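(* There exist positive constants $c_1, c_2, c_3$ such that the following hold. (a) Let $G = (V,E)$ be an $n$-vertex graph satisfying $\alpha(G)\delta(G) = O(n)$ and $\delta(G) > c_1 (\alpha(G) \log n)^2$. Then $G \cup \mathbb{G}(n,p)$ is a.a.s. pancyclic whenever $p := p(n) \geq \frac{c_2 \log n \,\log(\alpha(G) \log n)}{n \delta(G)}$. (b) For all integers $d := d(n) \geq 1$ and $k := k(n)$ with $k \to \infty$ as $n \to \infty$ and $k(d+1) \leq n$, there exists an $n$-vertex graph $H$ with $\alpha(H) = k$ and $\delta(H) = d$ such that a.a.s. $H \cup \mathbb{G}(n,p)$ is not Hamiltonian whenever $p := p(n) \leq \frac{c_3 \log k}{d n}$.
   Context: For an $n$-vertex graph $G$, $G \cup \mathbb{G}(n,p)$ denotes the union $G \cup R$ where $R$ is the binomial random graph on the vertex set $V(G)$ in which each pair of vertices is an edge independently with probability $p$. ''A.a.s.'' means with probability tending to $1$ as $n \to \infty$. $\alpha(G)$ is the independence number and $\delta(G)$ the minimum degree. A graph on $n$ vertices is Hamiltonian if it has a cycle through all vertices, and pancyclic if it contains a cycle of length $\ell$ for every $3 \leq \ell \leq n$. Asymptotic notation is with respect to $n \to \infty$. *)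

(* Defs.v *)
From Stdlib Require Import Reals.
From mathcomp Require Import all_boot all_order all_algebra.
From mathcomp Require Import Rstruct.

Set Implicit Arguments.
Unset Strict Implicit.
Unset Printing Implicit Defensive.

Definition is_graph (n : nat) (e : rel 'I_n) : Prop :=
  symmetric e /\ irreflexive e.

Definition indep_set (n : nat) (e : rel 'I_n) (S : {set 'I_n}) : bool :=
  [forall x in S, forall y in S, ~~ e x y].

Definition alpha (n : nat) (e : rel 'I_n) : nat :=
  \max_(S : {set 'I_n} | indep_set e S) #|S|.

Definition deg (n : nat) (e : rel 'I_n) (v : 'I_n) : nat := #|[set u | e v u]|.

Definition delta (n : nat) (e : rel 'I_n) : nat :=
  if n is 0 then 0 else \big[minn/n]_(v : 'I_n) deg e v.

Definition has_cycle_of_length (n : nat) (e : rel 'I_n) (l : nat) : bool :=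
  [exists s : l.-tuple 'I_n, uniq s && cycle e s].

Definition pancyclic (n : nat) (e : rel 'I_n) : bool :=
  [forall l : 'I_n.+1, (3 <= l)%N ==> has_cycle_of_length e l].

Definition hamiltonian (n : nat) (e : rel 'I_n) : bool :=
  (3 <= n)%N && has_cycle_of_length e n.

(* The binomial random graph G(n,p): its edge set is a set S of pairs (i,j)
   with i < j, each present independently with probability p. *)
Definition upper_pairs (n : nat) : {set 'I_n * 'I_n} :=
  [set ij : 'I_n * 'I_n | (val ij.1 < val ij.2)%N].

Definition graph_union (n : nat) (e : rel 'I_n) (S : {set 'I_n * 'I_n}) : rel 'I_n :=
  fun x y => [|| e x y, (x, y) \in S | (y, x) \in S].

Definition prob_union (n : nat) (e : rel 'I_n) (p : R) (P : rel 'I_n -> bool) : R :=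
  (\sum_(S : {set 'I_n * 'I_n} | (S \subset upper_pairs n) && P (graph_union e S))
     Rmult (pow p #|S|) (pow (Rminus 1 p) (#|upper_pairs n| - #|S|)))%R.

(* Main.v *)
Require Import Defs.
From Stdlib Require Import Reals Lra.
From mathcomp Require Import all_boot all_order all_algebra zify.
From mathcomp Require Import Rstruct.

(** Part (a). Split [G] recursively along separators with fewer than
    [k = d / 2a] vertices, where [a] and [d] are the independence number and the
    minimum degree. Independence numbers add up over the two sides, so at most
    [a] classes arise and fewer than [a k <= d / 2] vertices are removed; each
    removed vertex has at least [k] neighbours in some class and is put back
    there. Every class remains connected after deleting fewer than [k] vertices,
    and [k] is of order [a (log n)^2].

    With high probability the random edges contain two disjoint matchings each
    of which joins the classes into a connected structure: a forest is grown in
    about [log a] rounds, each round using fresh target vertices and at least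
    halving the number of components. The second matching serves to make all
    degrees even. The edges so chosen are linked inside the classes, always
    joining the two closest ends: if [r] ends are pairwise far apart, the even
    vertices of shortest paths between them form an independent set, so some link
    has length at most about [4 a / r], and the total length is of order
    [a log a < k]. This gives a cycle through all the chosen edges, which is
    extended to a Hamilton cycle by the exchange argument of Chvatal and Erdos.

    The Hamilton cycle can be made to contain a fan, i.e. a vertex [v] followed by
    a path of [2a + 2] neighbours of [v]. Skipping vertices inside the fan varies
    the length by up to [2a], while a chord of the remaining arc shortens it by
    at most [2a - 1]; hence all lengths occur.

    Part (b). [H] is a disjoint union of cliques, all but one with [d + 1]
    vertices; by the second moment method some small clique is isolated in the
    random graph. *)

(** The size of [p] comes from a union bound. A round of the forest can fail only if, for a set [I]
    of classes and a set [Z] of at most [5 * #|I|] excluded vertices, a rectangle of order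
    [#|I| * d * n / rho] pairs receives no random edge, where [rho], about [log a], is the number of
    rounds. There are [n ^ O(#|I|)] such choices, so [p] of order [rho * log n / (n * d)] is enough.
    Giving every round its own targets costs the factor [rho], but it keeps [Z] proportional to
    [#|I|], since targets of earlier rounds need not be excluded.

    Links consume the ends of a class in pairs, whence the parity correction. Careless links could
    also close a cycle too early. The classes are therefore ranked so that each one of positive rank
    has a chosen edge to a lower one, and links are made in the highest class that still has ends;
    this lasts until the two ends of one block remain in the lowest class.

    The exchange argument must not break the chosen edges. They are encoded, together with the fan
    contracted to one pair, by an involution, and the cycle is handled as a sequence of entries into
    blocks. *)

Set Implicit Arguments.
Unset Strict Implicit.
Unset Printing Implicit Defensive.

(** * Decomposition into highly connected classes *)

(* Keeps only arithmetic hypotheses: the preprocessing of [lia] is very slow on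
   contexts with membership and connectivity statements. *)
Ltac arith_only := repeat match goal with
  | x := _ |- _ => clearbody x
  | H : ?P |- _ =>
    lazymatch type of P with Prop =>
      lazymatch P with
      | is_true (leq _ _) => fail
      | is_true (~~ leq _ _) => fail
      | leq _ _ = _ => fail
      | @eq nat _ _ => fail
      | ~ @eq nat _ _ => fail
      | is_true (andb (leq _ _) (leq _ _)) => fail
      | is_true (@eq_op Datatypes_nat__canonical__eqtype_Equality _ _) => fail
      | is_true (negb (@eq_op Datatypes_nat__canonical__eqtype_Equality _ _)) => fail
      | is_true (odd _) => fail
      | is_true (~~ odd _) => fail
      | _ => clear H
      end
    end
  end.
Ltac lias := arith_only; unfold reverse_coercion in *; lia.
Ltac nias := arith_only; unfold reverse_coercion in *; nia.

Section Graph.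
Variables (T : finType) (e : rel T).
Hypotheses (esym : symmetric e) (eirr : irreflexive e).

Definition indep (S : {set T}) : bool := [forall x in S, forall y in S, ~~ e x y].

Lemma indepP (S : {set T}) :
  reflect {in S &, forall x y, ~~ e x y} (indep S).
Proof.
apply: (iffP forall_inP) => [h x y xS yS|h x xS]; first exact: (forall_inP (h x xS)).
by apply/forall_inP=> y; apply: h.
Qed.

Definition alpha_in (W : {set T}) : nat :=
  \max_(S : {set T} | (S \subset W) && indep S) #|S|.

Lemma alpha_inP (W S : {set T}) : S \subset W -> indep S -> #|S| <= alpha_in W.
Proof. by move=> sSW iS; apply: (@leq_bigmax_cond _ _ (fun S : {set T} => #|S|)); rewrite sSW. Qed.

Lemma alpha_in_ex (W : {set T}) :
  exists S : {set T}, [/\ S \subset W, indep S & #|S| = alpha_in W].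
Proof.
have h0 : (set0 \subset W) && indep set0.
  by rewrite sub0set; apply/indepP=> x y; rewrite inE.
have [|S /andP[sS iS] eqS] := @eq_bigmax_cond _ [pred S : {set T} | (S \subset W) && indep S]
  (fun S : {set T} => #|S|); first by rewrite (cardD1 set0) inE h0.
by exists S; split=> //; rewrite -eqS; apply: eq_bigl => S'; rewrite inE.
Qed.

Lemma alpha_in_disjoint (W A B : {set T}) :
  A \subset W -> B \subset W -> [disjoint A & B] ->
  {in A & B, forall x y, ~~ e x y} -> alpha_in A + alpha_in B <= alpha_in W.
Proof.
move=> sA sB dAB hAB.
have [S [sS /indepP iS <-]] := alpha_in_ex A; have [S' [sS' /indepP iS' <-]] := alpha_in_ex B.
have dS : [disjoint S & S'] by apply: disjointWl sS _; apply: disjointWr sS' _.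
rewrite -cardsUI; move: (dS); rewrite -setI_eq0 => /eqP ->; rewrite cards0 addn0.
apply: alpha_inP; first by rewrite subUset (subset_trans sS) ?(subset_trans sS').
apply/indepP=> x y; rewrite !inE => /orP[] xS /orP[] yS; first exact: iS.
- by apply: hAB; [apply: (subsetP sS)|apply: (subsetP sS')].
- by rewrite esym; apply: hAB; [apply: (subsetP sS)|apply: (subsetP sS')].
- exact: iS'.
Qed.

Definition inside (W : {set T}) : rel T := [rel x y | [&& x \in W, y \in W & e x y]].

Lemma inside_sym W : symmetric (inside W).
Proof. by move=> x y; rewrite /inside /= esym andbCA. Qed.

Lemma inside_csym W : connect_sym (inside W).
Proof. exact: (sym_connect_sym (inside_sym W)). Qed.

Lemma inside_mono (W W' : {set T}) x y :
  W \subset W' -> connect (inside W) x y -> connect (inside W') x y.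
Proof.
move=> /subsetP sW; apply: connect_sub => u v /= /and3P[uW vW euv].
by apply: connect1; rewrite /inside /= !sW.
Qed.

Lemma inside_connect_mem (W : {set T}) x y : x \in W -> connect (inside W) x y -> y \in W.
Proof.
move=> xW /connectP[p]; elim: p x xW => [|z p IH] x xW /=; first by move=> _ ->.
by move=> /andP[/and3P[_ zW _] pp]; apply: IH.
Qed.

Lemma inside_path_mem (W : {set T}) x p : path (inside W) x p -> {subset p <= W}.
Proof.
elim: p x => // y p IH x /= /andP[/and3P[_ yW _] /IH pW] z.
by rewrite inE => /orP[/eqP ->|/pW].
Qed.

(** No lower bound on the size of [W] is included, so singletons and the empty set qualify; the
    degree condition of [kgood] forces the size of a nonempty class. *)
Definition kconn k (W : {set T}) :=
  forall Z : {set T}, #|Z| < k ->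
  {in W :\: Z &, forall x y, connect (inside (W :\: Z)) x y}.

Definition nbrs x := [set y | e x y].

Definition kgood k (W : {set T}) :=
  {in W, forall x, k <= #|nbrs x :&: W|} /\ kconn k W.

Lemma alpha_in_gt0 (A : {set T}) x : x \in A -> 0 < alpha_in A.
Proof.
move=> xA; rewrite -(cards1 x); apply: alpha_inP; first by rewrite sub1set.
by apply/indepP=> y z; rewrite !inE => /eqP -> /eqP ->; rewrite eirr.
Qed.

(* Each split along a separator of fewer than [k] vertices distributes the
   independence number over the two sides, so it occurs fewer than
   [alpha_in W] times. *)
Lemma split_kconn k (W : {set T}) :
  exists (X : {set T}) (f : T -> nat),
  [/\ X \subset W, #|X| <= (alpha_in W).-1 * k,
      {in W :\: X, forall x, f x < alpha_in W},
      {in W :\: X &, forall x y, e x y -> f x = f y}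
    & forall i, kconn k [set x in W :\: X | f x == i]].
Proof.
have [N] := ubnP #|W|; elim: N W => // N IH W ltN.
have [->|/set0Pn[w0 w0W]] := eqVneq W set0.
  exists set0, (fun=> 0); split=> //; rewrite ?cards0 //.
  - by move=> x; rewrite !inE.
  - by move=> i Z _ x y; rewrite !inE /= andbF.
have [hW|] := boolP [forall Z : {set T}, (#|Z| < k) ==>
    [forall x in W :\: Z, forall y in W :\: Z, connect (inside (W :\: Z)) x y]].
  exists set0, (fun=> 0); rewrite setD0; split=> //; rewrite ?cards0 ?sub0set //.
  - by move=> x xW; apply: (alpha_in_gt0 xW).
  - move=> [|i] Z ltZ x y; last by rewrite !inE /= !andbF.
    have -> : [set x in W | 0 == 0] = W by apply/setP=> z; rewrite inE andbT.
    by move=> xW yW; have /implyP/(_ ltZ)/forall_inP/(_ x xW)/forall_inP/(_ y yW) := forallP hW Z.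
rewrite negb_forall => /existsP[Z]; rewrite negb_imply => /andP[ltZ].
rewrite negb_forall => /existsP[x]; rewrite negb_imply => /andP[xW].
rewrite negb_forall => /existsP[y]; rewrite negb_imply => /andP[yW nxy].
set A := [set z | connect (inside (W :\: Z)) x z].
set B := (W :\: Z) :\: A.
have sAZ : A \subset W :\: Z.
  by apply/subsetP=> z; rewrite inE; apply: inside_connect_mem.
have sA : A \subset W by apply: subset_trans sAZ (subsetDl _ _).
have sB : B \subset W by rewrite /B; apply: subset_trans (subsetDl _ _) (subsetDl _ _).
have xA : x \in A by rewrite inE connect0.
have yA : y \notin A by rewrite inE.
have yB : y \in B by rewrite in_setD yA yW.
have dAB : [disjoint A & B].
  by rewrite disjoints_subset; apply/subsetP=> z zA; rewrite in_setC in_setD zA.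
have eAB : {in A & B, forall u v, ~~ e u v}.
  move=> u v uA; rewrite in_setD => /andP[vA vW]; apply: contra vA => euv.
  rewrite inE; move: (uA); rewrite inE => /connect_trans; apply; apply: connect1.
  by rewrite /inside /= (subsetP sAZ) // vW.
have adAB := alpha_in_disjoint sA sB dAB eAB.
have a1 := alpha_in_gt0 xA; have b1 := alpha_in_gt0 yB.
have yW' : y \in W by apply: (subsetP sB).
have xW' : x \in W by apply: (subsetP sA).
have ltA : #|A| < N.
  apply: leq_trans (_ : #|W| <= N) => //; apply: proper_card; rewrite properE sA.
  by apply/subsetPn; exists y.
have ltB : #|B| < N.
  apply: leq_trans (_ : #|W| <= N) => //; apply: proper_card; rewrite properE sB.
  by apply/subsetPn; exists x => //; rewrite in_setD xA.
have [XA [fA [sXA cXA fAlt fAe fAk]]] := IH A ltA.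
have [XB [fB [sXB cXB fBlt fBe fBk]]] := IH B ltB.
pose X := (W :&: Z) :|: (XA :|: XB).
(* The shift keeps the labels of the two sides apart, so that each label class comes from one side
   only and inherits its connectivity. *)
pose f z := if z \in A then fA z else alpha_in A + fB z.
have memWX z : z \in W :\: X -> (z \in A :\: XA) || (z \in B :\: XB).
  rewrite !in_setD !in_setU in_setI !negb_or => /andP[/and3P[zZ zXA zXB] zW].
  by move: zZ; rewrite zW zXA zXB /= => ->; case: (z \in A).
have memA z : z \in A :\: XA -> z \in W :\: X.
  rewrite in_setD => /andP[zXA zA'].
  have := subsetP sAZ z zA'; rewrite !in_setD !in_setU in_setI (negPf zXA) => /andP[zZ ->].
  rewrite (negPf zZ) /= andbT; apply/negP => zXB.
  by have := subsetP sXB z zXB; rewrite in_setD zA'.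
have memB z : z \in B :\: XB -> z \in W :\: X.
  rewrite in_setD => /andP[zXB zB'].
  move: (zB'); rewrite !in_setD !in_setU in_setI (negPf zXB) => /andP[zA /andP[zZ ->]].
  rewrite (negPf zZ) /= orbF andbT; apply/negP => zXA.
  by have := subsetP sXA z zXA; rewrite (negPf zA).
have AnotB z : z \in B :\: XB -> (z \in A) = false.
  by rewrite !in_setD => /and3P[_ /negPf].
have AisA z : z \in A :\: XA -> z \in A by rewrite in_setD => /andP[].
exists X, f; split.
- rewrite !subUset subsetIl (subset_trans sXA) // (subset_trans sXB) //.
- have h1 : #|W :&: Z| <= k by apply: leq_trans (ltnW ltZ); rewrite subset_leq_card ?subsetIr.
  have h2 : #|X| <= k + ((alpha_in A).-1 * k + (alpha_in B).-1 * k).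
    rewrite (leq_trans (leq_card_setU _ _)) // leq_add // (leq_trans (leq_card_setU _ _)) //.
    by rewrite leq_add.
  apply: leq_trans h2 _; rewrite -mulnDl -[k + _]mulSn leq_mul2r; apply/orP; right.
  lias.
- move=> z /memWX /orP[zA|zB].
    rewrite /f AisA //; have := fAlt z zA; lias.
  rewrite /f AnotB //; have := fBlt z zB; lias.
- move=> u v /memWX /orP[uA|uB] /memWX /orP[vA|vB] euv.
  + by rewrite /f !AisA //; apply: fAe.
  + have uA' := AisA u uA; have vB' : v \in B by move: vB; rewrite in_setD => /andP[].
    by move: (eAB u v uA' vB'); rewrite euv.
  + have vA' := AisA v vA; have uB' : u \in B by move: uB; rewrite in_setD => /andP[].
    by move: (eAB v u vA' uB'); rewrite esym euv.
  + by rewrite /f !AnotB //; congr (_ + _); apply: fBe.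
- move=> i; case: (ltnP i (alpha_in A)) => hi.
    have -> : [set z in W :\: X | f z == i] = [set z in A :\: XA | fA z == i].
      apply/setP=> z; rewrite [LHS]in_set [RHS]in_set; apply/andP/andP => -[].
        move=> /memWX /orP[zA|zB]; first by rewrite /f AisA.
        by rewrite /f AnotB // => /eqP; lias.
      by move=> zA hz; rewrite memA // /f AisA.
    exact: fAk.
  have -> : [set z in W :\: X | f z == i] = [set z in B :\: XB | fB z == i - alpha_in A].
    apply/setP=> z; rewrite [LHS]in_set [RHS]in_set; apply/andP/andP => -[].
      move=> /memWX /orP[zA|zB]; last by rewrite /f AnotB // => /eqP <-; rewrite addKn.
      by rewrite /f AisA // => /eqP; have := fAlt z zA; lias.
    by move=> zB /eqP hz; rewrite memB // /f AnotB // hz subnKC.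
  exact: fBk.
Qed.

(** A removed vertex joins a class in which it has [k] neighbours; one of them survives the deletion
    of fewer than [k] vertices and ties it to the core of the class. Core vertices have no
    neighbours in other cores and lose at most [a * k] neighbours to the removed set. Restored
    vertices carry no such guarantee, hence the existential in the last clause. *)
Lemma kgood_colouring a d k :
  alpha_in setT <= a -> (forall x, d <= #|nbrs x|) -> 0 < k -> 2 * a * k <= d ->
  exists c : T -> nat,
  [/\ forall x, c x < a, forall i, kgood k [set x | c x == i]
    & forall x, exists2 y, c y = c x & d - a * k <= #|nbrs y :&: [set z | c z == c y]|].
Proof.
move=> ha hd k0 hk.
have [X [f [_ cX flt fe fk]]] := split_kconn k setT.
have {flt} flt x : x \notin X -> f x < a.
  by move=> xX; apply: leq_trans ha; apply: flt; rewrite !inE xX.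
have {fe} fe x y : x \notin X -> y \notin X -> e x y -> f x = f y.
  by move=> xX yX; apply: fe; rewrite !inE ?xX ?yX.
have {cX} cX : #|X| <= a * k by apply: leq_trans cX _; rewrite leq_mul2r; apply/orP; right; lias.
pose cls i := [set y | (y \notin X) && (f y == i)].
have hout x : d - a * k <= #|nbrs x :\: X|.
  rewrite cardsD; have := hd x; have := subset_leq_card (subsetIr (nbrs x) X); lias.
have hg x : x \in X -> exists i, (i < a) && (k <= #|nbrs x :&: cls i|).
  move=> xX; pose P (i : 'I_a) := k <= #|nbrs x :&: cls i|.
  have [/existsP[i hi]|/existsPn hn] := boolP [exists i, P i]; first by exists i; rewrite ltn_ord.
  (* Fewer than [k] neighbours in each of the [a] classes would give fewer than [a * k <= d - a * k]
     neighbours outside [X]. *)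
  have a0 : 0 < a by apply: leq_trans ha; apply: (@alpha_in_gt0 _ x).
  have sub : nbrs x :\: X \subset \bigcup_(i < a) (nbrs x :&: cls i).
    apply/subsetP=> y; rewrite !inE => /andP[yX exy].
    by apply/bigcupP; exists (Ordinal (flt y yX)); rewrite // !inE exy yX /=.
  have h1 : #|nbrs x :\: X| <= \sum_(i < a) k.-1.
    apply: leq_trans (subset_leq_card sub) _.
    apply: (big_ind2 (fun (A : {set T}) n => #|A| <= n)); rewrite ?cards0 //.
      by move=> A n B m hA hB; apply: leq_trans (leq_card_setU _ _) _; apply: leq_add.
    by move=> i _; have := hn i; rewrite /P -ltnNge; lias.
  rewrite sum_nat_const card_ord in h1; have := hout x.
  have : a * k.-1 < a * k by rewrite ltn_mul2l a0 ltn_predL.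
  lias.
pose g x := if (x \in X) =P true is ReflectT h then ex_minn (hg x h) else f x.
have gX x : x \in X -> (g x < a) && (k <= #|nbrs x :&: cls (g x)|).
  by move=> xX; rewrite /g; case: eqP => // h; case: ex_minnP.
have gN x : x \notin X -> g x = f x by rewrite /g; case: eqP => // h; rewrite h.
have sub_cls i : cls i \subset [set x | g x == i].
  by apply/subsetP=> y; rewrite !inE => /andP[yX]; rewrite gN.
have core x : x \notin X -> d - a * k <= #|nbrs x :&: cls (g x)|.
  move=> xX; apply: leq_trans (hout x) _; apply: subset_leq_card.
  apply/subsetP=> y; rewrite !inE => /andP[yX exy]; rewrite exy yX gN //=.
  by rewrite (fe x y).
have gnbr x : k <= #|nbrs x :&: cls (g x)|.
  have [xX|xX] := boolP (x \in X); first by case/andP: (gX x xX).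
  apply: leq_trans (core x xX).
  have : 0 < a by exact: leq_ltn_trans (flt x xX).
  nias.
exists g; split.
- by move=> x; have [xX|xX] := boolP (x \in X); [case/andP: (gX x xX)|rewrite gN ?flt].
- move=> i; split.
    move=> x; rewrite inE => /eqP <-; apply: leq_trans (gnbr x) _.
    by apply: subset_leq_card; apply: setIS.
  move=> Z ltZ.
  have toC x : x \in [set x | g x == i] :\: Z -> exists2 y, y \in cls i :\: Z
      & connect (inside ([set x | g x == i] :\: Z)) x y.
    move=> xi; have [xX|xX] := boolP (x \in X); last first.
      by exists x; rewrite ?connect0 //; move: xi; rewrite !inE gN // xX.
    have : 0 < #|(nbrs x :&: cls (g x)) :\: Z|.
      rewrite cardsD; have := gnbr x; have := subset_leq_card (subsetIr (nbrs x :&: cls (g x)) Z).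
      lias.
    have gx : g x = i by move: xi; rewrite !inE => /andP[_ /eqP].
    rewrite gx => /card_gt0P[y yin]; exists y.
      by move: yin; rewrite !inE => /and3P[-> _ ->].
    apply: connect1; rewrite /inside /= xi; move: yin; rewrite in_setD in_setI => /and3P[yZ yn yc].
    by rewrite inE yZ (subsetP (sub_cls i)) //=; move: yn; rewrite inE.
  have scl : cls i :\: Z \subset [set x | g x == i] :\: Z by apply: setSD.
  move=> x y /toC[x' x'C xx'] /toC[y' y'C yy'].
  apply: connect_trans xx' _; rewrite inside_csym; apply: connect_trans yy' _.
  apply: inside_mono scl _.
  have := fk i Z ltZ y' x'; have -> : [set x in setT :\: X | f x == i] = cls i.
    by apply/setP=> z; rewrite !inE andbT.
  exact.
- have main y : y \notin X -> d - a * k <= #|nbrs y :&: [set z | g z == g y]|.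
    move=> yX; apply: leq_trans (core y yX) _; apply: subset_leq_card.
    by apply: setIS; apply: sub_cls.
  move=> x; have [xX|xX] := boolP (x \in X); last by exists x; rewrite ?main.
  have : 0 < #|nbrs x :&: cls (g x)| by apply: leq_trans (gnbr x).
  move=> /card_gt0P[y]; rewrite in_setI [y \in cls _]inE => /andP[_ /andP[yX /eqP fy]].
  by exists y; [rewrite gN | apply: main].
Qed.
End Graph.

(** * Short links and long paths *)

Section Shortest.
Variables (T : finType) (r : rel T).

Lemma shortest_path x y : connect r x y ->
  exists p, [/\ path r x p, last x p = y
    & forall q, path r x q -> last x q = y -> size p <= size q].
Proof.
move=> /connectP[p0 p0r p0l].
pose P n := [exists p : n.-tuple T, path r x p && (last x p == y)].
have exP : exists n, P n.
  by exists (size p0); apply/existsP; exists (in_tuple p0); rewrite p0r p0l eqxx.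
case: (ex_minnP exP) => n /existsP[p /andP[pr /eqP pl]] nmin.
exists p; split=> // q qr ql; rewrite size_tuple; apply: nmin.
by apply/existsP; exists (in_tuple q); rewrite qr ql eqxx.
Qed.

Lemma path_prefix x p i : path r x p -> i <= size p ->
  exists q, [/\ path r x q, last x q = nth x (x :: p) i & size q = i].
Proof.
move=> pr ip; exists (take i p); split; last by rewrite size_takel.
  by move: pr; rewrite -{1}(cat_take_drop i p) cat_path => /andP[].
case: i ip => [|i] ip; first by rewrite take0.
by rewrite /= (take_nth x) // last_rcons.
Qed.

Lemma path_suffix x p i : path r x p -> i <= size p ->
  exists q, [/\ path r (nth x (x :: p) i) q, last (nth x (x :: p) i) q = last x p
     & size q = size p - i].
Proof.
move=> pr ip; exists (drop i p); rewrite size_drop.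
have [q [_ ql _]] := path_prefix pr ip.
have lt : last x (take i p) = nth x (x :: p) i.
  case: i ip {ql} => [|i] ip; first by rewrite take0.
  by rewrite /= (take_nth x) // last_rcons.
split=> //; rewrite -lt.
  by move: pr; rewrite -{1}(cat_take_drop i p) cat_path => /andP[].
by rewrite -{3}(cat_take_drop i p) last_cat.
Qed.

(** A repetition, or a chord that skips vertices, would be a shortcut. *)
Lemma shortest_chord x p i j : path r x p ->
  (forall q, path r x q -> last x q = last x p -> size p <= size q) ->
  i < j <= size p ->
  (nth x (x :: p) i != nth x (x :: p) j) /\
  (r (nth x (x :: p) i) (nth x (x :: p) j) -> j = i.+1).
Proof.
move=> pr pmin /andP[ij jp].
have [q1 [q1r q1l q1s]] := path_prefix pr (ltnW (leq_trans ij jp)).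
have [q2 [q2r q2l q2s]] := path_suffix pr jp.
split.
  apply/eqP=> eqij; have := pmin (q1 ++ q2); rewrite cat_path q1r q1l eqij q2r last_cat q1l eqij.
  by move=> /(_ isT q2l); rewrite size_cat; lia.
move=> rij; have := pmin (q1 ++ nth x (x :: p) j :: q2).
rewrite cat_path /= q1r q1l rij q2r last_cat /= => /(_ isT q2l).
rewrite size_cat /=; lia.
Qed.
End Shortest.

Section Link.
Variables (T : finType) (e : rel T) (a : nat).
Hypotheses (esym : symmetric e) (eirr : irreflexive e).
Hypothesis ha : forall S, indep e S -> #|S| <= a.

Lemma path_rev_sym (r : rel T) x p : symmetric r -> path r x p ->
  exists q, [/\ path r (last x p) q, last (last x p) q = x & size q = size p].
Proof.
move=> rsym pr; exists (rev (belast x p)); split; last by rewrite size_rev size_belast.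
  by rewrite (@rev_path _ r) (eq_path (e' := r)) // => u v; rewrite rsym.
case: p pr => //= y p _.
by rewrite rev_cons last_rcons.
Qed.

(* If no two of the vertices in [Y] were close, the even vertices of initial
   segments of shortest paths issued from them would form an independent set. *)
Lemma short_link k (W X Y : {set T}) h :
  kgood e k W -> #|X| < k -> Y \subset W -> 1 < #|Y| -> 0 < h <= #|Y| ->
  exists z z' Q, [/\ z \in Y, z' \in Y, z != z', path e z (rcons Q z') &
   [/\ {subset Q <= W :\: X}, uniq Q, Q != [::] & size Q <= 4 * (a %/ h) + 2]].
Proof.
move=> [hdeg hcon] ltX sYW Y2 /andP[h0 hY].
pose r := inside e (W :\: X); have rsym : symmetric r by exact: inside_sym.
have exy z : exists y, z \in Y -> (y \in W :\: X) && e z y.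
  have [zY|zY] := boolP (z \in Y); last by exists z.
  have : 0 < #|(nbrs e z :&: W) :\: X|.
    rewrite cardsD; have := hdeg z (subsetP sYW z zY).
    have := subset_leq_card (subsetIr (nbrs e z :&: W) X); lia.
  move=> /card_gt0P[y]; rewrite in_setD !in_setI => /and3P[yX yz yW]; exists y => _.
  by rewrite in_setD yX yW; move: yz; rewrite inE.
have [y yP] : exists y, forall z, z \in Y -> (y z \in W :\: X) && e z (y z).
  exact: (fin_all_exists (P := fun z y => z \in Y -> (y \in W :\: X) && e z y)).
have yWX z : z \in Y -> y z \in W :\: X by case/yP/andP.
have eyz z : z \in Y -> e z (y z) by case/yP/andP.
(* The [m + 1] even positions on at least [h] paths give more than [a] vertices. If two of them on
   different paths coincided or were adjacent, the starting points would be joined by a walk of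
   length at most [4 * m + 1 < L]. *)
set m := a %/ h; pose L := 4 * m + 2.
pose short (zz : T * T) := [exists n : 'I_L, exists p : n.-tuple T,
  path r (y zz.1) p && (last (y zz.1) p == y zz.2)].
have shortI z z' p : path r (y z) p -> last (y z) p = y z' -> size p < L -> short (z, z').
  move=> pr pl ps; apply/existsP; exists (Ordinal ps); apply/existsP; exists (in_tuple p).
  by rewrite pr pl eqxx.
have [/existsP[z /existsP[z' /and4P[zY z'Y nzz /existsP[n /existsP[p /andP[pr /eqP pl]]]]]]|] :=
  boolP [exists z, exists z', [&& z \in Y, z' \in Y, z != z' & short (z, z')]].
  move: pl; rewrite /=; case: (shortenP pr) => q qr qu qs ql.
  exists z, z', (y z :: q); split=> //.
    have qe : path e (y z) q by apply: sub_path qr => u v; rewrite /r /inside /= => /and3P[].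
    by rewrite rcons_cons /= eyz // rcons_path qe ql esym eyz.
  split=> //; last first.
    have := uniq_leq_size (proj2 (andP qu)) qs; rewrite size_tuple /=; have := ltn_ord n.
    by rewrite /L; lia.
  move=> u; rewrite inE => /orP[/eqP ->|uq]; first exact: yWX.
  exact: inside_path_mem qr u uq.
move=> /existsPn hn.
have far z z' p : z \in Y -> z' \in Y -> z != z' -> path r (y z) p -> last (y z) p = y z' ->
    L <= size p.
  move=> zY z'Y nzz pr pl; have := hn z; rewrite negb_exists => /forallP/(_ z').
  by rewrite zY z'Y nzz /= leqNgt; apply: contra; apply: shortI pr pl.
pose sp z p := z \in Y -> [/\ path r (y z) p, L <= size p &
    forall q, path r (y z) q -> last (y z) q = last (y z) p -> size p <= size q].
have exp z : exists p : seq T, sp z p.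
  have [zY|zY] := boolP (z \in Y); last by exists [::]; rewrite /sp (negPf zY).
  have : 0 < #|Y :\ z| by move: Y2; rewrite (cardsD1 z) zY.
  move=> /card_gt0P[z']; rewrite !inE => /andP[nz z'Y].
  have [|p [pr pl pmin]] := @shortest_path T r (y z) (y z').
    by apply: hcon => //; apply: yWX.
  exists p => _; split=> //; first by apply: (far z z') => //; rewrite eq_sym.
  by rewrite pl.
have [p pP] := fin_all_exists exp.
pose node (zi : T * 'I_m.+1) := nth (y zi.1) (y zi.1 :: p zi.1) (2 * zi.2).
have nodeP zi zi' : zi.1 \in Y -> zi'.1 \in Y -> zi != zi' ->
    (node zi != node zi') && ~~ r (node zi) (node zi').
  have same z (i j : 'I_m.+1) : z \in Y -> i < j ->
     (node (z, i) != node (z, j)) && ~~ r (node (z, i)) (node (z, j)).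
    move=> zY ij; have [pr pL pmin] := pP z zY.
    have [|h1 h2] := @shortest_chord T r (y z) (p z) (2 * i) (2 * j) pr pmin.
      by have := ltn_ord j; move: pL ij; rewrite /L; lias.
    by rewrite /node /= h1 /=; apply/negP=> /h2; move: ij; lias.
  case: zi zi' => [z i] [z' j] /= zY z'Y; have [->|nzz] := eqVneq z z'.
    rewrite xpair_eqE eqxx /= -val_eqE /= neq_ltn => /orP[] ij; first exact: same.
    by rewrite eq_sym rsym; apply: same.
  move=> _; have [pr pL pmin] := pP z zY; have [pr' pL' pmin'] := pP z' z'Y.
  have [|q [qr ql qs]] := @path_prefix T r (y z) (p z) (2 * i) pr.
    by have := ltn_ord i; move: pL; rewrite /L; lias.
  have [|q' [qr' ql' qs']] := @path_prefix T r (y z') (p z') (2 * j) pr'.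
    by have := ltn_ord j; move: pL'; rewrite /L; lias.
  have [q2 [q2r q2l q2s]] := path_rev_sym rsym qr'.
  have bnd : 2 * i + 1 + 2 * j < L by have := ltn_ord j; have := ltn_ord i; rewrite /L; lias.
  apply/andP; split; apply/negP; rewrite /node /= => hnode.
    have := far z z' (q ++ q2) zY z'Y nzz; rewrite cat_path qr ql (eqP hnode) -ql' q2r last_cat ql.
    by rewrite (eqP hnode) -ql' => /(_ isT q2l); rewrite size_cat qs q2s qs'; move: bnd; lias.
  have := far z z' (q ++ last (y z') q' :: q2) zY z'Y nzz; rewrite cat_path /= qr ql q2r ql' hnode.
  rewrite last_cat /= -ql' => /(_ isT q2l); rewrite size_cat /= qs q2s qs'; move: bnd; lias.
pose D := setX Y [set: 'I_m.+1].
have inD zi : zi \in D -> zi.1 \in Y by rewrite inE => /andP[].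
have injn : {in D &, injective node}.
  move=> u v /inD uY /inD vY euv; apply/eqP/negPn/negP => nuv.
  by have := nodeP u v uY vY nuv; rewrite euv eqxx.
have nodeW u : u \in D -> node u \in W :\: X.
  case: u => z i /inD /= zY; have [pr pL _] := pP z zY; rewrite /node /=.
  case: (posnP (2 * i)) => [->|]; first exact: yWX.
  move=> i0; rewrite -(prednK i0) /=; apply: (inside_path_mem pr); apply: mem_nth.
  by apply: leq_trans pL; have := ltn_ord i; rewrite /L; lias.
have : indep e (node @: D).
  apply/indepP=> _ _ /imsetP[u uD ->] /imsetP[v vD ->].
  have [->|nuv] := eqVneq u v; first by rewrite eirr.
  have := nodeP u v (inD u uD) (inD v vD) nuv; rewrite /r /inside /= !nodeW //=.
  by case/andP.
move=> /ha; rewrite card_in_imset // cardsX cardsT card_ord.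
have : a < h * m.+1 by rewrite mulnC -ltn_divLR.
have : h * m.+1 <= #|Y| * m.+1 by rewrite leq_mul2r hY orbT.
lias.
Qed.

(* A path that cannot be prolonged in [W] ends in a vertex without neighbour
   in the rest of [W], so its removal decreases the independence number. *)
Lemma long_path m b (W : {set T}) :
  (forall S : {set T}, S \subset W -> indep e S -> #|S| <= b) -> b * m < #|W| ->
  exists s, [/\ uniq s, {subset s <= W}, size s = m.+1 & sorted e s].
Proof.
elim: b W => [|b IH] W hb ltW.
  have /card_gt0P[x xW] : 0 < #|W| by [].
  have := hb [set x]; rewrite sub1set xW cards1 => /(_ isT) h; exfalso.
  suff /h : indep e [set x] by [].
  by apply/indepP=> u v; rewrite !inE => /eqP -> /eqP ->; rewrite eirr.
have [/existsP[s /and3P[su sW se]]|] := boolP [exists s : (m.+1).-tuple T,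
   [&& uniq s, all [in W] s & sorted e s]].
  by exists s; split=> //; [apply/allP|rewrite size_tuple].
move=> /existsPn hno.
pose P n := [exists s : n.-tuple T, [&& uniq s, all [in W] s & sorted e s]].
have Pm n : P n -> n <= m.
  move=> /existsP[s /and3P[su sW se]]; rewrite leqNgt; apply/negP=> mn.
  have sz : size (take m.+1 s) == m.+1 by rewrite size_takel // size_tuple.
  have := hno (Tuple sz); rewrite /= take_uniq // take_sorted // andbT.
  by rewrite (_ : all _ _) //; apply/allP => x /mem_take /(allP sW).
have P0 : P 0 by apply/existsP; exists [tuple].
case: (ex_maxnP (ex_intro P 0 P0) Pm) => n /existsP[s /and3P[su sW se]] nmax.
have n_m := Pm n (introT existsP (ex_intro _ s (introT and3P (And3 su sW se)))).
have ss := size_tuple s.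
have ext x p : x :: p = s -> forall z, z \in W -> z \notin s -> ~~ e (last x p) z.
  move=> eqs z zW zs; apply/negP=> elz.
  suff : n.+1 <= n by rewrite ltnn.
  have sz : size (rcons s z) == n.+1 by rewrite size_rcons ss.
  apply: nmax; apply/existsP; exists (Tuple sz) => /=.
  rewrite rcons_uniq zs su all_rcons [z \in W]zW sW /=.
  by rewrite -eqs /= rcons_path elz andbT; move: se; rewrite -eqs.
case eqs : (val s) => [|x p].
  have n0 : n = 0 by rewrite -ss eqs.
  have /card_gt0P[x xW] : 0 < #|W| by apply: leq_ltn_trans ltW.
  suff : 1 <= n by rewrite n0.
  by apply: nmax; apply/existsP; exists [tuple x]; rewrite /= andbT andbT.
have meq z : (z \in s) = (z \in x :: p) by rewrite -eqs.
have lW : last x p \in W by apply: (allP sW); rewrite meq mem_last.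
have [||s' [s'u s'W s's s'e]] := IH (W :\: [set z in s]).
- move=> S sS iS; have lS : last x p \notin S.
    by apply/negP=> /(subsetP sS); rewrite in_setD inE meq mem_last.
  have := hb (last x p |: S); rewrite cardsU1 lS; apply.
    by rewrite subUset sub1set lW; apply: subset_trans sS (subsetDl _ _).
  have nl z : z \in S -> ~~ e (last x p) z.
    by move=> /(subsetP sS); rewrite in_setD inE => /andP[zs zW]; apply: ext.
  apply/indepP=> u v; rewrite !inE => /orP[/eqP->|uS] /orP[/eqP->|vS].
  + by rewrite eirr.
  + exact: nl.
  + by rewrite esym nl.
  + by move/indepP: iS; apply.
- have : #|[set z in s]| <= n by rewrite cardsE; apply: leq_trans (card_size _) _; rewrite size_tuple.
  rewrite cardsD; have := subset_leq_card (subsetIr W [set z in s]); move: ltW; rewrite mulSn.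
  move: n_m; lias.
- by exists s'; split=> // z /s'W; rewrite inE => /andP[].
Qed.
End Link.

(** * Cycles through prescribed blocks *)

Section Blocks.
Variables (T : finType) (e : rel T) (c : T -> nat).
Hypotheses (esym : symmetric e) (eirr : irreflexive e).

(* An involution [m] encodes disjoint oriented blocks: entering a block at [x]
   one leaves it at [m x]; fixed points are blocks reduced to one vertex. A
   cyclic sequence of entries is valid when consecutive blocks are joined by an
   edge of [e] inside one colour class and no block is traversed twice. *)
Definition brel (m : T -> T) : rel T := [rel x y | e (m x) y && (c (m x) == c y)].

Definition valid (m : T -> T) (s : seq T) :=
  [/\ cycle (brel m) s, uniq s & {in s, forall x, m x \in s -> m x = x}].

Definition terms (m : T -> T) := [set x | m x != x].

Lemma brel_flip m x y : involutive m -> brel m (m y) (m x) = brel m x y.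
Proof. by move=> mK; rewrite /brel /= mK esym eq_sym. Qed.

(** Traversed backwards, the cycle enters every block at its other end. *)
Lemma valid_flip m s : involutive m -> valid m s -> valid m (rev (map m s)).
Proof.
move=> mK [cs us ms]; split.
- rewrite rev_cycle cycle_map; rewrite -(eq_cycle (e := brel m)) // => x y.
  by rewrite -(brel_flip _ _ mK).
- by rewrite rev_uniq map_inj_uniq //; apply: inv_inj.
- move=> x; rewrite !mem_rev => /mapP[y ys ->]; rewrite mK => /mapP[z zs yz].
  by rewrite [RHS]ms // yz mK.
Qed.

Lemma valid_rot m s i : valid m s -> valid m (rot i s).
Proof.
move=> [cs us ms]; split; rewrite ?rot_cycle ?rot_uniq //.
by move=> x; rewrite !mem_rot; apply: ms.
Qed.

(** A link from [z] to [z'] fuses their blocks into one with ends [m z] and [m z']. The inner points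
    [z] and [z'] become fixed points, so they have to be kept off the cycle separately. *)
Definition splice (m : T -> T) (z z' x : T) :=
  if (x == z) || (x == z') then x
  else if x == m z then m z' else if x == m z' then m z else m x.

Section Merge.
Variables (m : T -> T) (z z' : T).
Hypotheses (mK : involutive m) (tz : m z != z) (tz' : m z' != z').
Hypotheses (nzz : z != z') (nmz : z' != m z).

Let nmm : (m z == m z') = false.
Proof. by rewrite (inj_eq (inv_inj mK)) (negPf nzz). Qed.
Let nmz' : (m z' == z) = false.
Proof. by rewrite -(inj_eq (inv_inj mK)) mK (negPf nmz). Qed.
Let nmz2 : (m z == z') = false.
Proof. by rewrite eq_sym (negPf nmz). Qed.

Lemma splice_z : splice m z z' z = z.
Proof. by rewrite /splice eqxx. Qed.

Lemma splice_z' : splice m z z' z' = z'.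
Proof. by rewrite /splice eqxx orbT. Qed.

Lemma splice_mz : splice m z z' (m z) = m z'.
Proof. by rewrite /splice (negPf tz) nmz2 eqxx. Qed.

Lemma splice_mz' : splice m z z' (m z') = m z.
Proof. by rewrite /splice (negPf tz') nmz' eqxx eq_sym nmm. Qed.

Lemma splice_other x : x != z -> x != z' -> x != m z -> x != m z' -> splice m z z' x = m x.
Proof. by rewrite /splice => /negPf -> /negPf -> /negPf -> /negPf ->. Qed.

Lemma splice_inv : involutive (splice m z z').
Proof.
move=> x.
have [->|n1] := eqVneq x z; first by rewrite !splice_z.
have [->|n2] := eqVneq x z'; first by rewrite !splice_z'.
have [->|n3] := eqVneq x (m z); first by rewrite splice_mz splice_mz'.
have [->|n4] := eqVneq x (m z'); first by rewrite splice_mz' splice_mz.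
rewrite [X in splice _ _ _ X]splice_other // splice_other ?mK // ?(inj_eq (inv_inj mK)) //.
  by rewrite -(inj_eq (inv_inj mK)) mK.
by rewrite -(inj_eq (inv_inj mK)) mK.
Qed.

Lemma terms_splice : terms (splice m z z') = terms m :\: [set z; z'].
Proof.
apply/setP=> x; rewrite !inE.
have [->|n1] := eqVneq x z; first by rewrite splice_z eqxx.
have [->|n2] := eqVneq x z'; first by rewrite splice_z' eqxx.
have [->|n3] := eqVneq x (m z); first by rewrite splice_mz mK eq_sym nmm eq_sym tz.
have [->|n4] := eqVneq x (m z'); first by rewrite splice_mz' mK nmm eq_sym tz'.
by rewrite splice_other.
Qed.

(** In a cycle that enters the fused block at [m z], this entry is replaced by [m z], the link [Q]
    and [z']: the first block is left at [z], the second is entered at [z'] and left at [m z'],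
    where the fused block was left. *)
Lemma unsplice_oriented Q s : valid (splice m z z') s ->
  path e z (rcons Q z') -> {in Q, forall x, c x = c z} -> c z' = c z -> uniq Q ->
  {in Q, forall x, m x = x} -> {in z :: z' :: Q, forall x, x \notin s} -> m z \in s ->
  exists s', [/\ valid m s', {subset s' <= z' :: Q ++ s}, z' \in s' & {subset s <= s'}].
Proof.
move=> [cs us ms] pQ cQ cz' uQ mQ nQ azs.
have [i s0 eqs] := rot_to azs.
have {cs} cs : cycle (brel (splice m z z')) (m z :: s0) by rewrite -eqs rot_cycle.
have {us} us : uniq (m z :: s0) by rewrite -eqs rot_uniq.
have mem x : (x \in s) = (x \in m z :: s0) by rewrite -eqs mem_rot.
have zs0 x : x \in s0 -> x \in s by rewrite mem inE => ->; rewrite orbT.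
(* The fused block has the ends [m z] and [m z'], and a valid cycle enters it only once. *)
have bz : m z' \notin s.
  by apply/negP=> bs; have := ms (m z) azs; rewrite splice_mz => /(_ bs)/eqP; rewrite eq_sym nmm.
have nez x : x \in s0 -> [/\ x != z, x != z', x != m z & x != m z'].
  move=> xs0; have xs := zs0 x xs0; split; apply/eqP=> eqx.
  - by have := nQ z; rewrite inE eqxx -eqx xs => /(_ isT).
  - by have := nQ z'; rewrite !inE eqxx orbT -eqx xs => /(_ isT).
  - by move: us; rewrite /= -eqx xs0.
  - by move: bz; rewrite -eqx xs.
have msame x : x \in s0 -> splice m z z' x = m x by move=> /nez[]; apply: splice_other.
have nQs x : x \in Q -> x \notin s by move=> xQ; apply: nQ; rewrite !inE xQ !orbT.
have zns : z \notin s by apply: nQ; rewrite inE eqxx.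
have z'ns : z' \notin s by apply: nQ; rewrite !inE eqxx orbT.
have zQ : z \notin Q by apply/negP=> /mQ/eqP; rewrite (negPf tz).
have z'Q : z' \notin Q by apply/negP=> /mQ/eqP; rewrite (negPf tz').
exists (m z :: Q ++ z' :: s0); split.
- split.
  + move: cs; rewrite /= rcons_cat cat_path /= rcons_path => /andP[p0 l0].
    have pQ' : path (brel m) (m z) (rcons Q z').
      have gen x R : path e x (rcons R z') -> c x = c z -> {in R, forall y, c y = c z} ->
          {in R, forall y, m y = y} -> forall y, m y = x -> path (brel m) y (rcons R z').
        elim: R x => [|w R IH] x /=.
          by move=> /andP[ex _] cx _ _ y my; rewrite /brel /= my ex cx cz' eqxx.
        move=> /andP[ex pR] cx cR mR y my; rewrite /brel /= my ex cx (cR w) ?inE ?eqxx //=.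
        apply: (IH w pR); rewrite ?cR ?mR ?inE ?eqxx //.
          by move=> u uR; apply: cR; rewrite inE uR orbT.
        by move=> u uR; apply: mR; rewrite inE uR orbT.
      by apply: (gen z) => //; rewrite mK.
    move: pQ'; rewrite rcons_path => /andP[-> lz'] /=; rewrite lz' /= rcons_path.
    have E0 x y : x \in s0 -> brel m x y = brel (splice m z z') x y.
      by move=> xs0; rewrite /brel /= msame.
    have Ez y : brel m z' y = brel (splice m z z') (m z) y by rewrite /brel /= splice_mz.
    case: s0 p0 l0 E0 {eqs us mem zs0 nez msame} => [|w s0] /=; first by rewrite Ez.
    move=> /andP[p1 p2] l0 E0; rewrite Ez p1 /= E0 ?mem_last // l0 andbT.
    elim: s0 w p2 E0 {p1 l0} => //= w' s0 IH w /andP[q1 q2] E0.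
    rewrite E0 ?inE ?eqxx // q1 /=; apply: IH => // x y xs; apply: E0.
    by rewrite inE xs orbT.
  + move: us; rewrite /= cat_uniq mem_cat inE !negb_or => /andP[a1 a2].
    rewrite uQ a1 nmz2 /= andbT (contraL (@nQs _)) //= a2 andbT.
    rewrite z'Q /=; apply/andP; split; last by apply: contra z'ns; apply: zs0.
    by apply/hasPn=> x xs0; apply/negP=> /nQs; rewrite zs0.
  + move=> x; rewrite inE => /orP[/eqP->|].
      rewrite mK inE mem_cat inE (negPf nzz) (negPf zQ) /= [z == _]eq_sym (negPf tz) /=.
      by move=> /zs0; rewrite (negPf zns).
    rewrite mem_cat => /orP[/mQ //|]; rewrite inE => /orP[/eqP->|xs0].
      rewrite inE mem_cat inE eq_sym nmm (negPf tz') /= => /orP[/mQ/eqP|/zs0].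
        by rewrite mK eq_sym (negPf tz').
      by rewrite (negPf bz).
    have [n1 n2 n3 n4] := nez x xs0.
    rewrite inE mem_cat inE (inj_eq (inv_inj mK)) (negPf n1) /= => /or3P[/mQ|/eqP mx|mx].
    * by rewrite mK.
    * by move: n4; rewrite -mx mK eqxx.
    * by rewrite -(msame x xs0) ms ?zs0 // msame // zs0.
- move=> x; rewrite !(inE, mem_cat) => /or4P[/eqP->|->|->|/zs0 ->]; rewrite ?orbT //.
  by rewrite azs !orbT.
- by rewrite inE mem_cat inE eqxx !orbT.
- by move=> x; rewrite mem !(inE, mem_cat) => /orP[->|->]; rewrite ?orbT.
Qed.

(** A cycle that enters the fused block at [m z'] is first reversed by [valid_flip]; this is why
    images under the splice appear among the possible vertices of the result. *)
Lemma unsplice Q s : valid (splice m z z') s ->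
  path e z (rcons Q z') -> {in Q, forall x, c x = c z} -> c z' = c z -> uniq Q ->
  {in Q, forall x, m x = x} -> {in z :: z' :: Q, forall x, x \notin s} ->
  (m z \in s) || (m z' \in s) ->
  exists s', [/\ valid m s', {subset s' <= z' :: Q ++ s ++ map (splice m z z') s}, z' \in s' &
     forall x, (x \in s) || (splice m z z' x \in s) -> (x \in s') || (splice m z z' x \in s')].
Proof.
move=> vs pQ cQ cz' uQ mQ nQ /orP[azs|bzs].
  have [s' [v1 v2 v3 v4]] := unsplice_oriented vs pQ cQ cz' uQ mQ nQ azs.
  exists s'; split=> //.
    by move=> x /v2; rewrite !(inE, mem_cat) => /or3P[] ->; rewrite ?orbT.
  by move=> x /orP[/v4 ->|/v4 ->] //; rewrite orbT.
have vs' := valid_flip splice_inv vs.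
have memf x : (x \in rev (map (splice m z z') s)) = (splice m z z' x \in s).
  by rewrite mem_rev -{1}[x]splice_inv mem_map //; apply: (inv_inj splice_inv).
have [||s' [v1 v2 v3 v4]] := unsplice_oriented vs' pQ cQ cz' uQ mQ.
- move=> x xQ; rewrite memf; suff -> : splice m z z' x = x by exact: nQ.
  move: xQ; rewrite !inE => /or3P[/eqP->|/eqP->|xQ]; rewrite ?splice_z ?splice_z' //.
  have := mQ x xQ => mx; rewrite splice_other //; apply/eqP=> eqx; move: mx; rewrite eqx ?mK; apply/eqP => //.
  + by rewrite eq_sym.
  + by rewrite eq_sym.
- by rewrite memf splice_mz.
exists s'; split=> //.
  move=> x /v2; rewrite !(inE, mem_cat) mem_rev => /or3P[] ->; rewrite ?orbT //.
move=> x /orP[xs|xs].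
  by rewrite [X in _ || X]v4 ?orbT // memf splice_inv.
by rewrite v4 // memf.
Qed.
End Merge.
End Blocks.

Section BlockCycle.
Variables (T : finType) (e : rel T) (c : T -> nat) (W : {set T}) (a k : nat).
Hypotheses (esym : symmetric e) (eirr : irreflexive e).
Hypothesis ha : forall S, indep e S -> #|S| <= a.

Definition cls u := [set x in W | c x == u].
Hypothesis good : forall u, kgood e k (cls u).

(* Budget of vertices sufficient to link [2 h] block ends of one class in pairs. *)
Definition link_cost h := \sum_(i < h) (4 * (a %/ i.+1) + 2).

Lemma link_costS h : link_cost h.+1 = link_cost h + (4 * (a %/ h.+1) + 2).
Proof. by rewrite /link_cost big_ord_recr. Qed.

(* [Y] contains one end of every block with both ends in the class, and the ends
   of the blocks that leave it. If at most two blocks leave the class while some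
   stay in it, only one leaving end is offered, since joining two would cut the
   class off. *)
Lemma choose_ends (m : T -> T) v : involutive m -> terms m \subset W ->
  terms m :&: cls v != set0 -> ~~ odd #|terms m :&: cls v| ->
  (0 < v -> exists2 z, z \in terms m :&: cls v & c (m z) != v) ->
  (exists z, [/\ terms m :&: cls v = [set z; m z], m z != z & forall x, x \in terms m :&: cls v -> c (m x) = v]) \/
  exists Y : {set T}, [/\ Y \subset terms m :&: cls v, 1 < #|Y|,
     (#|terms m :&: cls v|)./2 <= #|Y|, {in Y &, forall z z', z' != m z}
   & forall z z', z \in Y -> z' \in Y -> z != z' -> 0 < v ->
     terms (splice m z z') :&: cls v != set0 ->
     exists2 x, x \in terms (splice m z z') :&: cls v & c (splice m z z' x) != v].
Proof.
move=> mK sW; set tv := terms m :&: cls v => tv0 tvo hv.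
have tm x : x \in terms m -> m x \in terms m by rewrite !inE mK eq_sym.
have tvP x : (x \in tv) = (x \in terms m) && (c x == v).
  by rewrite /tv in_setI [x \in cls v]inE; case: (boolP (x \in terms m)) => // /(subsetP sW) ->.
pose L := [set x in tv | (c (m x) == v) && (enum_rank x < enum_rank (m x))].
pose NL := [set x in tv | c (m x) != v].
have sL : L \subset tv by apply/subsetP=> x; rewrite inE => /andP[].
have sNL : NL \subset tv by apply/subsetP=> x; rewrite inE => /andP[].
have dLN : [disjoint L & NL].
  rewrite disjoints_subset; apply/subsetP=> x; rewrite !inE.
  by move=> /and3P[_ -> _]; rewrite andbF.
have eqtv : tv = (L :|: m @: L) :|: NL.
  apply/setP=> x; apply/idP/idP.
    move=> xt; have xt' := xt; move: xt'; rewrite tvP => /andP[xt' /eqP cx].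
    rewrite !in_setU [x \in NL]inE xt; have [cm|] /= := eqVneq (c (m x)) v; last by rewrite orbT.
    rewrite orbF; case: (ltngtP (enum_rank x) (enum_rank (m x))) => h.
    - by rewrite [x \in L]inE xt cm eqxx h.
    - apply/orP; right; apply/imsetP; exists (m x); last by rewrite mK.
      by rewrite inE tvP tm // cm eqxx mK cx eqxx h.
    - by move: xt'; rewrite inE => /negP[]; rewrite eq_sym; apply/eqP/enum_rank_inj/val_inj.
  rewrite !in_setU => /orP[/orP[/(subsetP sL)//|]|/(subsetP sNL)//].
  move=> /imsetP[y]; rewrite inE tvP => /andP[/andP[yt _] /andP[cm _]] ->.
  by rewrite tvP tm.
have dmL : [disjoint L & m @: L].
  rewrite disjoints_subset; apply/subsetP=> x; rewrite !inE => /and3P[_ _ r1].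
  apply/negP=> /imsetP[y]; rewrite inE => /and3P[_ _ r2] exy.
  by move: r1; rewrite exy mK ltnNge ltnW.
have dmN : [disjoint L :|: m @: L & NL].
  rewrite disjoints_subset; apply/subsetP=> x; rewrite in_setU => /orP[xL|].
    by rewrite inE (disjointFr dLN xL).
  move=> /imsetP[y]; rewrite inE tvP => /and3P[/andP[_ cy] _ _] ->.
  by rewrite !inE mK cy andbF.
have ctv : #|tv| = 2 * #|L| + #|NL|.
  rewrite eqtv cardsU (eqP (_ : _ :&: NL == set0)) ?setI_eq0 // cards0 subn0.
  rewrite cardsU (eqP (_ : L :&: _ == set0)) ?setI_eq0 // cards0 subn0.
  by rewrite card_imset ?mul2n ?addnn //; apply: inv_inj.
have tvn : (#|tv|)./2 * 2 = #|tv| by rewrite muln2 halfK (negPf tvo) subn0.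
have tvpos : 0 < #|tv| by rewrite card_gt0.
have Ymm (Y : {set T}) : Y \subset L :|: NL -> {in Y &, forall z z', z' != m z}.
  move=> sY z z' /(subsetP sY) zY /(subsetP sY) z'Y; apply/eqP=> eqz.
  have ztv : z \in tv by move: zY; rewrite in_setU => /orP[/(subsetP sL)|/(subsetP sNL)].
  have z'tv : z' \in tv by move: z'Y; rewrite in_setU => /orP[/(subsetP sL)|/(subsetP sNL)].
  move: (ztv) (z'tv); rewrite !tvP eqz => /andP[_ cz] /andP[_ cmz].
  have zL : z \in L by move: zY; rewrite in_setU => /orP[//|]; rewrite inE cmz andbF.
  have z'L : z' \in L by move: z'Y; rewrite in_setU => /orP[//|]; rewrite inE eqz mK cz andbF.
  by have := disjointFr dmL z'L; rewrite eqz imset_f.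
have cY (Y : {set T}) x : Y \subset L :|: NL -> x \in Y -> x \in tv.
  by move=> sY /(subsetP sY); rewrite in_setU => /orP[/(subsetP sL)|/(subsetP sNL)].
pose concl (Y : {set T}) := [/\ Y \subset tv, 1 < #|Y|, (#|tv|)./2 <= #|Y|, {in Y &, forall z z', z' != m z}
   & forall z z', z \in Y -> z' \in Y -> z != z' -> 0 < v ->
     terms (splice m z z') :&: cls v != set0 ->
     exists2 x, x \in terms (splice m z z') :&: cls v & c (splice m z z' x) != v].
have main (Y : {set T}) : Y \subset L :|: NL -> 1 < #|Y| -> (#|tv|)./2 <= #|Y| ->
   (forall z z', z \in NL -> z' \in NL -> z \in Y -> z' \in Y -> z != z' -> tv :\: [set z; z'] != set0 ->
      NL :\: [set z; z'] != set0) -> concl Y.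
  move=> sY Y1 Yh hNN; have mm := Ymm Y sY.
  split=> //; first by apply/subsetP=> x; apply: cY.
  move=> z z' zY z'Y nzz v0 tne.
  have ztv := cY Y z sY zY; have z'tv := cY Y z' sY z'Y.
  move: (ztv) (z'tv); rewrite !tvP => /andP[zt /eqP cz] /andP[z't /eqP cz'].
  have tz : m z != z by move: zt; rewrite inE.
  have tz' : m z' != z' by move: z't; rewrite inE.
  have nmz := mm z z' zY z'Y.
  have tE : terms (splice m z z') :&: cls v = tv :\: [set z; z'].
    by rewrite terms_splice // -setIDAC.
  have nnl x : x \in L -> x \notin NL by move=> xL; rewrite (disjointFr dLN xL).
  have pickL x : x \in NL :\: [set z; z'] -> 
      exists2 x, x \in terms (splice m z z') :&: cls v & c (splice m z z' x) != v.
    rewrite in_setD => /andP[xz xN]; exists x.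
      by rewrite tE in_setD xz (subsetP sNL).
    move: (xN); rewrite inE => /andP[xt cmx].
    move: xz; rewrite !inE negb_or => /andP[xz xz'].
    rewrite splice_other //; apply/eqP=> eqx; move: cmx; rewrite eqx mK ?cz ?cz' eqxx //.
  have zLN : z \in L :|: NL by apply: (subsetP sY).
  have z'LN : z' \in L :|: NL by apply: (subsetP sY).
  have nmz' : (m z' == z) = false by rewrite -(inj_eq (inv_inj mK)) mK (negPf nmz).
  have inL x : x \in L -> m x \in terms m :&: cls v /\ c (m x) = v.
    rewrite inE tvP => /andP[/andP[xt _] /andP[/eqP cx _]]; split=> //.
    by rewrite -/tv tvP tm // cx eqxx.
  (* Two leaving blocks: [hNN] provides a further leaving end. One leaving block and one loop: the
     fused block leaves the class, seen from the other end of the loop. Two loops: the leaving ends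
     are untouched. *)
  have [zN|zN] := boolP (z \in NL); have [z'N|z'N] := boolP (z' \in NL).
  - by have /set0Pn[x xN] := hNN z z' zN z'N zY z'Y nzz (eq_ind _ (fun A : {set T} => A != set0) tne _ tE);
      apply: pickL xN.
  - have z'L : z' \in L by move: z'LN; rewrite in_setU (negPf z'N) orbF.
    have [bt cb] := inL z' z'L; exists (m z').
      by rewrite tE in_setD bt andbT !inE nmz' (negPf tz').
    by rewrite splice_mz' //; move: zN; rewrite inE => /andP[].
  - have zL : z \in L by move: zLN; rewrite in_setU (negPf zN) orbF.
    have [bt cb] := inL z zL; exists (m z).
      by rewrite tE in_setD bt andbT !inE (negPf tz) eq_sym (negPf nmz).
    by rewrite splice_mz //; move: z'N; rewrite inE => /andP[].
  - have [x xt cmx] := hv v0.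
    apply: (pickL x); rewrite in_setD [x \in NL]inE xt cmx !andbT !inE negb_or.
    by apply/andP; split; apply/eqP=> eqx; [move: zN|move: z'N]; rewrite inE -eqx xt cmx.
have [NL0|/set0Pn[z0 z0N]] := eqVneq NL set0.
  have hL : (#|tv|)./2 = #|L| by move: ctv; rewrite NL0 cards0; lias.
  have [L1|L1] := leqP #|L| 1.
    have /eqP/cards1P[z eqL] : #|L| = 1 by move: tvpos ctv; rewrite NL0 cards0; lias.
    left; exists z; have zL : z \in L by rewrite eqL inE.
    have zt : z \in terms m by move: (subsetP sL z zL); rewrite tvP => /andP[].
    split; first by rewrite eqtv NL0 setU0 eqL imset_set1.
      by move: zt; rewrite inE.
    move=> x xt; apply/eqP/negPn/negP=> cmx.
    by have : x \in NL; [rewrite inE xt | rewrite NL0 inE].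
  right; exists L; apply: main; rewrite ?hL ?subsetUl //.
  by move=> z z'; rewrite NL0 inE.
(* By parity [NL] has exactly two elements here, so [z0 |: L] still contains half as many vertices
   as [tv]. *)
have [/andP[L0 NL2]|] := boolP ((L != set0) && (#|NL| <= 2)).
  have z0L : z0 \notin L by apply/negP=> /(disjointFr dLN); rewrite z0N.
  have Lp : 0 < #|L| by rewrite card_gt0.
  right; exists (z0 |: L); apply: main; rewrite ?cardsU1 ?z0L.
  - by rewrite subUset sub1set in_setU z0N orbT subsetUl.
  - by move: Lp; lias.
  - by move: ctv NL2; lias.
  - move=> z z' zN z'N; rewrite !in_setU1 => /orP[/eqP->|zL]; last by rewrite (disjointFr dLN zL) in zN.
    by move=> /orP[/eqP->|zL]; [rewrite eqxx | rewrite (disjointFr dLN zL) in z'N].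
rewrite negb_and negbK -ltnNge => hcase.
have cLN : #|L :|: NL| = #|L| + #|NL|.
  by rewrite cardsU (eqP (_ : L :&: NL == set0)) ?setI_eq0 // cards0 subn0.
right; exists (L :|: NL); apply: main; rewrite ?cLN //.
- case/orP: hcase => [/eqP L0|]; last by lias.
  by move: ctv tvn tvpos; rewrite L0 cards0; lias.
- by move: ctv; lias.
- move=> z z' zN z'N _ _ nzz tne; case/orP: hcase => [/eqP L0|NL3].
    by move: tne; rewrite eqtv L0 imset0 !set0U.
  rewrite -card_gt0 cardsD; have := subset_leq_card (subsetIr NL [set z; z']).
  by rewrite cards2 nzz; move: NL3; lias.
Qed.

(* Two ends in the highest class that contains any are linked, which merges their
   blocks; [X] collects the vertices used up by the links. *)
Lemma block_cycle N (m : T -> T) (X : {set T}) :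
  involutive m -> #|terms m| <= N -> terms m != set0 -> terms m \subset W :\: X ->
  (forall u, ~~ odd #|terms m :&: cls u|) ->
  (forall u, 0 < u -> terms m :&: cls u != set0 ->
     exists2 z, z \in terms m :&: cls u & c (m z) < u) ->
  (forall u, #|(X :|: terms m) :&: cls u| + link_cost (#|terms m :&: cls u|)./2 <= k) ->
  exists s, [/\ valid e c m s, {subset s <= W :\: X} & {in terms m, forall x, (x \in s) || (m x \in s)}].
Proof.
elim: N m X => [|N IH] m X mK; first by rewrite leqn0 cards_eq0 => ->.
move=> tN t0 tWX todd ttree tcost.
have tW : terms m \subset W by apply: subset_trans tWX (subsetDl _ _).
have tX x : x \in terms m -> x \notin X by move=> /(subsetP tWX); rewrite inE => /andP[].
have tm x : x \in terms m -> m x \in terms m by rewrite !inE mK eq_sym.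
have [x0 x0t] := set0Pn _ t0.
have [x1 x1t x1max] : exists2 x1, x1 \in terms m & forall x, x \in terms m -> c x <= c x1.
  by case: (arg_maxnP c x0t) => x1 x1t x1max; exists x1.
set v := c x1 in x1max.
have tv0 : terms m :&: cls v != set0.
  by apply/set0Pn; exists x1; rewrite in_setI x1t inE (subsetP tW) //=.
have hv : 0 < v -> exists2 z, z \in terms m :&: cls v & c (m z) != v.
  by move=> /ttree/(_ tv0)[z zt hz]; exists z; rewrite // neq_ltn hz.
have clsP x u : x \in cls u -> c x = u by rewrite inE => /andP[_ /eqP].
set tv := terms m :&: cls v.
have h0 : 0 < (#|tv|)./2.
  have := todd v; rewrite -/tv; have : 0 < #|tv| by rewrite card_gt0.
  by case: #|tv| => [|[|n]].
have usedk : #|(X :|: terms m) :&: cls v| < k.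
  have := tcost v; rewrite -/tv -(prednK h0) link_costS; move: (a %/ _) => q; lias.
have [[z [eqtv tz loops]]|[Y [sY Y2 Yh Ymm Ytree]]] := choose_ends mK tW tv0 (todd v) hv.
  (* A class of positive rank with ends keeps one whose partner lies lower. If the highest class
     holds just the two ends of one block, it has rank zero and no other ends exist; linking these
     two closes the cycle. *)
  have v0 : v = 0.
    apply/eqP; rewrite -leqn0 leqNgt; apply/negP=> /hv[y yt].
    by rewrite (loops y yt) eqxx.
  have eqt x : x \in terms m -> (x == z) || (x == m z).
    move=> xt; have : x \in terms m :&: cls v.
      rewrite in_setI xt inE (subsetP tW) //= v0 -leqn0 -v0; exact: x1max.
    by rewrite eqtv !inE.
  have zt : z \in terms m :&: cls v by rewrite eqtv !inE eqxx.
  have mzt : m z \in terms m :&: cls v by rewrite eqtv !inE eqxx orbT.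
  have cz : c z = v by move: zt; rewrite in_setI => /andP[_ /clsP].
  have cmz : c (m z) = v by move: mzt; rewrite in_setI => /andP[_ /clsP].
  have [|||y [y' [Q [yY y'Y nyy pQ [sQ uQ Q0 sizeQ]]]]] :=
      @short_link T e a esym eirr ha k (cls v) ((X :|: terms m) :&: cls v) [set z; m z] 1 (good v) usedk.
  - by rewrite -eqtv subsetIr.
  - by rewrite cards2 eq_sym tz.
  - by rewrite cards2 eq_sym tz.
  have sQ' x : x \in Q -> [/\ x \in W, c x = v, x \notin X & x \notin terms m].
    move=> /sQ; rewrite in_setD in_setI in_setU negb_and negb_or => /andP[h xv].
    move: h; rewrite xv orbF => /andP[xX xt]; split=> //; last exact: clsP xv.
    by move: xv; rewrite inE => /andP[].
  have mQ x : x \in Q -> m x = x by move=> /sQ'[_ _ _]; rewrite inE negbK => /eqP.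
  have my : y' = m y.
    by move: yY y'Y nyy; rewrite !inE => /orP[]/eqP-> /orP[]/eqP->; rewrite ?mK ?eqxx.
  have cy : c y = v by move: yY; rewrite !inE => /orP[]/eqP->.
  have yt : y \in terms m by move: yY; rewrite !inE => /orP[]/eqP->; rewrite ?mK // eq_sym.
  have mye : m y != y by move: yt; rewrite inE.
  exists (m y :: Q); split.
  - split.
    + have gen x R : path e x (rcons R y') -> c x = v -> {in R, forall w, c w = v} ->
          {in R, forall w, m w = w} -> forall w, m w = x -> path (brel e c m) w (rcons R (m y)).
        elim: R x => [|w R IHR] x /=.
          by move=> /andP[ex _] cx _ _ w mw; rewrite /brel /= mw -my ex cx my; move: y'Y;
            rewrite my !inE => /orP[]/eqP->; rewrite ?cz ?cmz eqxx.
        move=> /andP[ex pR] cx cR mR w' mw; rewrite /brel /= mw ex cx (cR w) ?inE ?eqxx //=.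
        apply: (IHR w pR); rewrite ?cR ?mR ?inE ?eqxx //.
          by move=> u uR; apply: cR; rewrite inE uR orbT.
        by move=> u uR; apply: mR; rewrite inE uR orbT.
      apply: (gen y Q pQ cy) => //; first by move=> x /sQ'[].
    + by rewrite /= uQ andbT; apply/negP=> /mQ; rewrite mK => h; move: mye; rewrite -h eqxx.
    + move=> x; rewrite inE => /orP[/eqP->|/mQ //]; rewrite mK inE eq_sym (negPf mye) /=.
      by move=> /mQ.
  - move=> x; rewrite inE => /orP[/eqP->|/sQ'[xW _ xX _]]; last by rewrite inE xX.
    by apply: (subsetP tWX); apply: tm.
  - move=> x /eqt hx; have hx' : (x == y) || (x == m y).
      move: yY hx; rewrite !inE => /orP[/eqP->//|/eqP->]; rewrite mK.
      by rewrite orbC.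
    by rewrite !inE; case/orP: hx' => /eqP->; rewrite eqxx ?orbT.
have [|||z [z' [Q [zY z'Y nzz pQ [sQ uQ Q0 sizeQ]]]]] :=
    @short_link T e a esym eirr ha k (cls v) ((X :|: terms m) :&: cls v) Y ((#|tv|)./2) (good v) usedk.
- by apply: subset_trans sY (subsetIr _ _).
- exact: Y2.
- by rewrite h0.
have sQ' x : x \in Q -> [/\ x \in W, c x = v, x \notin X & x \notin terms m].
  move=> /sQ; rewrite in_setD in_setI in_setU negb_and negb_or => /andP[h xv].
  move: h; rewrite xv orbF => /andP[xX xt]; split=> //; last exact: clsP xv.
  by move: xv; rewrite inE => /andP[].
have mQ x : x \in Q -> m x = x by move=> /sQ'[_ _ _]; rewrite inE negbK => /eqP.
have := subsetP sY z zY; rewrite in_setI => /andP[zt zv].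
have := subsetP sY z' z'Y; rewrite in_setI => /andP[z't z'v].
have tz : m z != z by move: zt; rewrite inE.
have tz' : m z' != z' by move: z't; rewrite inE.
have nmz := Ymm z z' zY z'Y.
have cz := clsP _ _ zv; have cz' := clsP _ _ z'v.
set m' := splice m z z'.
have m'K : involutive m' by apply: splice_inv.
have t'E : terms m' = terms m :\: [set z; z'] by apply: terms_splice.
(* As fixed points of [m'], the vertices [z] and [z'] would count as free. Together with [Q] they
   are reserved for the link. *)
pose X' := X :|: [set z; z'] :|: [set x in Q].
have sub2 : [set z; z'] \subset terms m by rewrite subUset !sub1set zt z't.
have ct' : #|terms m'| = #|terms m| - 2.
  by rewrite t'E cardsD (setIidPr sub2) cards2 nzz.
have t2 : 2 <= #|terms m| by have := subset_leq_card sub2; rewrite cards2 nzz.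
have clsu u : u != v -> terms m' :&: cls u = terms m :&: cls u.
  move=> nuv; apply/setP=> x; rewrite t'E !in_setI in_setD.
  have [xu|] := boolP (x \in cls u); rewrite ?andbF // !andbT.
  have /negPf -> : x \notin [set z; z'] => //.
  rewrite !inE negb_or; apply/andP; split; apply/eqP=> eqx.
    by move: nuv; rewrite -(clsP _ _ xu) eqx cz eqxx.
  by move: nuv; rewrite -(clsP _ _ xu) eqx cz' eqxx.
have clsv : #|terms m' :&: cls v| = #|tv| - 2.
  have -> : terms m' :&: cls v = tv :\: [set z; z'] by rewrite t'E /tv setIDAC.
  rewrite cardsD (setIidPr (_ : [set z; z'] \subset tv)) ?cards2 ?nzz //.
  by rewrite subUset !sub1set !in_setI zt z't zv z'v.
have mz'ne : m z' != m z by rewrite (inj_eq (inv_inj mK)) eq_sym.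
have azt' : m z \in terms m' by rewrite inE /m' splice_mz.
have [||||||s [vs sW' cs]] := IH m' X' m'K.
- by rewrite ct'; move: tN t2; lias.
- by apply/set0Pn; exists (m z).
- apply/subsetP=> x; rewrite t'E in_setD => /andP[xz xt].
  rewrite in_setD (subsetP tW) // andbT /X' in_setU [x \in X :|: _]in_setU !negb_or tX // xz /=.
  by rewrite inE; apply/negP=> /sQ'[_ _ _]; rewrite xt.
- move=> u; have [->|nuv] := eqVneq u v; last by rewrite clsu // todd.
  rewrite clsv oddB; first by rewrite addbF; apply: todd.
  by move: h0; lias.
(* In the highest class [Ytree] gives an end whose partner lies elsewhere, hence lower. In a class
   below, an end with a still lower partner is not affected by the splice, as [z] and [z'] both lie
   in the highest class. *)
- move=> u u0; have [eqv|nuv] := eqVneq u v; first rewrite eqv.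
    move=> hne; move: u0; rewrite eqv => v0.
    have [x xt cx] := Ytree z z' zY z'Y nzz v0 hne; exists x => //.
    have : m' x \in terms m'.
      by move: xt; rewrite in_setI => /andP[]; rewrite !inE m'K eq_sym.
    by rewrite t'E in_setD => /andP[_ /x1max]; rewrite leq_eqVlt (negPf cx).
  rewrite clsu // => hne; have [x xt cx] := ttree u u0 hne; exists x => //.
  move: xt; rewrite in_setI => /andP[xt xu].
  have cxu := clsP _ _ xu.
  have cxv : c x <= v by apply: x1max.
  rewrite /m' splice_other //.
  + by apply/eqP=> eqx; move: nuv; rewrite -cxu eqx cz eqxx.
  + by apply/eqP=> eqx; move: nuv; rewrite -cxu eqx cz' eqxx.
  + by apply/eqP=> eqx; move: cx; rewrite eqx mK cz ltnNge -cxu cxv.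
  + by apply/eqP=> eqx; move: cx; rewrite eqx mK cz' ltnNge -cxu cxv.
(* Since [z] and [z'] only pass from the ends to [X'], the used set grows by [Q] alone, inside class
   [v]; the bound on [size Q] is precisely the last summand of [link_cost]. *)
- move=> u; have eqU : X' :|: terms m' = X :|: terms m :|: [set x in Q].
    apply/setP=> x; rewrite /X' t'E !inE.
    have [->|_] := eqVneq x z; first by rewrite tz !orbT.
    have [->|_] := eqVneq x z'; first by rewrite tz' !orbT.
    by rewrite /= orbF orbAC.
  have [->|nuv] := eqVneq u v; last first.
    rewrite clsu //; apply: leq_trans (tcost u); rewrite leq_add2r subset_leq_card //.
    apply/subsetP=> x; rewrite eqU !in_setI in_setU => /andP[/orP[->//|]].
    by rewrite inE => /sQ'[_ cx _ _ /clsP cxu]; move: nuv; rewrite -cxu cx eqxx.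
  have le1 : #|(X' :|: terms m') :&: cls v| <= #|(X :|: terms m) :&: cls v| + size Q.
    rewrite eqU setIUl; apply: leq_trans (leq_card_setU _ _) _; rewrite leq_add2l.
    by apply: leq_trans (subset_leq_card (subsetIl _ _)) _; rewrite cardsE card_size.
  have := tcost v; rewrite -/tv clsv; move: le1 sizeQ.
  have -> : (#|tv| - 2)./2 = (#|tv|)./2.-1 by lias.
  rewrite -{2 3}(prednK h0) link_costS (prednK h0).
  by lias.
have sWX x : x \in s -> (x \in W) /\ [/\ x \notin X, x != z, x != z' & x \notin Q].
  by move=> /sW'; rewrite !inE !negb_or => /andP[/andP[/and3P[-> -> ->] ->] ->].
have [||||||s' [vs' ss' z's' cs']] := @unsplice T e c esym m z z' mK tz tz' nzz nmz Q s vs pQ.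
- by move=> x /sQ'[_ ->].
- by rewrite cz cz'.
- exact: uQ.
- exact: mQ.
- move=> x; rewrite !inE => hx; apply/negP=> /sWX[_ [_ n1 n2 n3]].
  by move: hx; rewrite (negPf n1) (negPf n2) (negPf n3).
- by have := cs (m z) azt'; rewrite /m' splice_mz.
exists s'; split=> //.
  have sin x : x \in s -> x \in W :\: X by move=> /sWX[xW [xX _ _ _]]; rewrite inE xX.
  move=> x /ss'; rewrite inE !mem_cat => /or4P[/eqP->|/sQ'[xW _ xX _]|/sin//|].
  - exact: (subsetP tWX).
  - by rewrite inE xX.
  - move=> /mapP[y ys ->]; rewrite -/m'; have [->|ny] := eqVneq (m' y) y; first exact: sin.
    have : m' (m' y) != m' y by rewrite m'K eq_sym.
    by move=> h; apply: (subsetP tWX); have : m' y \in terms m'; [rewrite inE|rewrite t'E in_setD => /andP[]].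
move=> x xt; have [->|n1] := eqVneq x z.
  have : (m z \in s') || (m' (m z) \in s').
    by apply: cs'; apply: cs.
  rewrite /m' splice_mz // => /orP[->|h]; first by rewrite orbT.
  have [_ _ h2] := vs'; have := h2 z' z's' h => /eqP.
  by rewrite (negPf tz').
have [->|n2] := eqVneq x z'; first by rewrite z's'.
have h := cs' x (cs x _).
have xt' : x \in terms m' by rewrite t'E in_setD xt andbT !inE negb_or n1.
have [xa|n3] := eqVneq x (m z).
  move: (h xt'); rewrite xa splice_mz // => /orP[->//|h'].
  by have [_ _ h2] := vs'; have := h2 z' z's' h' => /eqP; rewrite (negPf tz').
have [->|n4] := eqVneq x (m z'); first by rewrite mK z's' orbT.
by have := h xt'; rewrite splice_other.
Qed.
End BlockCycle.

(** * Extension to a covering cycle by exchange *)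

Section Extend.
Variables (T : finType) (e : rel T) (c : T -> nat) (W : {set T}) (a k : nat).
Hypotheses (esym : symmetric e) (eirr : irreflexive e).
Hypothesis ha : forall S, indep e S -> #|S| <= a.
Hypothesis good : forall u, kgood e k (cls c W u).
Variable m : T -> T.
Hypotheses (mK : involutive m) (tW : terms m \subset W).
Hypothesis tne : {in W, forall w, exists2 x, x \in terms m & c x = c w}.
Hypothesis hk : a + #|terms m| <= k.

Definition spanning_terms s :=
  [/\ valid e c m s, {subset s <= W} & {in terms m, forall x, (x \in s) || (m x \in s)}].

Lemma brel_path_rev x p : path (brel e c m) x p ->
  path (brel e c m) (m (last x p)) (rev (map m (belast x p))).
Proof.
elim: p x => // y p IH x /= /andP[xy pp].
rewrite rev_cons rcons_path IH //=.
have -> : last (m (last y p)) (rev (map m (belast y p))) = m y.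
  by case: p {IH pp} => //= z p; rewrite rev_cons last_rcons.
by rewrite brel_flip.
Qed.

Lemma cycle_insert (r : rel T) y p Q :
  path r (last y p) (rcons Q y) -> path r y p -> cycle r (Q ++ y :: p).
Proof.
move=> h1 h2; rewrite -(rot_cycle (size Q)) rot_size_cat /= rcons_cat cat_path h2.
exact: h1.
Qed.

(* The Chvatal-Erdos exchange: a component [D] of the uncovered part of a class
   has at least [k] neighbours on the cycle, and two of the entries following
   them are adjacent. *)
Lemma extend_cycle s w : spanning_terms s -> w \in W -> ~~ ((w \in s) || (m w \in s)) ->
  exists2 s', spanning_terms s' & size s < size s'.
Proof.
move=> [[cs us ms] sW st] wW ws.
pose supp x := (x \in s) || (m x \in s).
pose v := c w; pose V := cls c W v.
pose F := [set x in V | ~~ supp x].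
pose D := [set x | connect (inside e F) w x].
have mW x : x \in W -> m x \in W.
  move=> xW; have [->//|nx] := eqVneq (m x) x.
  by apply: (subsetP tW); rewrite inE mK eq_sym.
have suppm x : supp (m x) = supp x by rewrite /supp mK orbC.
have wF : w \in F by rewrite !inE wW eqxx.
have wD : w \in D by rewrite inE connect0.
have DF x : x \in D -> x \in F by rewrite inE; apply: inside_connect_mem.
have Fm x : x \in F -> m x = x.
  rewrite inE => /andP[_ xs]; apply/eqP/negPn/negP=> mx.
  by move: xs; rewrite /supp st // inE.
have FV x : x \in F -> x \in V by rewrite inE => /andP[].
have VP x : (x \in V) = (x \in W) && (c x == v) by rewrite inE.
pose Nb := [set u in V | supp u && [exists d in D, e u d]].
have NbP u : reflect [/\ u \in V, supp u & exists2 d, d \in D & e u d] (u \in Nb).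
  rewrite [u \in Nb]in_set; apply: (iffP and3P) => [[h1 h2 /exists_inP h3]|[h1 h2 h3]]; split=> //.
  exact/exists_inP.
have link u u' : u \in Nb -> u' \in Nb ->
    exists Q, [/\ path e u (rcons Q u'), {subset Q <= F}, uniq Q & Q != [::]].
  move=> /NbP[_ _ [d dD eud]] /NbP[_ _ [d' d'D eud']].
  have /connectP[p pp pl] : connect (inside e F) d d'.
    move: dD d'D; rewrite !inE => dD d'D.
    by apply: connect_trans d'D; rewrite inside_csym.
  move: pl; case: (shortenP pp) => q qp qu _ ql.
  exists (d :: q); split=> //.
    have qe : path e d q by apply: sub_path qp => x y; rewrite /inside /= => /and3P[].
    by rewrite /= rcons_path eud qe -ql esym eud'.
  move=> x; rewrite inE => /orP[/eqP->|]; first exact: DF.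
  exact: inside_path_mem qp x.
have sW' x : x \in s -> x \in W by exact: sW.
have suppV x : x \in s -> supp x by rewrite /supp => ->.
have gapc x : x \in s -> e (m x) (next s x) /\ c (m x) = c (next s x).
  by move=> xs; have /andP[h /eqP] := next_cycle cs xs.
have gapV x : x \in s -> (m x \in V) = (next s x \in V).
  move=> xs; rewrite !VP (mW x (sW x xs)) (sW (next s x)) ?mem_next //=.
  by have [_ ->] := gapc x xs.
have pathQ u u' Q x : path e u (rcons Q u') -> {subset Q <= F} -> u \in V -> u' \in V -> m x = u ->
    path (brel e c m) x (rcons Q u').
  have gen R : forall x u, path e u (rcons R u') -> {subset R <= F} -> u \in V -> u' \in V ->
      m x = u -> path (brel e c m) x (rcons R u').
    elim: R => [|y R IH] x0 u0 /=.
      move=> /andP[eu _] _; rewrite !VP => /andP[_ /eqP cu] /andP[_ /eqP cu'] mx.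
      by rewrite /brel /= mx eu cu cu' eqxx.
    move=> /andP[eu pR] RF uV u'V mx.
    have yF : y \in F by apply: RF; rewrite inE eqxx.
    have yV := FV y yF.
    move: (uV) (yV); rewrite {1 2}/brel /= mx eu !VP => /andP[_ /eqP ->] /andP[_ /eqP ->].
    rewrite eqxx /=; apply: (IH y y) => //; last exact: Fm.
    by move=> z zR; apply: RF; rewrite inE zR orbT.
  exact: gen.
have sizeQ (Q : seq T) : Q != [::] -> 0 < size Q by case: Q.
have FW x : x \in F -> x \in W by move=> /FV; rewrite VP => /andP[].
have Fs x : x \in F -> x \notin s.
  by rewrite inE => /andP[_]; rewrite /supp negb_or => /andP[].
have Fsm x : x \in F -> m x \notin s.
  by rewrite inE => /andP[_]; rewrite /supp negb_or => /andP[].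
(* If the exit of a block and the next entry both have neighbours in [D], a path through [F] is
   inserted between them. *)
have [/existsP[x /and3P[xs mxN nxN]]|] :=
    boolP [exists x, [&& x \in s, m x \in Nb & next s x \in Nb]].
  have [Q [pQ QF uQ Q0]] := link _ _ mxN nxN.
  have ns : next s x \in s by rewrite mem_next.
  have [i s0 eqs] := rot_to ns.
  have lst : last (next s x) s0 = x.
    have : fcycle (next s) (next s x :: s0) by rewrite -eqs rot_cycle cycle_next.
    rewrite /= rcons_path => /andP[_ /eqP h].
    have lin : last (next s x) s0 \in s by rewrite -(mem_rot i) eqs mem_last.
    by rewrite -[LHS](prev_next us) h prev_next.
  exists (Q ++ next s x :: s0); last first.
    by rewrite size_cat -eqs size_rot; have := sizeQ Q Q0; lias.
  have mem y : (y \in Q ++ next s x :: s0) = (y \in Q) || (y \in s).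
    by rewrite mem_cat -eqs mem_rot.
  split.
  - split.
    + have mxV : m x \in V by have [] := NbP _ mxN.
      have nxV : next s x \in V by have [] := NbP _ nxN.
      have pQ' := pathQ _ _ _ x pQ QF mxV nxV (erefl _).
      have cs' : cycle (brel e c m) (next s x :: s0) by rewrite -eqs rot_cycle.
      apply: cycle_insert; first by rewrite lst.
      by move: cs'; rewrite /= rcons_path => /andP[].
    + rewrite cat_uniq uQ -eqs rot_uniq us andbT; apply/hasPn=> y; rewrite mem_rot => ys.
      by apply/negP=> /QF/Fs; rewrite ys.
    + move=> y; rewrite !mem => /orP[/QF/Fm//|ys] /orP[/QF h|]; last exact: ms.
      by move: (Fsm _ h); rewrite mK ys.
  - by move=> y; rewrite mem => /orP[/QF/FW//|/sW].
  - by move=> y yt; rewrite !mem; have /orP[->|->] := st y yt; rewrite ?orbT.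
rewrite negb_exists => /forallP nogap.
pose J := [set x in s | m x \in Nb].
have JP x : (x \in J) = (x \in s) && (m x \in Nb) by rewrite in_set.
have nextN x : x \in J -> next s x \notin Nb.
  by rewrite JP => /andP[xs mxN]; have := nogap x; rewrite xs mxN.
have nextV x : x \in J -> next s x \in V.
  by rewrite JP => /andP[xs /NbP[mxV _ _]]; rewrite -gapV.
(* Otherwise [Nb] would separate [D] from a covered vertex of the class. Such a vertex outside [Nb]
   exists: by [tne] the cycle visits the class, and an exit in [Nb] is followed by an entry not in
   [Nb]. *)
have kN : k <= #|Nb|.
  rewrite leqNgt; apply/negP=> ltN.
  have [t tt ct] := tne wW.
  have [x xs mxV] : exists2 x, x \in s & m x \in V.
    have tV : t \in V by rewrite VP (subsetP tW) //= ct.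
    have /orP[ts|ts] := st t tt; last by exists (m t); rewrite // mK.
    by exists (prev s t); rewrite ?mem_prev // gapV ?mem_prev // next_prev.
  have [y [yV ys yN]] : exists y, [/\ y \in V, supp y & y \notin Nb].
    have [mxN|mxN] := boolP (m x \in Nb); last by exists (m x); rewrite suppm suppV.
    have xJ : x \in J by rewrite JP xs.
    by exists (next s x); rewrite nextV // nextN // suppV // mem_next.
  have wN : w \notin Nb by apply/negP=> /NbP[_ h _]; move: ws; rewrite -/(supp w) h.
  have wV : w \in V by apply: FV.
  have := (good v).2 Nb ltN w y; rewrite !in_setD wN wV yN yV => /(_ isT isT).
  move=> /connectP[p pp yl].
  suff : y \in D by move=> /DF; rewrite in_set ys andbF.
  rewrite yl; elim: p (w) wD pp {yl} => //= z p IH x0 x0D /andP[/and3P[_ zV ez] pp].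
  apply: IH pp; move: zV; rewrite in_setD => /andP[zN zV].
  have zF : z \in F.
    rewrite in_set zV /=; apply/negP=> zs; move/negP: zN; apply; apply/NbP; split=> //.
    by exists x0; rewrite // esym.
  move: (x0D); rewrite inE => /connect_trans; rewrite [z \in D]inE; apply.
  by apply: connect1; rewrite /inside /= DF // zF.
(* A vertex of [Nb] that is not the exit of a block of the cycle is the entry of a two-ended block,
   so passing from [Nb] to exits loses at most [#|terms m|] vertices. *)
have kJ : k <= #|J| + #|terms m|.
  apply: leq_trans kN _; rewrite -(card_imset J (inv_inj mK)).
  apply: leq_trans (leq_card_setU _ _); apply: subset_leq_card; apply/subsetP=> u uN.
  have [_ su _] := NbP _ uN; rewrite in_setU.
  have [mus|mus] := boolP (m u \in s).
    by rewrite -{1}[u]mK imset_f // JP mus mK.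
  have us' : u \in s by move: su; rewrite /supp (negPf mus) orbF.
  by apply/orP; right; rewrite inE; apply: contraNneq mus => ->.
pose A := [set next s x | x in J].
have cA : #|A| = #|J|.
  apply: card_in_imset => x y; rewrite !JP => /andP[xs _] /andP[ys _] exy.
  by rewrite -(prev_next us x) exy prev_next.
have wA : w \notin A.
  apply/negP=> /imsetP[x]; rewrite JP => /andP[xs _] eqw.
  by move: ws; rewrite eqw mem_next xs.
(* The set has more than [a] elements, and an entry in [A] adjacent to [w] would belong to [Nb]. The
   edge obtained thus joins two entries. *)
have := @ha (w |: A); rewrite cardsU1 wA cA => hA.
have : ~~ indep e (w |: A) by apply/negP=> /hA; move: kJ hk; lias.
have nw y : y \in A -> ~~ e w y.
  move=> /imsetP[x xJ ->]; apply: contra (nextN x xJ) => ewy; apply/NbP; split.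
  - exact: nextV.
  - by apply: suppV; rewrite mem_next; move: xJ; rewrite JP => /andP[].
  - by exists w; rewrite // esym.
rewrite negb_forall => /existsP[y1]; rewrite negb_imply => /andP[y1A].
rewrite negb_forall => /existsP[y2]; rewrite negb_imply negbK => /andP[y2A e12].
have {}y1A : y1 \in A.
  move: y1A y2A e12; rewrite !in_setU1 => /orP[/eqP->|//] /orP[/eqP->|/nw/negPf->//].
  by rewrite eirr.
have {}y2A : y2 \in A.
  by move: y2A; rewrite in_setU1 => /orP[/eqP eqy|//]; move: e12; rewrite eqy esym (negPf (nw _ y1A)).
have /imsetP[x1 x1J eq1] := y1A; have /imsetP[x2 x2J eq2] := y2A.
have := x1J; rewrite JP => /andP[x1s x1N]; have := x2J; rewrite JP => /andP[x2s x2N].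
have y1s : y1 \in s by rewrite eq1 mem_next.
have y2s : y2 \in s by rewrite eq2 mem_next.
have n12 : y1 != y2 by apply/eqP=> h; move: e12; rewrite h eirr.
have [i p1 p2 _ _ eqs] := rot_to_arc us y1s y2s n12.
have fc : fcycle (next s) (y1 :: p1 ++ y2 :: p2) by rewrite -eqs rot_cycle cycle_next.
have mem0 y : (y \in s) = (y \in y1 :: p1) || (y \in y2 :: p2).
  by rewrite -(mem_rot i) eqs -cat_cons mem_cat.
move: fc; rewrite /= rcons_cat cat_path /= rcons_path => /and3P[_ /eqP l1 /andP[_ /eqP l2]].
have lx2 : last y1 p1 = x2.
  by rewrite -(prev_next us (last y1 p1)) l1 eq2 prev_next.
have lx1 : last y2 p2 = x1.
  by rewrite -(prev_next us (last y2 p2)) l2 eq1 prev_next.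
have [Q [pQ QF uQ Q0]] := link _ _ x1N x2N.
have mx1V : m x1 \in V by have [] := NbP _ x1N.
have mx2V : m x2 \in V by have [] := NbP _ x2N.
have pQ' := pathQ _ _ _ x1 pQ QF mx1V mx2V (erefl _).
have cs' : cycle (brel e c m) (y1 :: p1 ++ y2 :: p2) by rewrite -eqs rot_cycle.
move: cs'; rewrite /= rcons_cat cat_path /= rcons_path => /and3P[c1 c2 /andP[c3 c4]].
pose A1 := rev (map m (belast y1 p1)).
have revA : rev (map m (y1 :: p1)) = m x2 :: A1.
  by rewrite lastI map_rcons rev_rcons lx2.
(* From the exit of [x1] through [Q] to the exit of [x2], backwards along the arc from [x2] to [y1],
   over the edge between [y1] and [y2], then forwards to [x1]. *)
pose s' := Q ++ m x2 :: A1 ++ y2 :: p2.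
have lA1 : last (m x2) A1 = m y1.
  have : last (m x2) (m x2 :: A1) = m y1 by rewrite -revA /= rev_cons last_rcons.
  by [].
have memS y : (y \in s') = [|| y \in Q, m y \in y1 :: p1 | y \in y2 :: p2].
  rewrite /s' mem_cat -cat_cons mem_cat -revA mem_rev -{2}[y]mK mem_map //.
  exact: inv_inj.
have [u1 u2 u12] : [/\ uniq (y1 :: p1), uniq (y2 :: p2) & ~~ has (mem (y1 :: p1)) (y2 :: p2)].
  by have := us; rewrite -(rot_uniq i) eqs -cat_cons cat_uniq => /and3P[].
have split12 y : y \in y1 :: p1 -> y \in y2 :: p2 -> False.
  by move=> h1 h2; move/hasPn: u12 => /(_ y h2); rewrite /= h1.
have in1 y : y \in y1 :: p1 -> y \in s by rewrite mem0 => ->.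
have in2 y : y \in y2 :: p2 -> y \in s by rewrite mem0 => ->; rewrite orbT.
exists s'; last first.
  rewrite /s' -(size_rot i) eqs -cat_cons !size_cat /= size_cat size_rev size_map size_belast /=.
  by have := sizeQ Q Q0; lias.
split.
- split.
  + rewrite /s'; apply: cycle_insert; first by rewrite last_cat /= lx1.
    rewrite cat_path /= lA1 c3 andbT; apply/andP; split.
      by have := brel_path_rev c1; rewrite lx2.
    rewrite /brel /= mK e12 /=; apply/eqP.
    have := nextV x1 x1J; have := nextV x2 x2J.
    by rewrite -eq1 -eq2 !VP => /andP[_ /eqP->] /andP[_ /eqP->].
  + rewrite /s' -cat_cons -revA cat_uniq uQ cat_uniq rev_uniq map_inj_uniq; last exact: inv_inj.
    rewrite u1 u2 andbT [true && _]andTb; apply/andP; split.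
      apply/hasPn=> y yin; apply/negP=> /QF yF.
      move: yin; rewrite mem_cat mem_rev => /orP[/mapP[z zin eqy]|/in2].
        by have := Fsm y yF; rewrite eqy mK in1.
      by rewrite (negPf (Fs y yF)).
    apply/hasPn=> y yin; apply/negP=> hy.
    have /mapP[z zin eqy] : y \in map m (y1 :: p1) by rewrite -mem_rev.
    have zs := in1 z zin; have ys := in2 y yin.
    have : m z = z by apply: ms => //; rewrite -eqy.
    by move=> mz; apply: (split12 z zin); rewrite -mz -eqy.
  + move=> y; rewrite !memS mK => /or3P[/QF/Fm//|h1|h1] /or3P[/QF h2|h2|h2].
    * by have := Fs _ h2; rewrite in1.
    * by have := ms _ (in1 _ h1); rewrite mK => /(_ (in1 _ h2)).
    * by case: (split12 (m y)).
    * by have := Fsm _ h2; rewrite mK in2.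
    * by case: (split12 y).
    * by apply: ms; apply: in2.
- move=> y; rewrite memS => /or3P[/QF/FW//|/in1/sW h|/in2/sW//].
  by rewrite -[y]mK mW.
- move=> y yt; rewrite !memS mK; have := st y yt; rewrite !mem0.
  by move=> /orP[/orP[]->|/orP[]->]; rewrite ?orbT.
Qed.

Lemma covering_cycle s : spanning_terms s ->
  exists2 s', spanning_terms s' & {in W, forall x, (x \in s') || (m x \in s')}.
Proof.
have [N] := ubnP (#|T| - size s); elim: N s => // N IH s ltN hs.
have [/forall_inP h|] := boolP [forall x in W, (x \in s) || (m x \in s)]; first by exists s.
rewrite negb_forall => /existsP[w]; rewrite negb_imply => /andP[wW ws].
have [s' hs' lt] := extend_cycle hs wW ws.
apply: (IH s') => //; have [[_ us' _] _ _] := hs'.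
have : size s' <= #|T| by rewrite -(card_uniqP us') max_card.
move: ltN lt; lias.
Qed.
End Extend.

(** * Fans *)

Section Fan.
Variables (T : finType) (H : rel T) (a : nat).
Hypotheses (Hsym : symmetric H) (Hirr : irreflexive H).
Hypothesis ha : forall S, indep H S -> #|S| <= a.

(** Among the [a + 1] vertices at positions [0, 2, ..., 2 * a] two are adjacent; taking only even
    positions ensures that the chord skips at least one vertex, and it skips at most [2 * a - 1]. *)
Lemma shorten_arc x (B : seq T) : uniq B -> path H x B -> 2 * a < size B ->
  exists B', [/\ path H x B', last x B' = last x B, subseq B' B, size B' < size B
    & size B < size B' + 2 * a].
Proof.
move=> uB pB ltB.
have x0 : T by exact: x.
pose f (i : 'I_a.+1) := nth x0 B (2 * i).
have fi (i : 'I_a.+1) : 2 * i < size B by have := ltn_ord i; move: ltB; lias.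
have finj : injective f.
  move=> i j /eqP; rewrite nth_uniq //; move=> /eqP h; apply: val_inj => /=.
  by move: h; lias.
have := @ha (f @: [set: 'I_a.+1]); rewrite card_imset // cardsT card_ord ltnn => nind.
have : ~~ indep H (f @: [set: 'I_a.+1]) by apply/negP=> /nind.
rewrite negb_forall => /existsP[y1]; rewrite negb_imply => /andP[/imsetP[i1 _ ->]].
rewrite negb_forall => /existsP[y2]; rewrite negb_imply negbK => /andP[/imsetP[j1 _ ->]].
have main (i j : 'I_a.+1) : i < j -> H (f i) (f j) ->
  exists B', [/\ path H x B', last x B' = last x B, subseq B' B, size B' < size B
    & size B < size B' + 2 * a].
  move=> ij hij; have ltj := ltn_ord j.
  exists (take (2 * i).+1 B ++ drop (2 * j) B).
  have tk : take (2 * i).+1 B = rcons (take (2 * i) B) (f i) by rewrite (take_nth x0).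
  have dr : drop (2 * j) B = f j :: drop (2 * j).+1 B by rewrite (drop_nth x0).
  have := pB; rewrite -{1}(cat_take_drop (2 * i).+1 B) cat_path => /andP[pt _].
  have := pB; rewrite -{1}(cat_take_drop (2 * j) B) cat_path dr /= => /and3P[_ _ pd].
  have lB : last x B = last (f j) (drop (2 * j).+1 B).
    by rewrite -{1}(cat_take_drop (2 * j) B) last_cat dr.
  rewrite -dr; split.
  - by rewrite cat_path pt tk last_rcons dr /= hij pd.
  - by rewrite lB last_cat dr.
  - have eB : B = take (2 * i).+1 B ++ (drop (2 * i).+1 (take (2 * j) B)) ++ drop (2 * j) B.
      rewrite catA -{1}(cat_take_drop (2 * j) B); congr (_ ++ _).
      rewrite -{1}(cat_take_drop (2 * i).+1 (take (2 * j) B)); congr (_ ++ _).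
      by rewrite take_takel //; move: ij; lias.
    by rewrite [X in subseq _ X]eB cat_subseq // suffix_subseq ?suffix_suffix.
  - by rewrite size_cat size_drop size_takel; [move: (fi j) ij; lias|exact: fi].
  - by rewrite size_cat size_drop size_takel; [move: (fi j) ij ltj; lias|exact: fi].
case: (ltngtP i1 j1) => h hH; [exact: (main i1 j1)|by apply: (main j1 i1) => //; rewrite Hsym|].
have eij : i1 = j1 by apply: val_inj.
by move: hH; rewrite eij Hirr.
Qed.

(* The fan consists of [v] and a path [w1 :: w] of neighbours of [v]; going from
   [w1] to [v] and back to the path skips any number of its vertices. *)
Lemma fan_pancyclic v w1 (w B : seq T) l :
  2 * a < size w -> uniq (v :: w1 :: w ++ B) -> {in w1 :: w, forall x, H v x} ->
  path H w1 (w ++ B) -> H (last w1 (w ++ B)) w1 ->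
  2 < l <= (size w + size B).+2 ->
  exists s, [/\ size s = l, uniq s & cycle H s].
Proof.
move=> aw; have [N] := ubnP (size B); elim: N B => // N IH B ltN uB hv pB lB /andP[l3 lle].
have [lw|lw] := leqP l (size w).+2.
  exists (v :: take l.-1 (w1 :: w)); split.
  - by rewrite /= size_takel /=; move: l3 lw; lias.
  - move: uB; rewrite -cat_cons cons_uniq cat_uniq mem_cat negb_or => /and3P[/andP[vw _] uw _].
    by rewrite cons_uniq take_uniq // andbT; apply: contra vw; apply: mem_take.
  - have l1 : l.-1 = l.-2.+1 by move: l3; lias.
    rewrite l1 /= hv ?inE ?eqxx //= rcons_path; apply/andP; split.
      by move: pB; rewrite -{1}(cat_take_drop l.-2 w) -catA cat_path => /andP[].
    rewrite Hsym hv //; have := mem_last w1 (take l.-2 w); rewrite !inE => /orP[->//|].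
    by move=> /mem_take ->; rewrite orbT.
have lastB : last w1 (w ++ B) = last (last w1 w) B by rewrite last_cat.
have [lB2|lB2] := leqP l (size B).+2; last first.
  pose j := (size w + size B).+2 - l.
  have jw : j < size w by rewrite /j; move: lle lB2 lw; lias.
  exists (w1 :: v :: drop j w ++ B); split.
  - rewrite /= size_cat size_drop; move: jw; rewrite /j; move: lle lB2; lias.
  - move: uB; rewrite /= !inE !mem_cat !negb_or !cat_uniq.
    move=> /and3P[/and3P[vw1 vw vB] /andP[w1w w1B] /and3P[uw wB uB']].
    rewrite eq_sym vw1 w1B vB drop_uniq // uB' andbT /=.
    have -> : w1 \notin drop j w by apply: contra w1w; apply: mem_drop.
    have -> : v \notin drop j w by apply: contra vw; apply: mem_drop.
    rewrite /= andbT; apply/hasPn=> y yB /=; apply/negP=> /mem_drop yw.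
    by move/hasPn: wB => /(_ y yB); rewrite /= yw.
  - rewrite /= Hsym hv ?inE ?eqxx //= rcons_cat cat_path rcons_path.
    have x0 : T by exact: v.
    have pw : path H w1 w by move: pB; rewrite cat_path => /andP[].
    have pB' : path H (last w1 w) B by move: pB; rewrite cat_path => /andP[].
    have dw : drop j w = nth x0 w j :: drop j.+1 w by rewrite (drop_nth x0).
    have lw' : last v (drop j w) = last w1 w.
      by rewrite -{2}(cat_take_drop j w) last_cat dw.
    rewrite lw' pB' -lastB lB andbT andbT.
    move: pw; rewrite -{1}(cat_take_drop j w) cat_path dw /= => /and3P[_ _ ->].
    by rewrite hv // inE mem_nth ?orbT.
have uB' : uniq B by move: uB; rewrite /= cat_uniq => /and3P[_ _ /and3P[]].
have pB' : path H (last w1 w) B by move: pB; rewrite cat_path => /andP[].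
(* Fewer than [2 * a < size w] vertices are lost, and [l <= size B + 2], so [l] does not exceed the
   length of the shortened cycle. *)
have [|B' [pB2 lB' sB' s1 s2]] := shorten_arc uB' pB'; first by move: lB2 lw aw; lias.
apply: (IH B') => //.
- by move: ltN s1; lias.
- apply: subseq_uniq uB; rewrite /= !eqxx; exact: cat_subseq.
- by move: pB; rewrite !cat_path => /andP[-> _].
- by rewrite last_cat lB' -lastB.
- by rewrite l3; move: lB2 s2 aw; lias.
Qed.
End Fan.

(** * Connecting the classes by random edges *)

Section ConnectingMatching.
Variables (T : finType) (t : nat) (c : T -> 'I_t) (rr : rel T).
Variables (S Tg : {set T}) (lab : T -> nat) (rho : nat).

(* [lab y] is the round in which [y] may be used as a target; [Z] stands for the
   vertices that are already used. *)
Definition expands := forall (r : nat) (I : {set 'I_t}) (Z : {set T}),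
  r < rho -> I != set0 -> 2 * #|[set x | c x \in I]| <= #|T| -> #|Z| <= 5 * #|I| ->
  exists x y, [/\ x \in S :\: Z, c x \in I, y \in Tg :\: Z, lab y = r & (c y \notin I) && rr x y].

Hypothesis hexp : expands.

(** First and second coordinates are compared separately; with disjoint sets of sources and targets
    this is a matching in the usual sense. *)
Definition matching (E : {set T * T}) :=
  {in E &, forall p q, (p.1 == q.1) || (p.2 == q.2) -> p = q}.

(* [E] is a forest on the colours, [f] labels its components *)
Definition forest (E : {set T * T}) (f : 'I_t -> 'I_t) r :=
  [/\ {in E, forall p, [/\ p.1 \in S, p.2 \in Tg, lab p.2 < r, rr p.1 p.2
                        & (c p.1 != c p.2) && (f (c p.1) == f (c p.2))]},
      matching E,
      forall I : {set 'I_t}, {in E, forall p, (c p.1 \in I) = (c p.2 \in I)} ->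
        forall i j, f i = f j -> i \in I -> j \in I,
      forall i, #|[set p in E | f (c p.1) == f i]| < #|[set j | f j == f i]|
    & #|E| + #|f @: setT| = t].

(** The component of [c y] takes the label of that of [c x]. The merged component has one edge more
    than its two parts together, which preserves the strict bound by the number of colours. *)
Lemma forest_add E f r x y : forest E f r ->
  x \in S -> y \in Tg -> lab y < r -> rr x y -> f (c x) != f (c y) ->
  {in E, forall p, (p.1 != x) && (p.2 != y)} ->
  forest ((x, y) |: E) (fun i => if f i == f (c y) then f (c x) else f i) r.
Proof.
move=> [h1 h2 h3 h4 h5] xS yT yr rxy fxy hE.
have nE : (x, y) \notin E by apply/negP=> /hE; rewrite eqxx.
have cxy : c x != c y by apply: contraNneq fxy => ->.
set f' := fun i => _.
have f'x : f' (c x) = f (c x) by rewrite /f' (negPf fxy).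
have f'y : f' (c y) = f (c x) by rewrite /f' eqxx.
split.
- move=> p; rewrite in_setU1 => /orP[/eqP->|/h1[p1 p2 p3 p4 /andP[p5 /eqP p6]]] /=.
    by split; rewrite // cxy f'x f'y eqxx.
  by split; rewrite // p5 /f' p6 eqxx.
- move=> p q; rewrite !in_setU1 => /orP[/eqP->|pE] /orP[/eqP->|qE] //=.
  + by have /andP[/negPf n1 /negPf n2] := hE q qE; rewrite eq_sym n1 eq_sym n2.
  + by have /andP[/negPf n1 /negPf n2] := hE p pE; rewrite n1 n2.
  + exact: h2.
- move=> I hI.
  have hI' : {in E, forall p, (c p.1 \in I) = (c p.2 \in I)}.
    by move=> p pE; apply: hI; rewrite in_setU1 pE orbT.
  have hxy : (c x \in I) = (c y \in I) by apply: (hI (x, y)); rewrite in_setU1 eqxx.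
  have h3' := h3 I hI'.
  move=> i j; rewrite /f'.
  have [ei|_] := eqVneq (f i) (f (c y)); have [ej|_] := eqVneq (f j) (f (c y)).
  + by move=> _; apply: h3'; rewrite ei ej.
  + move=> ej iI; apply: (h3' (c x) j) => //; rewrite hxy; exact: (h3' i).
  + move=> ei iI; apply: (h3' (c y) j) => //; rewrite -hxy; exact: (h3' i).
  + exact: h3'.
- move=> i; have [eqk|nek] := eqVneq (f' i) (f (c x)).
    have := h4 (c x); have := h4 (c y).
    set A := [set p in E | f (c p.1) == f (c x)]; set B := [set p in E | f (c p.1) == f (c y)].
    set Cx := [set j | f j == f (c x)]; set Cy := [set j | f j == f (c y)].
    have le1 : #|[set p in (x, y) |: E | f' (c p.1) == f (c x)]| <= 1 + (#|A| + #|B|).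
      apply: leq_trans (_ : #|(x, y) |: (A :|: B)| <= _).
        apply: subset_leq_card; apply/subsetP=> p; rewrite in_set !in_setU1 => /andP[/orP[->//|pE]].
        rewrite in_setU !in_set pE /= /f'; case: (f (c p.1) == f (c y)); rewrite ?orbT //.
        by move=> ->; rewrite orbT.
      by rewrite cardsU1 leq_add ?leq_b1 // leq_card_setU.
    have eq2 : #|[set j | f' j == f (c x)]| = #|Cx| + #|Cy|.
      have -> : [set j | f' j == f (c x)] = Cx :|: Cy.
        apply/setP=> j; rewrite in_setU !in_set /f'.
        by have [->|_] := eqVneq (f j) (f (c y)); rewrite ?eqxx ?orbT ?orbF.
      rewrite cardsU (_ : Cx :&: Cy = set0) ?cards0 ?subn0 //.
      by apply/setP=> j; rewrite !inE; apply/negP=> /andP[/eqP-> ]; rewrite (negPf fxy).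
    by rewrite eqk eq2 => ltB ltA; apply: leq_ltn_trans le1 _; move: ltA ltB; lias.
  have ni : (f i == f (c y)) = false by apply: contraNF nek => /eqP h; rewrite /f' h eqxx.
  have fi : f' i = f i by rewrite /f' ni.
  have nix : (f (c x) == f i) = false by rewrite -fi eq_sym (negPf nek).
  have feq k : (f' k == f i) = (f k == f i).
    by rewrite /f'; have [->|//] := eqVneq (f k) (f (c y)); rewrite nix eq_sym ni.
  rewrite fi; have -> : [set p in (x, y) |: E | f' (c p.1) == f i] = [set p in E | f (c p.1) == f i].
    apply/setP=> p; rewrite [LHS]in_set [RHS]in_set in_setU1 feq; have [->|//] := eqVneq p (x, y).
    by rewrite /= nix andbF.
  have -> : [set j | f' j == f i] = [set j | f j == f i] by apply/setP=> j; rewrite !in_set feq.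
  exact: h4.
- rewrite cardsU1 nE.
  have -> : f' @: setT = (f @: setT) :\ f (c y).
    apply/setP=> k; rewrite in_setD1; apply/imsetP/andP.
      move=> [i _ ->]; rewrite /f'; have [_|n] := eqVneq (f i) (f (c y)).
        by rewrite fxy imset_f.
      by rewrite n imset_f.
    by move=> [nk /imsetP[i _ ek]]; exists i; rewrite // /f' -ek (negPf nk).
  have := cardsD1 (f (c y)) (f @: setT); rewrite imset_f // => h6.
  by move: h5; rewrite h6; lias.
Qed.

Lemma forest0 : forest set0 id 0.
Proof.
split.
- by move=> p; rewrite inE.
- by move=> p q; rewrite inE.
- by move=> I _ i j ->.
- move=> i; rewrite (_ : [set p in set0 | _] = set0) ?cards0; last by apply/setP=> p; rewrite !inE.
  by rewrite card_gt0; apply/set0Pn; exists i; rewrite inE.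
- by rewrite cards0 imset_id cardsT card_ord.
Qed.

Definition extendable (E : {set T * T}) (f : 'I_t -> 'I_t) r x y :=
  [&& x \in S, y \in Tg, lab y == r, rr x y, f (c x) != f (c y) &
      [forall p in E, (p.1 != x) && (p.2 != y)]].

Lemma forest_maximal (E : {set T * T}) f r : forest E f r ->
  exists (E' : {set T * T}) (f' : 'I_t -> 'I_t), [/\ forest E' f' r.+1, E \subset E',
     {in E' :\: E, forall p, lab p.2 = r} & forall x y, ~~ extendable E' f' r x y].
Proof.
move=> hf.
have hf1 : forest E f r.+1.
  by case: hf => h1 h2 h3 h4 h5; split=> // p /h1[p1 p2 p3 p4 p5]; split=> //; apply: ltnW.
have sub0 : {in E :\: E, forall p, lab p.2 = r} by move=> p; rewrite setDv inE.
suff gen N : forall (E1 : {set T * T}) f1, forest E1 f1 r.+1 -> {in E1 :\: E, forall p, lab p.2 = r} ->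
  E \subset E1 -> t - #|E1| < N ->
  exists (E' : {set T * T}) (f' : 'I_t -> 'I_t), [/\ forest E' f' r.+1, E \subset E',
     {in E' :\: E, forall p, lab p.2 = r} & forall x y, ~~ extendable E' f' r x y].
  exact: (gen _ E f hf1 sub0 (subxx E) (ltnSn _)).
elim: N => // N IH E1 f1 {}hf1 sub1 sE1 ltN.
have [/existsP[x /existsP[y]]|] := boolP [exists x, exists y, extendable E1 f1 r x y]; last first.
  move=> /existsPn hn; exists E1, f1; split=> // x y; have := hn x.
  by rewrite negb_exists => /forallP.
case/and5P=> xS yT /eqP yr rxy /andP[fxy /forall_inP hE].
have nE : (x, y) \notin E1 by apply/negP=> /hE; rewrite eqxx.
have hf2 := forest_add hf1 xS yT (eq_leq (f_equal Datatypes.S yr)) rxy fxy hE.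
apply: (IH _ _ hf2).
- move=> p; rewrite in_setD in_setU1 => /andP[pE /orP[/eqP->//|pE1]].
  by apply: sub1; rewrite in_setD pE.
- by apply: subset_trans sE1 (subsetUr _ _).
- have [_ _ _ _ h5] := hf2; move: ltN; rewrite cardsU1 nE.
  move: h5; rewrite cardsU1 nE => h5.
  have : 0 < #|(fun i => if f1 i == f1 (c y) then f1 (c x) else f1 i) @: setT|.
    by rewrite card_gt0; apply/set0Pn; exists (f1 (c x)); apply/imsetP; exists (c y); rewrite ?eqxx.
  by move: h5; lias.
Qed.

(* One half of the components carries at most half of the vertices. If the round
   stopped early, its edges to the targets of label [r] would be covered by the
   few vertices used inside that half or in this round. *)
Lemma forest_round (E : {set T * T}) f r : r < rho -> forest E f r ->
  exists (E' : {set T * T}) (f' : 'I_t -> 'I_t),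
    forest E' f' r.+1 /\ 2 * (#|f' @: setT|.-1) <= #|f @: setT|.-1.
Proof.
move=> rr0 hf; have [E' [f' [hf' sE lE stuck]]] := forest_maximal hf.
exists E', f'; split=> //; rewrite leqNgt; apply/negP=> big.
set C := f' @: setT in big *.
have C2 : 1 < #|C| by move: big; lias.
have [h1 h2 h3 h4 h5] := hf'; have [_ _ _ _ h5'] := hf.
have [K1 K1C cK1] : exists2 K1 : {set 'I_t}, K1 \subset C & #|K1| = #|C|./2.
  have : #|C|./2 <= #|C| by rewrite -divn2 leq_div.
  by move=> /card_geqP[s [us ss sC]]; exists [set x in s];
    [apply/subsetP=> x; rewrite inE; apply: sC|rewrite cardsE (card_uniqP us)].
pose mass (K : {set 'I_t}) := #|[set x | f' (c x) \in K]|.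
have [K [KC cK mK]] : exists K : {set 'I_t}, [/\ K \subset C, #|C|./2 <= #|K| & 2 * mass K <= #|T|].
  have disj : mass K1 + mass (C :\: K1) <= #|T|.
    rewrite /mass -cardsUI (_ : _ :&: _ = set0) ?cards0 ?addn0 ?max_card //.
    by apply/setP=> x; rewrite !inE; apply/negP=> /and3P[-> ].
  have [le|le] := leqP (2 * mass K1) #|T|; first by exists K1; rewrite cK1.
  exists (C :\: K1); split; first exact: subsetDl.
    by rewrite cardsD (setIidPr K1C) cK1; lias.
  by move: disj le; lias.
pose I := [set i | f' i \in K].
have K0 : 0 < #|K| by apply: leq_trans cK; move: C2; lias.
have cI : #|K| <= #|I|.
  apply: leq_trans (leq_imset_card f' I); apply: subset_leq_card; apply/subsetP=> k kK.
  by have /imsetP[i _ ek] := subsetP KC k kK; apply/imsetP; exists i; rewrite // inE -ek.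
have I0 : I != set0 by rewrite -card_gt0; apply: leq_trans cI.
have mI : 2 * #|[set x | c x \in I]| <= #|T|.
  by rewrite (_ : [set x | c x \in I] = [set x | f' (c x) \in K]) //; apply/setP=> x; rewrite !inE.
pose EI := [set p in E' | c p.1 \in I].
have cEI : #|EI| <= #|I|.
  have e1 : #|EI| = \sum_(k in K) #|[set p in E' | f' (c p.1) == k]|.
    rewrite -sum1_card (partition_big (fun p : T * T => f' (c p.1)) (mem K)) /=; last first.
      by move=> p; rewrite !inE => /andP[].
    apply: eq_bigr => k kK; rewrite -sum1_card; apply: eq_bigl => p; rewrite !inE.
    by have [->|] := eqVneq (f' (c p.1)) k; rewrite ?andbF // !andbT [k \in K]kK andbT.
  have e2 : #|I| = \sum_(k in K) #|[set i | f' i == k]|.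
    rewrite -sum1_card (partition_big f' (mem K)) /=; last by move=> p; rewrite !inE.
    apply: eq_bigr => k kK; rewrite -sum1_card; apply: eq_bigl => p; rewrite !inE.
    by have [->|] := eqVneq (f' p) k; rewrite ?andbF // !andbT [k \in K]kK.
  rewrite e1 e2; apply: leq_sum => k kK.
  by have /imsetP[i _ ->] := subsetP KC k kK; apply: ltnW.
(* Sources used outside [I] do not matter, as [x] is sought over [I], and targets of earlier rounds
   have smaller labels. The forest bound limits the first set to [#|I|] elements; the second has
   fewer than [#|C|], the number of components lost in this round. *)
pose Z := [set p.1 | p in EI] :|: [set p.2 | p in E' :\: E].
have cZ : #|Z| <= #|I| + (#|E'| - #|E|).
  apply: leq_trans (leq_card_setU _ _) _; apply: leq_add.
    by apply: leq_trans (leq_imset_card _ _) cEI.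
  apply: leq_trans (leq_imset_card _ _) _.
  by rewrite cardsD (setIidPr sE).
have Zle : #|Z| <= 5 * #|I|.
  apply: leq_trans cZ _; have sEc := subset_leq_card sE.
  by move: big C2 h5 h5' cI cK; rewrite -/C; lias.
have [x [y [xSZ cxI yTZ ly /andP[cyI rxy]]]] := hexp rr0 I0 mI Zle.
move: xSZ yTZ; rewrite !in_setD => /andP[xZ xS] /andP[yZ yT].
have/negP := stuck x y; apply; apply/and5P; split=> //; first by rewrite ly.
apply/andP; split.
  by apply: contraNneq cyI => exy; rewrite inE -exy; move: cxI; rewrite inE.
apply/forall_inP=> p pE; apply/andP; split; apply/eqP=> ep.
  move/negP: xZ; apply; rewrite in_setU; apply/orP; left; apply/imsetP; exists p; rewrite //.
  by rewrite in_set pE ep.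
have [pE0|pE0] := boolP (p \in E).
  have [hh _ _ _ _] := hf; have [_ _] := hh p pE0; rewrite ep ly ltnn //.
move/negP: yZ; apply; rewrite in_setU; apply/orP; right; apply/imsetP; exists p; rewrite //.
by rewrite in_setD pE0.
Qed.

(** The number of components minus one starts at [t - 1 < 2 ^ rho] and is at least halved in each
    round, so it vanishes. Connectedness is stated through cuts, the form in which the tree order
    uses it. *)
Lemma connecting_matching : t <= 2 ^ rho ->
  exists E : {set T * T}, [/\
    {in E, forall p, [/\ p.1 \in S, p.2 \in Tg, rr p.1 p.2 & c p.1 != c p.2]},
    matching E, #|E| <= t.-1 &
    forall I : {set 'I_t}, I != set0 -> I != setT ->
      exists2 p, p \in E & (c p.1 \in I) != (c p.2 \in I)].
Proof.
move=> ht.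
have [E [f [hf hc]]] : exists E f, forest E f rho /\ 2 ^ rho * (#|f @: setT|.-1) <= t.-1.
  have gen r : r <= rho -> exists E f, forest E f r /\ 2 ^ r * (#|f @: setT|.-1) <= t.-1.
    elim: r => [|r IH] rle.
      exists set0, id; split; first exact: forest0.
      by rewrite imset_id cardsT card_ord mul1n.
    have [E [f [hf hc]]] := IH (ltnW rle).
    have [E' [f' [hf' hc']]] := forest_round rle hf.
    exists E', f'; split=> //; apply: leq_trans hc.
    by rewrite expnS [2 * _]mulnC -mulnA leq_mul2l hc' orbT.
  exact: gen.
have [h1 h2 h3 h4 h5] := hf.
have c1 : #|f @: setT| <= 1.
  case: (leqP #|f @: setT| 1) => // h; move: hc; rewrite leqNgt.
  have t0 : 0 < t by move: h5 h; lias.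
  have -> // : t.-1 < 2 ^ rho * #|f @: setT|.-1.
  apply: leq_trans (_ : 2 ^ rho * 1 <= _); last by rewrite leq_mul2l; move: h; lias.
  by rewrite muln1; move: ht t0; lias.
exists E; split=> //.
- by move=> p /h1[p1 p2 _ p4 /andP[p5 _]].
- have [t0|t0] := posnP t; first by move: h5; lias.
  have : 0 < #|f @: setT|.
    by rewrite card_gt0; apply/set0Pn; exists (f (Ordinal t0)); rewrite imset_f.
  by move: h5; lias.
- move=> I /set0Pn[i iI] IT.
  have [/exists_inP//|] := boolP [exists p in E, (c p.1 \in I) != (c p.2 \in I)].
  rewrite negb_exists_in => /forall_inP hI; move/negP: IT; case; apply/eqP/setP=> j.
  rewrite inE; apply: (h3 I) iI; first by move=> p pE; have := hI p pE; rewrite negbK => /eqP.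
  by apply: (card_le1_eqP c1); rewrite imset_f.
Qed.
End ConnectingMatching.

(** * Search order and parity correction on the classes *)

Section TreeOrder.
Variables (T : finType) (t : nat) (c : T -> 'I_t) (E : {set T * T}).
Hypothesis cut : forall I : {set 'I_t}, I != set0 -> I != setT ->
  exists2 p, p \in E & (c p.1 \in I) != (c p.2 \in I).

Definition joins (p : T * T) (u v : 'I_t) :=
  ((c p.1 == u) && (c p.2 == v)) || ((c p.2 == u) && (c p.1 == v)).

(** The colours are listed one by one, the cut condition always supplying an edge from the listed
    ones to a new one. Every colour except the first thus has a neighbour of lower rank. *)
Lemma tree_rank : exists rk : 'I_t -> nat, [/\ injective rk, forall u, rk u < t &
  forall u, 0 < rk u -> exists p v, [/\ p \in E, joins p u v & rk v < rk u]].
Proof.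
have [t0|t0] := posnP t.
  have no (i : 'I_t) : False by have := ltn_ord i; rewrite {2}t0.
  by exists (fun=> 0); split=> i; case: (no i).
have gen n : n < t -> exists L : seq 'I_t, [/\ uniq L, size L = n.+1 & forall u, u \in L ->
    0 < index u L -> exists p v, [/\ p \in E, joins p u v, v \in L & index v L < index u L]].
  elim: n => [|n IH] lt.
    by exists [:: Ordinal t0]; split=> // u; rewrite inE => /eqP->; rewrite /= ?eqxx.
  have [L [uL sL hL]] := IH (ltnW lt); pose I := [set u in L].
  have [||p pE hp] := cut (I := I).
  - by rewrite -card_gt0 cardsE (card_uniqP uL) sL.
  - apply/eqP=> hI; have := card_uniqP uL; rewrite -cardsE -/I hI cardsT card_ord sL.
    by move: lt; lias.
  have [u [v [uN vL jp]]] : exists u v, [/\ u \notin L, v \in L & joins p u v].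
    move: hp; rewrite !inE; case h1 : (c p.1 \in L); case h2 : (c p.2 \in L) => // _.
      by exists (c p.2), (c p.1); rewrite h1 h2 /joins !eqxx orbT.
    by exists (c p.1), (c p.2); rewrite h1 h2 /joins !eqxx.
  exists (rcons L u); split; first by rewrite rcons_uniq uN.
    by rewrite size_rcons sL.
  have idx w : w \in L -> index w (rcons L u) = index w L.
    by move=> wL; rewrite -cats1 index_cat wL.
  move=> w; rewrite mem_rcons inE => /orP[/eqP->|wL].
    move=> _; exists p, v; rewrite mem_rcons inE vL orbT idx // -cats1 index_cat (negPf uN).
    by split=> //; rewrite ltn_addr // index_mem.
  rewrite idx // => /(hL w wL)[q [w' [h1 h2 h3 h4]]]; exists q, w'.
  by rewrite mem_rcons inE h3 orbT idx.
have [|L [uL sL hL]] := gen t.-1; first by lias.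
have all u : u \in L.
  have : #|L| = #|'I_t| by rewrite card_ord (card_uniqP uL) sL prednK.
  by move=> h; have := subset_cardP h (subset_predT _) u => ->.
exists (fun u => index u L); split.
- by move=> u v h; rewrite -(nth_index u (all u)) h nth_index.
- by move=> u; move: (all u); rewrite -index_mem sL prednK.
- by move=> u /(hL u (all u))[p [v [h1 h2 h3 h4]]]; exists p, v.
Qed.

(** The degree of [u] in the multigraph that [J] induces on the colours. *)
Definition gdeg (J : {set T * T}) (u : 'I_t) := \sum_(p in J) ((c p.1 == u) + (c p.2 == u)).

Lemma gdeg_toggle (J : {set T * T}) p :
  exists2 J' : {set T * T}, J' \subset p |: J &
    forall u, odd (gdeg J' u) = odd (gdeg J u) (+) (c p.1 == u) (+) (c p.2 == u).
Proof.
have [pJ|pJ] := boolP (p \in J).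
  exists (J :\ p); first by apply: subset_trans (subsetDl _ _) (subsetUr _ _).
  move=> w; rewrite /gdeg [in RHS](big_setD1 p) //= !oddD !oddb.
  by case: (c p.1 == w); case: (c p.2 == w); case: (odd _).
exists (p |: J) => // w; rewrite /gdeg (big_setU1 p) //= !oddD !oddb.
by case: (c p.1 == w); case: (c p.2 == w); case: (odd _).
Qed.

Lemma sum_gdeg (J : {set T * T}) : \sum_u gdeg J u = 2 * #|J|.
Proof.
rewrite /gdeg exchange_big /= -sum1_card big_distrr /=; apply: eq_bigr => p _.
rewrite big_split /= (bigD1 (c p.1)) //= eqxx big1 ?addn0; last first.
  by move=> i /negPf; rewrite eq_sym => ->.
by rewrite (bigD1 (c p.2)) //= eqxx big1 // => i /negPf; rewrite eq_sym => ->.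
Qed.

Lemma odd_sum (I : finType) (F : I -> nat) : odd (\sum_i F i) = \big[addb/false]_i odd (F i).
Proof. exact: (big_morph odd oddD). Qed.

(** A [T]-join in a connected graph. Colours are treated by decreasing rank; a wrong parity is
    repaired by toggling an edge to a lower colour, which leaves the higher ones alone. The colour
    of rank zero is then right by the handshake identity [sum_gdeg]. *)
Lemma parity_join (f : 'I_t -> nat) : ~~ odd (\sum_u f u) ->
  exists2 J : {set T * T}, J \subset E & forall u, odd (gdeg J u) = odd (f u).
Proof.
move=> fev; have [rk [rinj rlt hrk]] := tree_rank.
have [J JE hJ] : exists2 J : {set T * T}, J \subset E & forall u, 1 <= rk u -> odd (gdeg J u) = odd (f u).
  suff gen k : forall j, j + k = t ->
      exists2 J : {set T * T}, J \subset E & forall u, maxn 1 j <= rk u -> odd (gdeg J u) = odd (f u).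
    by have [//|J JE hJ] := gen t 0; exists J.
  elim: k => [|k IH] j jk.
    exists set0 => [|u]; first exact: sub0set.
    by have := rlt u; move: jk => h0 h1 h2; exfalso; move: h0 h1 h2; lias.
  have [|J JE hJ] := IH j.+1; first by rewrite -jk addnS.
  have [/existsP[u /and3P[/eqP ru r0 bad]]|] :=
     boolP [exists u, [&& rk u == j, 0 < rk u & odd (gdeg J u) != odd (f u)]]; last first.
    rewrite negb_exists => /forallP ok; exists J => // u hu.
    have [ru|ru] := eqVneq (rk u) j.
      have := ok u; rewrite ru eqxx -ru /= (leq_trans (leq_maxl _ _) hu) /= negbK.
      by move=> /eqP.
    by apply: hJ; move: hu ru; lias.
  have [p [v [pE jp rv]]] := hrk u r0.
  have [J' J'E hJ'] := gdeg_toggle J p.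
  exists J'; first by apply: subset_trans J'E _; rewrite subUset sub1set pE.
  have tog w : odd (gdeg J' w) = odd (gdeg J w) (+) (u == w) (+) (v == w).
    by rewrite hJ'; case/orP: jp => /andP[/eqP-> /eqP->] //; rewrite addbAC.
  move=> w hw; have vw : (v == w) = false.
    by apply/eqP=> h; move: rv hw; rewrite h ru; lias.
  rewrite tog vw addbF; have [<-|nuw] := eqVneq u w.
    by move: bad; case: (odd _); case: (odd _).
  rewrite addbF; apply: hJ; have : rk w != j.
    by apply: contraNneq nuw => h; apply/eqP; apply: rinj; rewrite ru h.
  by move: hw; lias.
exists J => // u; have [|ru] := posnP (rk u); last exact: hJ.
move=> ru; have h1 : odd (\sum_w gdeg J w) = false by rewrite sum_gdeg oddM.
move: fev h1; rewrite !odd_sum (bigD1 u) //= => h2; rewrite (bigD1 u) //= => h1.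
move: h1 h2; rewrite (eq_bigr (fun w => odd (f w))); last first.
  move=> w nwu; apply: hJ; rewrite lt0n; apply: contraNneq nwu => rw.
  by apply/eqP; apply: rinj; rewrite ru rw.
by case: (odd _); case: (odd _); case: (\big[_/_]_(_ | _) _).
Qed.
End TreeOrder.

(** * The involution exchanging the ends of matching edges *)

Section PairInvolution.
Variables (T : finType) (P Q : {set T}) (E : {set T * T}).
Hypotheses (dPQ : [disjoint P & Q]) (mE : matching E).
Hypothesis sE : {in E, forall p, (p.1 \in P) && (p.2 \in Q)}.

Definition pairinv x :=
  if [pick p in E | p.1 == x] is Some p then p.2
  else if [pick p in E | p.2 == x] is Some p then p.1 else x.

Lemma pairinv1 p : p \in E -> pairinv p.1 = p.2.
Proof.
move=> pE; rewrite /pairinv; case: pickP => [q /andP[qE q1]|/(_ p)]; last by rewrite pE eqxx.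
by congr (_.2); apply: mE => //; rewrite q1.
Qed.

Lemma pairinv2 p : p \in E -> pairinv p.2 = p.1.
Proof.
move=> pE; have /andP[_ p2] := sE pE; rewrite /pairinv; case: pickP => [q /andP[qE /eqP q1]|_].
  by have /andP[] := sE qE; rewrite q1 (disjointFl dPQ p2).
case: pickP => [q /andP[qE q1]|/(_ p)]; last by rewrite pE eqxx.
by congr (_.1); apply: mE => //; rewrite q1 orbT.
Qed.

Lemma pairinvP x : pairinv x != x ->
  exists2 p, p \in E & (x == p.1) || (x == p.2).
Proof.
rewrite {1}/pairinv; case: pickP => [p /andP[pE /eqP p1] _|_].
  by exists p; rewrite // p1 eqxx.
case: pickP => [p /andP[pE /eqP p2] _|_]; last by rewrite eqxx.
by exists p; rewrite // p2 eqxx orbT.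
Qed.

Lemma pairinv_inv : involutive pairinv.
Proof.
move=> x; have [h|h] := eqVneq (pairinv x) x; first by rewrite !h.
have [p pE /orP[]/eqP->] := pairinvP h; first by rewrite pairinv1 // pairinv2.
by rewrite pairinv2 // pairinv1.
Qed.

Lemma pair_neq p : p \in E -> p.1 != p.2.
Proof.
move=> pE; have /andP[p1 p2] := sE pE; apply/eqP=> h.
by move: p2; rewrite -h (disjointFr dPQ p1).
Qed.

Lemma terms_pairinv : terms pairinv = [set p.1 | p in E] :|: [set p.2 | p in E].
Proof.
apply/setP=> x; rewrite inE; apply/idP/setUP.
  by move=> /pairinvP[p pE /orP[]/eqP->]; [left|right]; apply/imsetP; exists p.
case=> /imsetP[p pE ->]; first by rewrite pairinv1 // eq_sym pair_neq.
by rewrite pairinv2 // pair_neq.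
Qed.

Lemma card_terms_pairinv (A : {set T}) :
  #|terms pairinv :&: A| = \sum_(p in E) ((p.1 \in A) + (p.2 \in A)).
Proof.
have cnt (g : T * T -> T) : {in E &, injective g} ->
    #|[set g p | p in E] :&: A| = \sum_(p in E) (g p \in A).
  move=> ginj; have -> : [set g p | p in E] :&: A = g @: [set p in E | g p \in A].
    apply/setP=> x; rewrite in_setI; apply/andP/imsetP.
      by move=> [/imsetP[p pE ->] gA]; exists p; rewrite // in_set pE.
    by move=> [p]; rewrite in_set => /andP[pE gA] ->; rewrite imset_f.
  rewrite card_in_imset; last by move=> p q; rewrite !in_set => /andP[pE _] /andP[qE _]; apply: ginj.
  rewrite -sum1_card big_mkcond [RHS]big_mkcond; apply: eq_bigr => p _.
  by rewrite in_set; case: (p \in E); case: (g p \in A).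
rewrite terms_pairinv setIUl cardsU (_ : _ :&: _ :&: _ = set0); last first.
  apply/setP=> x; rewrite !in_setI in_set0; apply/negP=> /andP[/andP[/imsetP[p pE ->] _]].
  move=> /andP[/imsetP[q qE h] _]; have /andP[p1 _] := sE pE; have /andP[_ q2] := sE qE.
  by move: q2; rewrite -h (disjointFr dPQ p1).
rewrite cards0 subn0 !cnt ?big_split //= => p q pE qE h; apply: mE => //.
  by rewrite h eqxx orbT.
by rewrite h eqxx.
Qed.
End PairInvolution.

Lemma kgoodD (T : finType) (e : rel T) k (W X : {set T}) :
  kgood e k W -> kgood e (k - #|X|) (W :\: X).
Proof.
move=> [h1 h2]; split.
  move=> x; rewrite inE => /andP[_ /h1]; rewrite setIDA cardsD.
  have := subset_leq_card (subsetIr (nbrs e x :&: W) X); lias.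
move=> Z ltZ; rewrite setDDl; apply: h2.
by apply: leq_ltn_trans (leq_card_setU _ _) _; move: ltZ; lias.
Qed.

Lemma leq_link_cost a h h' : h <= h' -> link_cost a h <= link_cost a h'.
Proof.
move=> /subnK <-; elim: (h' - h) => // n IH; rewrite addSn link_costS.
by apply: leq_trans IH _; apply: leq_addr.
Qed.

(** * From sequences of entries to sequences of vertices *)

Section Expand.
Variables (T : finType) (e H : rel T) (c : T -> nat) (m : T -> T).
Hypothesis eH : subrel e H.

Definition unfold_blocks (s : seq T) :=
  flatten [seq if m x == x then [:: x] else [:: x; m x] | x <- s].

(** The path starts at [m x], where the block entered at [x] is left. Inside a two-ended block it
    uses an edge of [H] that may not belong to [e]. *)
Lemma unfold_blocks_path x s : {in s, forall y, m y != y -> H y (m y)} ->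
  path (brel e c m) x s ->
  path H (m x) (unfold_blocks s) /\ last (m x) (unfold_blocks s) = m (last x s).
Proof.
elim: s x => // y s IH x hs /= /andP[/andP[exy _] ps].
have [|p1 p2] := IH y _ ps; first by move=> z zs; apply: hs; rewrite inE zs orbT.
rewrite /unfold_blocks /=; have [my|my] := eqVneq (m y) y.
  by rewrite my in p1 p2; rewrite /= eH // -my.
rewrite /= eH //= hs ?inE ?eqxx //.
Qed.

Lemma mem_unfold_blocks s y : involutive m ->
  (y \in unfold_blocks s) = (y \in s) || (m y \in s).
Proof.
move=> mK; apply/flattenP/orP.
  move=> [b /mapP[x xs ->]]; have [_|_] := eqVneq (m x) x.
    by rewrite inE => /eqP->; left.
  by rewrite !inE => /orP[]/eqP->; [left|right; rewrite mK].
case=> ys.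
  exists (if m y == y then [:: y] else [:: y; m y]); first by apply/mapP; exists y.
  by case: ifP; rewrite !inE eqxx.
exists (if m (m y) == m y then [:: m y] else [:: m y; m (m y)]); first by apply/mapP; exists (m y).
by rewrite mK; have [<-|] := eqVneq y (m y); rewrite !inE ?eqxx ?orbT.
Qed.

Lemma uniq_unfold_blocks s : involutive m -> uniq s ->
  {in s, forall x, m x \in s -> m x = x} -> uniq (unfold_blocks s).
Proof.
move=> mK; elim: s => //= x s IH /andP[xs us] hm.
have hm' : {in s, forall y, m y \in s -> m y = y}.
  by move=> y ys mys; apply: hm; rewrite inE ?ys ?mys orbT.
have nin : m x \notin s.
  by apply/negP=> mxs; move: (xs); rewrite -{1}(hm x) ?mxs // inE ?eqxx // mxs orbT.
rewrite /unfold_blocks /= cat_uniq -/(unfold_blocks s) IH // andbT.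
apply/andP; split; first by have [//|h] := eqVneq (m x) x; rewrite /= inE eq_sym h.
apply/hasPn=> y; rewrite mem_unfold_blocks // => ys; apply/negP.
have [mx|mx] := eqVneq (m x) x; rewrite !inE.
  by move=> /eqP eyx; move: ys; rewrite eyx mx (negPf xs).
by move=> /orP[]/eqP eyx; move: ys; rewrite eyx ?mK (negPf xs) (negPf nin).
Qed.
End Expand.

(** * The deterministic statement *)

Section Deterministic.
Variables (T : finType) (e H rr : rel T) (a k t rho : nat) (c : T -> 'I_t).
Hypotheses (esym : symmetric e) (eirr : irreflexive e).
Hypotheses (Hsym : symmetric H) (Hirr : irreflexive H) (eH : subrel e H) (rrH : subrel rr H).
Hypothesis ha : forall S, indep e S -> #|S| <= a.
Hypothesis good : forall u, kgood e k [set x | c x == u].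
Hypotheses (ta : t <= a) (trho : t <= 2 ^ rho).
(** The three terms pay for the [2 * a + 1] fan vertices taken out of the classes, for the at most
    [4 * t - 2] ends of the fan and of the two matchings, and for linking at most [2 * a] pairs in
    one class. *)
Hypothesis hk : (2 * a).+1 + 4 * a + link_cost a (2 * a) <= k.
Variables (v w1 : T) (w : seq T).
Hypotheses (sw : size w = (2 * a).+1) (uw : uniq (v :: w1 :: w)) (pw : path e w1 w).
Hypotheses (ev : {in w1 :: w, forall x, e v x}) (cw : {in w1 :: w, forall x, c x = c v}).
Variables (kind lab : T -> nat).

(* Sides 0 and 2 contain the sources, sides 1 and 3 the targets of the edges of the
   two matchings. *)
Definition side i := [set x in ~: [set x in v :: w1 :: w] | kind x == i].

Hypothesis exp1 : expands c rr (side 0) (side 1) lab rho.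
Hypothesis exp2 : expands c rr (side 2) (side 3) lab rho.

(** The path of the fan is contracted to the single block with ends [w1] and [wl]; [v] and the
    interior of the path are withdrawn until the end. *)
Let wl := last w1 w.
Let inner := [set x in v :: w] :\ wl.
Let W := ~: inner.

Lemma side_notin i x : x \in side i -> x \notin v :: w1 :: w.
Proof. by rewrite !inE => /andP[]. Qed.

Lemma sideW i x : x \in side i -> x \in W.
Proof. by move=> /side_notin; rewrite !inE !negb_or => /and3P[/negPf-> _ /negPf->]; rewrite andbF. Qed.

Lemma side_kind i x : x \in side i -> kind x = i.
Proof. by rewrite inE => /andP[_ /eqP]. Qed.

Lemma wl_in : wl \in w.
Proof. by rewrite /wl; case: w sw => //= y w' _; rewrite mem_last. Qed.

Lemma w1_neq_wl : w1 != wl.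
Proof. by apply/eqP=> h; move: uw; rewrite /= h wl_in andbF. Qed.

Lemma card_inner : #|inner| = (2 * a).+1.
Proof.
have h : #|[set x in v :: w]| = (2 * a).+2.
  rewrite cardsE (card_uniqP _) ?/= ?sw //.
  by move: uw; rewrite /= inE negb_or => /and3P[/andP[_ ->] _ ->].
move: h; rewrite (cardsD1 wl) inE inE wl_in orbT /= => h.
by apply/eqP; rewrite -(eqn_add2l 1) [1 + #|inner|]h.
Qed.

Lemma w1W : w1 \in W.
Proof.
move: uw; rewrite /= inE negb_or => /and3P[/andP[vw1 _] w1w _].
by rewrite !inE [w1 == v]eq_sym (negPf vw1) (negPf w1w) andbF.
Qed.

Lemma wlW : wl \in W.
Proof. by rewrite !inE eqxx. Qed.

Lemma notW x : x \notin W -> x \in v :: w.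
Proof. by rewrite in_setC negbK in_setD1 => /andP[_]; rewrite inE. Qed.

Lemma pancyclic_of_expansion l : 2 < l <= #|T| ->
  exists s, [/\ size s = l, uniq s & cycle H s].
Proof.
have [E1 [hE1 mE1 cE1 cut1]] := connecting_matching exp1 trho.
have [E2 [hE2 mE2 cE2 cut2]] := connecting_matching exp2 trho.
have [rk [rinj rlt hrk]] := tree_rank cut1.
(* With the parities of [E1] prescribed for [J], every class has an even number of ends of
   [E1 :|: J]; the fan adds two ends to one class. *)
have [|J JE hJ] := parity_join cut2 (f := gdeg c E1).
  by rewrite sum_gdeg oddM.
have hJ' p : p \in J -> [/\ p.1 \in side 2, p.2 \in side 3, rr p.1 p.2 & c p.1 != c p.2].
  by move=> /(subsetP JE)/hE2.
have mJ : matching J by move=> p q /(subsetP JE) pE /(subsetP JE) qE; apply: mE2.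
pose E0 := (w1, wl) |: (E1 :|: J).
pose P := w1 |: (side 0 :|: side 2); pose Q := wl |: (side 1 :|: side 3).
have nw1 i : w1 \notin side i by apply/negP=> /side_notin; rewrite !inE eqxx orbT.
have nwl i : wl \notin side i by apply/negP=> /side_notin; rewrite !inE wl_in !orbT.
have dside i j x : x \in side i -> x \in side j -> i = j by move=> /side_kind <- /side_kind <-.
have dPQ : [disjoint P & Q].
  rewrite disjoints_subset; apply/subsetP=> x; rewrite in_setC !(in_setU1, in_setU).
  move=> /or3P[/eqP->|h|h]; apply/negP.
  - by rewrite (negPf w1_neq_wl) !(negPf (nw1 _)).
  - move=> /or3P[/eqP ex|/(dside _ _ _ h)//|/(dside _ _ _ h)//].
    by move: h; rewrite ex (negPf (nwl _)).
  - move=> /or3P[/eqP ex|/(dside _ _ _ h)//|/(dside _ _ _ h)//].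
    by move: h; rewrite ex (negPf (nwl _)).
have sE0 : {in E0, forall p, (p.1 \in P) && (p.2 \in Q)}.
  move=> p; rewrite !(in_setU1, in_setU) => /or3P[/eqP->|/hE1[-> -> _ _]|/hJ'[-> -> _ _]];
  by rewrite /= ?eqxx ?orbT.
have mE0 : matching E0.
  move=> p q; rewrite !(in_setU1, in_setU) => /or3P[/eqP->|pE|pE] /or3P[/eqP->|qE|qE] //=.
  - by have [q1 q2 _ _] := hE1 q qE => /orP[]/eqP h; move: q1 q2; rewrite -h ?(negPf (nw1 _)) ?(negPf (nwl _)).
  - by have [q1 q2 _ _] := hJ' q qE => /orP[]/eqP h; move: q1 q2; rewrite -h ?(negPf (nw1 _)) ?(negPf (nwl _)).
  - by have [q1 q2 _ _] := hE1 p pE => /orP[]/eqP h; move: q1 q2; rewrite h ?(negPf (nw1 _)) ?(negPf (nwl _)).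
  - exact: mE1.
  - have [p1 p2 _ _] := hE1 p pE; have [q1 q2 _ _] := hJ' q qE => /orP[]/eqP h.
      by rewrite h in p1; have := dside _ _ _ p1 q1.
    by rewrite h in p2; have := dside _ _ _ p2 q2.
  - by have [q1 q2 _ _] := hJ' p pE => /orP[]/eqP h; move: q1 q2; rewrite h ?(negPf (nw1 _)) ?(negPf (nwl _)).
  - have [p1 p2 _ _] := hE1 q qE; have [q1 q2 _ _] := hJ' p pE => /orP[]/eqP h.
      by rewrite -h in p1; have := dside _ _ _ p1 q1.
    by rewrite -h in p2; have := dside _ _ _ p2 q2.
  - exact: mJ.
pose m := pairinv E0.
have mK : involutive m := pairinv_inv dPQ mE0 sE0.
have fanE : (w1, wl) \in E0 by rewrite in_setU1 eqxx.
have mw1 : m w1 = wl := pairinv1 mE0 fanE.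
have mwl : m wl = w1 by rewrite -mw1 mK.
have EW p : p \in E0 -> (p.1 \in W) && (p.2 \in W).
  rewrite !(in_setU1, in_setU) => /or3P[/eqP->|/hE1[p1 p2 _ _]|/hJ'[p1 p2 _ _]] /=.
  - by rewrite w1W wlW.
  - by rewrite (sideW p1) (sideW p2).
  - by rewrite (sideW p1) (sideW p2).
have termsP x : x \in terms m -> exists2 p, p \in E0 & (x == p.1) || (x == p.2).
  by rewrite inE => /pairinvP.
have termE p : p \in E0 -> (p.1 \in terms m) && (p.2 \in terms m).
  move=> pE; rewrite !inE /m (pairinv1 mE0 pE) (pairinv2 dPQ mE0 sE0 pE).
  by rewrite eq_sym (pair_neq dPQ sE0 pE) .
have tW : terms m \subset W.
  by apply/subsetP=> x /termsP[p /EW/andP[p1 p2] /orP[]/eqP->].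
(* Recolouring by rank turns the numerical order followed by [block_cycle] into the search order of
   [E1]. *)
pose cN x := rk (c x).
have t0 : 0 < t by apply: leq_ltn_trans (ltn_ord (c v)).
have E1J0 : (w1, wl) \notin E1 :|: J.
  rewrite in_setU negb_or; apply/andP; split; apply/negP.
    by move=> /hE1[] /=; rewrite (negPf (nw1 _)).
  by move=> /hJ'[] /=; rewrite (negPf (nw1 _)).
have dE1J : E1 :&: J = set0.
  apply/setP=> p; rewrite in_setI in_set0; apply/negP=> /andP[/hE1[p1 _ _ _] /hJ'[p2 _ _ _]].
  by have := dside _ _ _ p1 p2.
have cterms : #|terms m| <= 4 * a.
  rewrite -[terms m]setIT (card_terms_pairinv dPQ mE0 sE0).
  rewrite (eq_bigr (fun=> 2)); last by move=> p _; rewrite !inE.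
  rewrite sum_nat_const cardsU1 E1J0 cardsU dE1J cards0 subn0.
  by have := subset_leq_card JE; move: cE1 cE2 ta t0; lias.
have classE u : cls cN W (rk u) = [set x | c x == u] :\: inner.
  by apply/setP=> x; rewrite !in_set (inj_eq rinj) andbC.
have sub_terms u : #|terms m :&: cls cN W u| <= 4 * a.
  by apply: leq_trans cterms; apply: subset_leq_card; apply: subsetIl.
have goodW u : kgood e (k - (2 * a).+1) (cls cN W u).
  have [/existsP[u' /eqP <-]|hn] := boolP [exists u', rk u' == u].
    by rewrite classE -card_inner; apply: kgoodD.
  have -> : cls cN W u = set0.
    apply/setP=> x; rewrite !in_set; apply/negP=> /andP[_ h].
    by move/negP: hn; apply; apply/existsP; exists (c x).
  by split=> [x|Z _ x y]; rewrite !inE ?andbF.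
(* The cut around a single class is crossed by an edge of [E1]; if there is only one class, it
   contains the ends of the fan. *)
have tne : {in W, forall y, exists2 x, x \in terms m & cN x = cN y}.
  move=> y yW; have [t1|t1] := leqP t 1.
    exists w1; first by case/andP: (termE _ fanE).
    congr rk; apply: val_inj => /=; have := ltn_ord (c w1); have := ltn_ord (c y); move: t1.
    by move: (nat_of_ord (c y)) (nat_of_ord (c w1)) => i j; lias.
  have [||p pE hp] := cut1 [set c y].
  - by apply/set0Pn; exists (c y); rewrite inE.
  - by apply/eqP=> h; have := cards1 (c y); rewrite h cardsT card_ord; move: t1; lias.
  have /andP[p1 p2] := termE p (subsetP (subsetUr _ _) _ (subsetP (subsetUl _ _) _ pE)).
  move: hp; rewrite !inE; have [h _|_] := eqVneq (c p.1) (c y).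
    by exists p.1; rewrite // /cN h.
  by have [h _|//] := eqVneq (c p.2) (c y); exists p.2; rewrite // /cN h.
have gdegE u : #|terms m :&: cls cN W (rk u)| = 2 * (c v == u) + gdeg c E1 u + gdeg c J u.
  rewrite (card_terms_pairinv dPQ mE0 sE0) (eq_bigr (fun p => (c p.1 == u) + (c p.2 == u))); last first.
    by move=> p /EW/andP[p1 p2]; rewrite ![_ \in cls _ _ _]inE p1 p2 /= /cN !(inj_eq rinj).
  rewrite big_setU1 //= (big_setID E1) /= setUK setDUl setDv set0U.
  have -> : J :\: E1 = J by apply/setDidPl; rewrite -setI_eq0 setIC dE1J.
  by rewrite /gdeg !cw ?addnA ?mul2n ?addnn // inE ?wl_in ?eqxx ?orbT.
have [||||||s0 [vs0 s0W s0t]] := @block_cycle T e cN W a (k - (2 * a).+1) esym eirr ha goodW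
    #|terms m| m set0 mK.
- by [].
- by apply/set0Pn; exists w1; case/andP: (termE _ fanE).
- by rewrite setD0.
- move=> u; have [/existsP[u' /eqP <-]|hn] := boolP [exists u', rk u' == u].
    by rewrite gdegE -addnA oddD mul2n odd_double /= oddD hJ addbb.
  rewrite (_ : _ :&: _ = set0) ?cards0 //; apply/setP=> x; rewrite !in_set.
  apply/negP=> /andP[_ /andP[_ h]].
  by move/negP: hn; apply; apply/existsP; exists (c x).
- move=> u u0 /set0Pn[x]; rewrite in_setI => /andP[xt].
  rewrite inE => /andP[xW /eqP cx]; have [|p [v' [pE jp rv]]] := hrk (c x).
    by rewrite -/(cN x) cx.
  have pE0 : p \in E0 by rewrite !(in_setU1, in_setU) pE orbT.
  have /andP[t1 t2] := termE p pE0; have /andP[W1 W2] := EW p pE0.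
  case/orP: jp => /andP[/eqP h1 /eqP h2].
    exists p.1; first by rewrite in_setI t1 inE W1 /cN h1 -/(cN x) cx /=.
    by rewrite /m (pairinv1 mE0 pE0) /cN h2 -cx.
  exists p.2; first by rewrite in_setI t2 inE W2 /cN h1 -/(cN x) cx /=.
  by rewrite /m (pairinv2 dPQ mE0 sE0 pE0) /cN h2 -cx.
- move=> u; rewrite set0U.
  have h1 := sub_terms u.
  have : link_cost a (#|terms m :&: cls cN W u|)./2 <= link_cost a (2 * a).
    by apply: leq_link_cost; move: h1; lias.
  by move: hk h1; lias.
rewrite setD0 in s0W.
have [||s1 [vs1 s1W s1t] s1cov] := @covering_cycle T e cN W a (k - (2 * a).+1) esym eirr ha goodW
  m mK tW tne _ s0.
- have : 2 * (2 * a) <= link_cost a (2 * a).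
    rewrite /link_cost mulnC -[X in X * _](card_ord (2 * a)) -sum_nat_const.
    by apply: leq_sum => i _; apply: leq_addl.
  by move: hk cterms; lias.
- by split.
(* After a reversal if necessary, the fan block is entered at [w1] and left at [wl], the direction
   of the path [w]. *)
have [s2 [vs2 s2W s2cov w1s2]] : exists s2, [/\ valid e cN m s2, {subset s2 <= W},
    {in W, forall x, (x \in s2) || (m x \in s2)} & w1 \in s2].
  have /orP[h|h] := s1cov w1 w1W; first by exists s1.
  have memf x : (x \in rev (map m s1)) = (m x \in s1).
    by rewrite mem_rev -{1}[x]mK mem_map //; apply: inv_inj.
  have mW x : m x \in W -> x \in W.
    have [->//|nx _] := eqVneq (m x) x.
    by apply: (subsetP tW); rewrite inE.
  exists (rev (map m s1)); split.
  - exact: valid_flip.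
  - by move=> x; rewrite memf => /s1W/mW.
  - by move=> x xW; rewrite !memf mK orbC; apply: s1cov.
  - by rewrite memf.
have [i s3 eqs] := rot_to w1s2.
have mem3 x : (x \in s2) = (x \in w1 :: s3) by rewrite -eqs mem_rot.
have [c3 u3 m3] : valid e cN m (w1 :: s3) by rewrite -eqs; apply: valid_rot.
have ns3 x : x \in s3 -> [/\ x \in W, x != w1 & x != wl].
  move=> xs; split; first by apply: s2W; rewrite mem3 inE xs orbT.
    by apply: contraTneq xs => ->; move: u3 => /= /andP[].
  apply/eqP=> xl; have := m3 w1; rewrite mw1 !inE eqxx -xl xs orbT => /(_ isT isT) h.
  by have := w1_neq_wl; rewrite -xl h eqxx.
have hH : {in s3, forall y, m y != y -> H y (m y)}.
  move=> y /ns3[_ y1 yl] my; have : y \in terms m by rewrite inE.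
  move=> /termsP[p pE hp].
  have rp : rr p.1 p.2.
    move: pE; rewrite !(in_setU1, in_setU) => /or3P[/eqP ep|/hE1[]//|/hJ'[]//].
    by move: hp; rewrite ep /= (negPf y1) (negPf yl).
  case/orP: hp => /eqP->; first by rewrite /m (pairinv1 mE0 pE); apply: rrH.
  by rewrite /m (pairinv2 dPQ mE0 sE0 pE) Hsym; apply: rrH.
(* The part of the cycle after the fan block: it continues from [wl = m w1], and its last vertex is
   adjacent to [w1]. *)
pose Bq := unfold_blocks m s3.
have u3' : uniq s3 by move: u3 => /= /andP[].
have m3' : {in s3, forall x, m x \in s3 -> m x = x}.
  by move=> x xs ms; apply: m3; rewrite inE ?xs ?ms orbT.
have uB : uniq Bq by apply: uniq_unfold_blocks.
have memB x : (x \in Bq) = (x \in s3) || (m x \in s3) by apply: mem_unfold_blocks.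
have p3 : path (brel e cN m) w1 s3 by move: c3; rewrite /= rcons_path => /andP[].
have l3 : brel e cN m (last w1 s3) w1 by move: c3; rewrite /= rcons_path => /andP[].
have [pB lB] := unfold_blocks_path eH hH p3.
have BW x : x \in Bq -> x \notin v :: w1 :: w.
  move=> xB; have [xW x1 xl] : [/\ x \in W, x != w1 & x != wl].
    move: xB; rewrite memB => /orP[/ns3//|/ns3[mW m1 ml]]; split.
    - by have [<-//|nx] := eqVneq (m x) x; apply: (subsetP tW); rewrite inE.
    - by apply: contraNneq ml => ->; rewrite mw1.
    - by apply: contraNneq m1 => ->; rewrite mwl.
  move: xW; rewrite in_setC in_setD1 xl /= !inE !negb_or => /andP[-> ->].
  by rewrite x1.
have uall : uniq (v :: w1 :: w ++ Bq).
  move: uw; rewrite -!cat_cons cat_uniq => ->; rewrite uB andbT /=.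
  apply/hasPn=> x xB; have := BW x xB; exact.
have size_all : (size w + size Bq).+2 = #|T|.
  have -> : (size w + size Bq).+2 = size (v :: w1 :: w ++ Bq) by rewrite /= size_cat.
  rewrite -(card_uniqP uall); apply: eq_card => x; rewrite [RHS]inE.
  have [xW|/notW] := boolP (x \in W); last first.
    by rewrite !inE mem_cat => /orP[->|->]; rewrite ?orbT.
  rewrite !inE mem_cat memB; have := s2cov x xW; rewrite !mem3 !inE.
  move=> /orP[/orP[->|->]|/orP[/eqP h|->]]; rewrite ?orbT //.
  by rewrite -[x]mK h mw1 wl_in !orbT.
rewrite -size_all => hl.
apply: (@fan_pancyclic T H a Hsym Hirr _ v w1 w Bq l) => //.
- move=> S iS; apply: ha; apply/indepP=> x y xS yS; apply: contra (_ : ~~ H x y) => //; first exact: eH.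
  by move/indepP: iS; apply.
- by rewrite sw.
- by move=> x xw; apply: eH; apply: ev.
- by rewrite cat_path (sub_path eH pw) -/wl -mw1.
- rewrite last_cat -/wl -mw1 lB; move: l3 => /andP[l3 _]; exact: eH.
Qed.
End Deterministic.

(** * Disjoint cliques *)

Lemma cycle_closed (T : eqType) (r : rel T) (B : pred T) (s : seq T) :
  cycle r s -> (forall x y, r x y -> B x = B y) -> {in s &, forall x y, B x = B y}.
Proof.
move=> cs hr x y xs ys; have [i s' es] := rot_to xs.
have : y \in x :: s' by rewrite -es mem_rot.
have : path r x s' by move: cs; rewrite -(rot_cycle i) es /= rcons_path => /andP[].
elim: s' x {xs es} => [|z s' IH] x /=; first by rewrite inE => _ /eqP->.
move=> /andP[rxz ps]; rewrite inE => /orP[/eqP->//|ys'].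
by rewrite (hr x z rxz); apply: IH.
Qed.

Lemma deltaE n (e : rel 'I_n) : 0 < n -> delta e = \big[minn/n]_(v : 'I_n) deg e v.
Proof. by case: n e. Qed.

Section Cliques.
Variables (n d k : nat).
Hypotheses (k2 : 1 < k) (d1 : 0 < d) (kdn : k * (d + 1) <= n).

(** Consecutive intervals of length [d + 1]; the minimum sends all remaining vertices to the last
    clique, which [kdn] makes large enough. *)
Definition blk (v : nat) := minn (v %/ d.+1) k.-1.
Definition cliques : rel 'I_n := fun x y => (x != y) && (blk x == blk y).

Lemma cliques_graph : is_graph cliques.
Proof.
split=> [x y|x]; rewrite /cliques ?eqxx //.
by rewrite eq_sym [blk x == _]eq_sym.
Qed.

Lemma blk_lt v : blk v < k.
Proof. by rewrite /blk; have := geq_minr (v %/ d.+1) k.-1; move: k2; lias. Qed.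

Lemma ord_of_blk i j : i < k -> j < d.+1 -> i * d.+1 + j < n.
Proof.
move=> ik jd; apply: leq_trans kdn; rewrite addn1.
apply: leq_trans (_ : i.+1 * d.+1 <= _); first by rewrite mulSn addnC ltn_add2r.
by rewrite leq_mul2r ik orbT.
Qed.

Lemma blk_ord i j : i < k -> j < d.+1 -> blk (i * d.+1 + j) = i.
Proof. by move=> ik jd; rewrite /blk divnMDl // divn_small // addn0; apply/minn_idPl; move: ik; lias. Qed.

Lemma alpha_cliques : alpha cliques = k.
Proof.
apply/eqP; rewrite eqn_leq; apply/andP; split.
  apply/bigmax_leqP=> S iS.
  have inj : {in S &, injective (fun x : 'I_n => Ordinal (blk_lt x))}.
    move=> x y xS yS /(congr1 val) /= exy; apply/eqP/negPn/negP=> nxy.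
    have := forall_inP (forall_inP iS x xS) y yS.
    by rewrite /cliques nxy exy eqxx.
  by rewrite -(card_in_imset inj) -[X in _ <= X]card_ord max_card.
have lt (i : 'I_k) : i * d.+1 + 0 < n by apply: ord_of_blk.
pose f (i : 'I_k) : 'I_n := Ordinal (lt i).
have bf i : blk (f i) = i by rewrite /= blk_ord.
have finj : injective f by move=> i j /(congr1 (fun x : 'I_n => blk x)); rewrite !bf => /val_inj.
rewrite -[X in X <= _]card_ord -cardsT -(card_imset setT finj).
apply: (@leq_bigmax_cond _ _ (fun S : {set 'I_n} => #|S|)).
apply/forall_inP=> _ /imsetP[i _ ->]; apply/forall_inP=> _ /imsetP[j _ ->].
rewrite /cliques !bf; apply/negP=> /andP[nf /eqP/val_inj eij].
by move: nf; rewrite eij eqxx.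
Qed.

Lemma bigmin_leq (I : eqType) (r : seq I) (F : I -> nat) m i :
  i \in r -> \big[minn/m]_(j <- r) F j <= F i.
Proof.
elim: r => // j r IH; rewrite inE big_cons => /orP[/eqP->|/IH h]; first exact: geq_minl.
by apply: leq_trans h; apply: geq_minr.
Qed.

Lemma delta_cliques : delta cliques = d.
Proof.
have n0 : 0 < n by apply: leq_trans kdn; rewrite muln_gt0 addn1 (ltnW k2).
rewrite deltaE //.
apply/eqP; rewrite eqn_leq; apply/andP; split.
  apply: leq_trans (bigmin_leq _ _ (mem_index_enum (Ordinal n0))) _.
  have lt (i : 'I_d) : 0 * d.+1 + i.+1 < n by apply: ord_of_blk; rewrite ?ltnS // ltnW.
  pose f (i : 'I_d) : 'I_n := Ordinal (lt i).
  apply: leq_trans (_ : #|f @: setT| <= d); last first.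
    by apply: leq_trans (leq_imset_card _ _) _; rewrite cardsT card_ord.
  apply: subset_leq_card; apply/subsetP=> u; rewrite inE /cliques /= => /andP[nu].
  rewrite /blk div0n min0n => /eqP bu.
  have ud : u < d.+1.
    move: bu => /esym/eqP; rewrite /minn; case: ltnP => _; last by move: k2; lias.
    by rewrite -leqn0 leqNgt divn_gt0 // -leqNgt.
  have u0 : 0 < u by rewrite lt0n; apply: contraNneq nu => u0; apply/eqP/val_inj.
  have lu : u.-1 < d by move: ud u0; lias.
  by apply/imsetP; exists (Ordinal lu) => //; apply: val_inj => /=; rewrite mul0n prednK.
apply: (big_ind (fun m => d <= m)).
- by apply: leq_trans kdn; move: k2 d1; nias.
- by move=> x y h1 h2; rewrite leq_min h1.
move=> v _; rewrite /deg.
have bl := blk_lt v.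
have lt (j : 'I_d.+1) : blk v * d.+1 + j < n by apply: ord_of_blk.
pose f (j : 'I_d.+1) : 'I_n := Ordinal (lt j).
have finj : injective f by move=> i j /(congr1 val) /= /addnI /val_inj.
have : (f @: setT) :\ v \subset [set u | cliques v u].
  apply/subsetP=> u; rewrite in_setD1 inE /cliques => /andP[uv /imsetP[j _ ej]].
  by rewrite eq_sym uv ej /= blk_ord.
move=> /subset_leq_card; apply: leq_trans.
have := cardsD1 v (f @: setT); rewrite (card_imset _ finj) cardsT card_ord.
by case: (v \in _); lias.
Qed.

Definition block (i : 'I_k.-1) : {set 'I_n} := [set v : 'I_n | v %/ d.+1 == i].

Definition exits (B : {set 'I_n}) := [set ij in upper_pairs n | (ij.1 \in B) != (ij.2 \in B)].

Lemma card_block i : #|block i| <= d.+1.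
Proof.
have lt (j : 'I_d.+1) : i * d.+1 + j < n.
  by apply: ord_of_blk => //; apply: leq_trans (ltn_ord i) (leq_pred _).
apply: leq_trans (_ : #|[set Ordinal (lt j) | j in setT]| <= _); last first.
  by apply: leq_trans (leq_imset_card _ _) _; rewrite cardsT card_ord.
apply: subset_leq_card; apply/subsetP=> v; rewrite inE => /eqP vi.
apply/imsetP; exists (Ordinal (ltn_pmod v (ltn0Sn d))) => //.
by apply: val_inj; rewrite /= -vi -divn_eq.
Qed.

Lemma card_exits i : #|exits (block i)| <= 2 * d.+1 * n.
Proof.
have sub : exits (block i) \subset setX (block i) setT :|: setX setT (block i).
  by apply/subsetP=> -[x y]; rewrite !inE /= => /andP[_]; case: (x %/ _ == i); case: (y %/ _ == i).
apply: leq_trans (subset_leq_card sub) _; apply: leq_trans (leq_card_setU _ _) _.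
rewrite !cardsX cardsT card_ord; have := card_block i; nias.
Qed.

(** A pair that leaves both blocks must join them. This bounds the dependence between the events
    that two blocks are isolated. *)
Lemma card_exitsI i j : i != j ->
  #|exits (block i) :&: exits (block j)| <= 2 * (d.+1 * d.+1).
Proof.
move=> nij.
have sub : exits (block i) :&: exits (block j) \subset
    setX (block i) (block j) :|: setX (block j) (block i).
  apply/subsetP=> -[x y]; rewrite !inE /= => /andP[/andP[_ h1] /andP[_ h2]].
  have dis (z : 'I_n) : z %/ d.+1 == i -> z %/ d.+1 == j -> False.
    by move=> /eqP-> /eqP/val_inj h; move: nij; rewrite h eqxx.
  move: h1 h2 (dis x) (dis y).
  case: (x %/ _ == i); case: (y %/ _ == i); case: (x %/ _ == j); case: (y %/ _ == j) => //=.
    by move=> _ _ /(_ isT isT).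
  by move=> _ _ _ /(_ isT isT).
apply: leq_trans (subset_leq_card sub) _; apply: leq_trans (leq_card_setU _ _) _.
rewrite !cardsX; have := card_block i; have := card_block j; nias.
Qed.

(** A Hamilton cycle visits both the block and the last clique, but no edge of the union leaves the
    block. *)
Lemma isolated_block (S : {set 'I_n * 'I_n}) i : S \subset upper_pairs n ->
  [disjoint S & exits (block i)] -> ~~ hamiltonian (graph_union cliques S).
Proof.
move=> sS dS; apply/negP=> /andP[_ /existsP[s /andP[us cs]]].
have all v : v \in s.
  have : #|s| = #|'I_n| by rewrite card_ord (card_uniqP us) size_tuple.
  by move=> h; have := subset_cardP h (subset_predT _) v => ->.
have ik : i < k.-1 := ltn_ord i.
have l1 : i * d.+1 + 0 < n by apply: ord_of_blk => //; move: ik; lias.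
have l2 : k.-1 * d.+1 + 0 < n by apply: ord_of_blk => //; move: k2; lias.
have := @cycle_closed _ (graph_union cliques S) (mem (block i)) s cs.
move=> /(_ _ (Ordinal l1) (Ordinal l2) (all _) (all _)); rewrite !inE /= !addn0 !mulnK //.
rewrite eqxx => h; have : k.-1 == i.
  apply: esym (h _) => x y.
  have hS u v : (u, v) \in S -> (u \in block i) = (v \in block i).
    move=> uvS; have := disjointFr dS uvS; rewrite inE (subsetP sS) //= => /negbT.
    by rewrite negbK => /eqP.
  rewrite /graph_union => /or3P[|/hS//|/hS//].
  rewrite /cliques /blk => /andP[_ /eqP exy]; rewrite /= !inE; move: exy ik.
  rewrite /minn; case: (ltnP (x %/ d.+1) k.-1) => h1; case: (ltnP (y %/ d.+1) k.-1) => h2 exy ik.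
  - by rewrite exy.
  - by move: h1; rewrite exy ltnn.
  - by move: h2; rewrite -exy ltnn.
  - by rewrite !gtn_eqF // ?(leq_trans ik).
by move: ik; lias.
Qed.
End Cliques.

(** * Rectangles without random edges *)

Lemma surjective_colouring (T : finType) (f : T -> nat) a : (forall x, f x < a) ->
  exists t (c : T -> 'I_t), [/\ t <= a, forall u, exists x, c x = u &
    forall x y, (c x == c y) = (f x == f y)].
Proof.
move=> fa; pose L := undup [seq f x | x <- enum T].
have fL x : f x \in L by rewrite mem_undup map_f // mem_enum.
have lt x : index (f x) L < size L by rewrite index_mem.
exists (size L), (fun x => Ordinal (lt x)); split.
- rewrite -(size_iota 0 a); apply: uniq_leq_size; first exact: undup_uniq.
  by move=> i; rewrite mem_undup mem_iota => /mapP[x _ ->]; rewrite /= add0n.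
- move=> u; have : nth 0 L u \in L by apply: mem_nth.
  rewrite mem_undup => /mapP[x _ ex]; exists x; apply: val_inj => /=.
  by rewrite -ex index_uniq ?undup_uniq.
- move=> x y; rewrite -val_eqE /=; apply/eqP/eqP => [h|->//].
  by rewrite -(nth_index 0 (fL x)) h nth_index.
Qed.

(** Each colour class is enumerated and positions are reduced modulo [Q], a deterministic
    replacement for a random split. *)
Lemma balanced_labelling (T : finType) (C : eqType) (c : T -> C) (A : {set T}) Q : 0 < Q ->
  exists lbl : T -> nat, forall u j, j < Q ->
    #|[set x in A | c x == u]| %/ Q <= #|[set x in A | (c x == u) && (lbl x == j)]|.
Proof.
move=> Q0; pose cl u := [set x in A | c x == u].
exists (fun x => index x (enum (cl (c x))) %% Q) => u j jQ.
set N := _ %/ Q.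
have lt (i : 'I_N) : i * Q + j < size (enum (cl u)).
  rewrite -cardE; apply: leq_trans (leq_trunc_div _ Q).
  apply: leq_trans (_ : i.+1 * Q <= _); first by rewrite mulSn addnC ltn_add2r.
  by rewrite leq_mul2r ltn_ord orbT.
have [N0|N0] := posnP N; first by rewrite N0.
have [x0 x0c] : exists x0, x0 \in cl u.
  apply/card_gt0P; move: N0; rewrite /N divn_gt0 //; exact: leq_trans.
pose g (i : 'I_N) := nth x0 (enum (cl u)) (i * Q + j).
have gc i : g i \in cl u by rewrite -mem_enum mem_nth.
have ginj : injective g.
  move=> i i' /eqP; rewrite nth_uniq ?enum_uniq // eqn_add2r eqn_mul2r => /orP[/eqP h|/eqP/val_inj//].
  by rewrite h in Q0.
have := card_imset setT ginj; rewrite cardsT card_ord => <-.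
apply: subset_leq_card; apply/subsetP=> _ /imsetP[i _ ->].
have := gc i; rewrite !inE => /andP[-> cu]; rewrite cu /= (eqP cu).
by rewrite index_uniq ?enum_uniq // modnMDl modn_small.
Qed.

Definition rect n (A B : {set 'I_n}) :=
  [set ij in upper_pairs n | ((ij.1 \in A) && (ij.2 \in B)) || ((ij.1 \in B) && (ij.2 \in A))].

Lemma card_rect n (A B : {set 'I_n}) : [disjoint A & B] -> #|A| * #|B| <= #|rect A B|.
Proof.
move=> dAB; rewrite -cardsX.
pose g (ij : 'I_n * 'I_n) := if ij.1 < ij.2 then ij else (ij.2, ij.1).
have ginj : {in setX A B &, injective g}.
  move=> [x y] [x' y']; rewrite !inE /= => /andP[xA yB] /andP[xA' yB']; rewrite /g /=.
  case: ifP => h; case: ifP => h' [] // e1 e2.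
  - by rewrite e1 e2.
  - by move: yB'; rewrite -e1 (disjointFr dAB xA).
  - by move: yB; rewrite e1 (disjointFr dAB xA').
  - by rewrite e1 e2.
rewrite -(card_in_imset ginj); apply: subset_leq_card; apply/subsetP=> _ /imsetP[[x y] xy ->].
move: xy; rewrite !inE /= => /andP[xA yB]; rewrite /g /=.
have nxy : x != y by apply: contraTneq xA => ->; rewrite (disjointFl dAB yB).
have /orP[h|h] : (x < y) || (y < x) by rewrite -neq_ltn.
  by rewrite h /= h xA yB.
have -> : (x < y) = false by apply/negbTE; rewrite -leqNgt ltnW.
by rewrite /= h xA yB orbT.
Qed.

Lemma rectP n (A B : {set 'I_n}) (S : {set 'I_n * 'I_n}) : ~~ [disjoint S & rect A B] ->
  exists x y, [/\ x \in A, y \in B & ((x, y) \in S) || ((y, x) \in S)].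
Proof.
rewrite -setI_eq0 => /set0Pn[[x y]]; rewrite !inE /= => /and3P[xyS _ /orP[]/andP[h1 h2]].
  by exists x, y; rewrite xyS.
by exists y, x; rewrite xyS orbT.
Qed.

Lemma leq_card_setD (T : finType) (X Z : {set T}) : #|X| <= #|X :\: Z| + #|Z|.
Proof. rewrite cardsD; have := subset_leq_card (subsetIr X Z); lias. Qed.

Lemma card_fibres (T : finType) t (c : T -> 'I_t) (M : {set T}) (I : {set 'I_t}) :
  #|[set x in M | c x \in I]| = \sum_(u in I) #|[set x in M | c x == u]|.
Proof.
rewrite -sum1_card (partition_big c (mem I)) /=; last by move=> x; rewrite inE => /andP[].
apply: eq_bigr => u uI; rewrite -sum1_card; apply: eq_bigl => x; rewrite !inE.
by have [->|] := eqVneq (c x) u; rewrite ?andbF // !andbT [u \in I]uI andbT.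
Qed.

Section Rectangles.
Variables (n : nat) (e : rel 'I_n) (rho : nat).
Hypothesis ge : is_graph e.
Let a := alpha e.
Let d := delta e.
Let k := d %/ (2 * a).
Hypotheses (a0 : 0 < a) (n0 : 0 < n).
Hypothesis hbudget : (2 * a).+1 + 4 * a + link_cost a (2 * a) <= k.
Hypothesis hfan : 2 * (a * (2 * a).+1) < d.
Hypotheses (arho : a <= 2 ^ rho) (rho0 : 0 < rho).
(** By [hd2], removing the fan and rounding in the split into four sides and [rho] labels still
    leave a fixed proportion of each class. By [hd1], the at most [5 * #|I|] excluded vertices cost
    at most half of the resulting bounds. *)
Hypotheses (hd1 : 640 * rho <= d) (hd2 : 16 * a + 48 + 32 * rho <= 3 * d).

Lemma alpha_indep (S : {set 'I_n}) : indep e S -> #|S| <= a.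
Proof. by move=> iS; apply: (@leq_bigmax_cond _ _ (fun S : {set 'I_n} => #|S|)). Qed.

Lemma delta_nbrs x : d <= #|nbrs e x|.
Proof. by rewrite /d deltaE //; apply: bigmin_leq; apply: mem_index_enum. Qed.

Lemma classes : exists t (c : 'I_n -> 'I_t), [/\ t <= a, forall u, exists x, c x = u,
  forall u, kgood e k [set x | c x == u] &
  forall u, exists2 y, c y = u & d - a * k <= #|nbrs e y :&: [set z | c z == u]|].
Proof.
have [esym eirr] := ge.
have [||||f [fa fgood fbig]] := @kgood_colouring _ e esym eirr a d k.
- by apply/bigmax_leqP=> S /andP[_ /alpha_indep].
- exact: delta_nbrs.
- by move: hbudget; lias.
- by rewrite mulnC leq_trunc_div.
have [t [c [ta csurj cE]]] := surjective_colouring fa.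
exists t, c; split=> // u; have [x <-] := csurj u.
  have -> : [set y | c y == c x] = [set y | f y == f x] by apply/setP=> y; rewrite !inE cE.
  exact: fgood.
have [y fy hy] := fbig x; have cyx : c y = c x by apply/eqP; rewrite cE fy.
exists y => //; rewrite -cyx; have -> // : [set z | c z == c y] = [set z | f z == f y].
by apply/setP=> z; rewrite !inE cE.
Qed.

Lemma half_d : d <= 2 * (d - a * k).
Proof. by have : 2 * a * k <= d; [rewrite mulnC leq_trunc_div|lias]. Qed.

Lemma fan_exists t (c : 'I_n -> 'I_t) (u : 'I_t) :
  (exists2 y, c y = u & d - a * k <= #|nbrs e y :&: [set z | c z == u]|) ->
  exists v w1 w, [/\ size w = (2 * a).+1, uniq (v :: w1 :: w), path e w1 w,
    {in w1 :: w, forall x, e v x} & {in w1 :: w, forall x, c x = c v}].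
Proof.
have [esym eirr] := ge; move=> [v cv hv].
have [|s [us sW ss se]] := @long_path _ e esym eirr (2 * a).+1 a _ (fun S _ => @alpha_indep S) (_ : _ < #|nbrs e v :&: [set z | c z == u]|).
  by apply: leq_trans hv; have := half_d; move: hfan; lias.
case: s us sW ss se => // w1 w us sW [ss] se.
have sW' x : x \in w1 :: w -> e v x /\ c x = c v.
  by move=> /sW; rewrite !inE cv => /andP[-> /eqP].
exists v, w1, w; split=> //.
- rewrite cons_uniq us andbT; apply/negP=> /sW'[]; by rewrite eirr.
- by move=> x /sW'[].
- by move=> x /sW'[].
Qed.

Lemma pancyclicP (H : rel 'I_n) :
  (forall l, 2 < l <= n -> exists s : seq 'I_n, [/\ size s = l, uniq s & cycle H s]) -> pancyclic H.
Proof.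
move=> h; apply/forallP=> l; apply/implyP=> l3.
have [|s [ss us cs]] := h l; first by rewrite l3 -ltnS ltn_ord.
by apply/existsP; move: (ltn_ord l) l3; rewrite -ss => _ _; exists (in_tuple s); rewrite us.
Qed.

(* A rectangle is given by one of the two matchings, a round, a set of classes,
   and a set of vertices excluded as already used. *)
Definition rect_index t := (bool * 'I_rho * {set 'I_t} * {set 'I_n})%type.

(** A random set that meets every rectangle satisfies [expands] for both matchings, so
    [pancyclic_of_expansion] applies. The last bound multiplies [#|I| * d <= 64 * #|A i|] and
    [n <= 64 * rho * #|B i|]. *)
Lemma bad_rectangles : exists t (A B : rect_index t -> {set 'I_n}) (K : pred (rect_index t)),
  [/\ t <= a,
   forall S : {set 'I_n * 'I_n}, S \subset upper_pairs n -> ~~ pancyclic (graph_union e S) ->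
     exists2 i, K i & [disjoint S & rect (A i) (B i)]
   & forall i, K i -> [/\ 0 < #|i.1.2|, #|i.2| <= 5 * #|i.1.2| &
     #|i.1.2| * d * n <= 4096 * rho * #|rect (A i) (B i)|]].
Proof.
have [esym eirr] := ge.
have [t [c [ta csurj cgood cbig]]] := classes.
have [v [w1 [w [sw uw pw ev cw]]]] := fan_exists (cbig (c (Ordinal n0))).
pose A0 := ~: [set x in v :: w1 :: w].
have [kind hkind] := balanced_labelling c A0 (isT : 0 < 4).
have [lab hlab] := balanced_labelling (fun x => (c x, kind x)) A0 rho0.
pose V u := [set x | c x == u].
have cV u : d <= 2 * #|V u|.
  have [y _ hy] := cbig u; have := half_d; have := subset_leq_card (subsetIr (nbrs e y) (V u)).
  by move: hy; rewrite -/(V u); lias.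
pose sd := side v w1 w kind.
have cF u : #|V u| <= #|[set x in A0 | c x == u]| + (2 * a + 3).
  have -> : [set x in A0 | c x == u] = V u :\: [set x in v :: w1 :: w].
    by apply/setP=> x; rewrite in_set in_setC in_setD [x \in V u]in_set andbC.
  rewrite cardsD; have : #|[set x in v :: w1 :: w]| <= 2 * a + 3.
    by rewrite cardsE; apply: leq_trans (card_size _) _; rewrite /= sw; lias.
  have := subset_leq_card (subsetIr (V u) [set x in v :: w1 :: w]); lias.
have csd i u : i < 4 -> #|V u| + 16 * rho <= 16 * #|[set x in sd i | c x == u]|.
  move=> i4; have := hkind u i i4; have := cF u.
  have -> : [set x in A0 | (c x == u) && (kind x == i)] = [set x in sd i | c x == u].
    by apply/setP=> x; rewrite !in_set andbCA andbC -!andbA.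
  by have := cV u; move: hd2; lias.
have ctg i r u : i < 4 -> r < rho ->
    #|V u| <= 16 * rho * #|[set x in [set x in sd i | lab x == r] | c x == u]|.
  move=> i4 rrho; have h1 := csd i u i4; have := hlab (u, i) r rrho.
  have -> : [set x in A0 | (c x, kind x) == (u, i)] = [set x in sd i | c x == u].
    by apply/setP=> x; rewrite !in_set xpair_eqE andbCA andbC -!andbA.
  have -> : [set x in A0 | ((c x, kind x) == (u, i)) && (lab x == r)] =
       [set x in [set x in sd i | lab x == r] | c x == u].
    by apply/setP=> x; rewrite !in_set xpair_eqE; do !case: (_ == _); rewrite ?andbF ?andbT.
  move: h1; set X := #|[set x in sd i | _]|; set Y := #|[set x in [set _ in _ | _] | _]| => h1 h2.
  have : X < (X %/ rho).+1 * rho by apply: ltn_ceil.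
  have : (X %/ rho).+1 * rho <= Y.+1 * rho by rewrite leq_mul2r ltnS h2 orbT.
  move: h1; rewrite mulSn; nias.
(* The boolean selects sides 0 and 1 or sides 2 and 3: sources lie over [I], targets of the given
   round over its complement. *)
pose A (i : rect_index t) := [set x in sd (2 * i.1.1.1) | c x \in i.1.2] :\: i.2.
pose B (i : rect_index t) :=
  [set x in [set x in sd (2 * i.1.1.1).+1 | lab x == i.1.1.2] | c x \in ~: i.1.2] :\: i.2.
pose K (i : rect_index t) :=
  [&& i.1.2 != set0, 2 * #|[set x | c x \in i.1.2]| <= n & #|i.2| <= 5 * #|i.1.2|].
exists t, A, B, K; split=> //.
- move=> S sS hp.
  have [/existsP[i /andP[Ki dis]]|/existsPn hno] :=
    boolP [exists i : rect_index t, K i && [disjoint S & rect (A i) (B i)]]; first by exists i.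
  pose rr x y := ((x, y) \in S) || ((y, x) \in S).
  have exps (b : bool) : expands c rr (sd (2 * b)) (sd (2 * b).+1) lab rho.
    move=> r I Z rlt I0 mI cZ; have := hno (b, Ordinal rlt, I, Z).
    rewrite /K /= I0 cZ; move: mI; rewrite card_ord => -> /= /rectP[x [y [xA yB rxy]]].
    move: xA yB; rewrite !in_setD => /andP[xZ]; rewrite in_set => /andP[xs xI].
    move=> /andP[yZ]; rewrite in_set in_setC => /andP[]; rewrite in_set => /andP[ys /eqP yr] yI.
    by exists x, y; rewrite /rr !in_setD xZ yZ xs ys xI yI rxy yr.
  move/negP: hp; case; apply: pancyclicP => l hl.
  have Hs : symmetric (graph_union e S).
    by move=> x y; rewrite /graph_union esym [X in _ || X]orbC.
  have Hi : irreflexive (graph_union e S).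
    move=> x; rewrite /graph_union eirr orbb; apply/negP=> /(subsetP sS).
    by rewrite inE ltnn.
  have eH : subrel e (graph_union e S) by move=> x y exy; rewrite /graph_union exy.
  have rrH : subrel rr (graph_union e S).
    by move=> x y rxy; rewrite /graph_union -/(rr x y) rxy orbT.
  have trho : t <= 2 ^ rho by apply: leq_trans arho.
  apply: (pancyclic_of_expansion esym eirr Hs Hi eH rrH alpha_indep cgood ta trho hbudget
    sw uw pw ev cw (exps false) (exps true)).
  by rewrite card_ord.
- move=> [[[b r] I] Z]; rewrite /K /= => /and3P[I0 mI cZ].
  have I0' : 0 < #|I| by rewrite card_gt0.
  split=> //.
  have b4 : 2 * b < 4 by case: (b).
  have b4' : (2 * b).+1 < 4 by case: (b).
  set Ai := A _; set Bi := B _.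
  have dAB : [disjoint Ai & Bi].
    rewrite disjoints_subset; apply/subsetP=> x; rewrite in_setC !in_setD in_set /= => /andP[_ /andP[_ xI]].
    by rewrite in_set in_setC xI !andbF.
  have sumI : #|I| * d <= 2 * \sum_(u in I) #|V u|.
    by rewrite big_distrr -sum_nat_const /=; apply: leq_sum => u _; apply: cV.
  have hA : #|I| * d <= 64 * #|Ai|.
    have h1 : \sum_(u in I) #|V u| <= 16 * #|[set x in sd (2 * b) | c x \in I]|.
      rewrite card_fibres big_distrr; apply: leq_sum => u _.
      by apply: leq_trans (csd _ u b4); apply: leq_addr.
    have h2 : #|[set x in sd (2 * b) | c x \in I]| <= #|Ai| + #|Z|.
      exact: leq_card_setD.
    have h3 : #|I| * 640 <= #|I| * d.
      by rewrite leq_mul2l; apply/orP; right; move: hd1 rho0; lias.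
    have aux jd s X Y z j : s <= 16 * X -> X <= Y + z -> j * 640 <= jd -> jd <= 2 * s -> z <= 5 * j ->
      jd <= 64 * Y by lia.
    exact: aux h1 h2 h3 sumI cZ.
  have sumT : \sum_u #|V u| = n.
    rewrite -[RHS]card_ord -cardsT; have := card_fibres c setT setT.
    have -> : [set x in [set: 'I_n] | c x \in [set: 'I_t]] = setT by apply/setP=> x; rewrite !inE.
    move=> ->; apply: eq_big => [u|u _]; first by rewrite inE.
    by apply: eq_card => x; rewrite !inE.
  have sumIC : n <= 2 * \sum_(u in ~: I) #|V u|.
    move: mI; have -> : #|[set x | c x \in I]| = \sum_(u in I) #|V u|.
      have := card_fibres c setT I.
      have -> : [set x in [set: 'I_n] | c x \in I] = [set x | c x \in I] by apply/setP=> x; rewrite !inE.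
      move=> ->; apply: eq_bigr => u _; by apply: eq_card => x; rewrite !inE.
    have e2 : \sum_(u in I) #|V u| + \sum_(u in ~: I) #|V u| = n.
      rewrite -[RHS]sumT [RHS](bigID (mem I)) /=; congr (_ + _).
      by apply: eq_bigl => u; rewrite in_setC.
    have aux s s' : s + s' = n -> 2 * s <= n -> n <= 2 * s' by lia.
    exact: aux e2.
  have tn : #|I| * (640 * rho) <= 2 * n.
    apply: leq_trans (_ : #|I| * d <= _); first by rewrite leq_mul2l hd1 orbT.
    have le : \sum_(u in I) #|V u| <= n.
      by apply: leq_trans (eq_leq sumT); rewrite [X in _ <= X](bigID (mem I)) /=; apply: leq_addr.
    by apply: leq_trans sumI _; rewrite leq_mul2l le orbT.
  have hB : n <= 64 * rho * #|Bi|.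
    set M := [set x in [set x in sd (2 * b).+1 | lab x == r] | c x \in ~: I].
    have h1 : \sum_(u in ~: I) #|V u| <= 16 * rho * #|M|.
      by rewrite card_fibres big_distrr; apply: leq_sum => u _; apply: ctg.
    have h2 : #|M| <= #|Bi| + #|Z|.
      exact: leq_card_setD.
    have aux s X Y z j : s <= 16 * rho * X -> X <= Y + z -> j * (640 * rho) <= 2 * n ->
        n <= 2 * s -> z <= 5 * j -> n <= 64 * rho * Y.
      move=> k1 k2 k3 k4 k5.
      have k6 : rho * X <= rho * Y + rho * z by rewrite -mulnDr leq_mul2l k2 orbT.
      have k7 : rho * z <= rho * (5 * j) by rewrite leq_mul2l k5 orbT.
      by clear -k1 k3 k4 k6 k7; lia.
    exact: aux h1 h2 tn sumIC cZ.
  apply: leq_trans (_ : 64 * #|Ai| * (64 * rho * #|Bi|) <= _); first exact: leq_mul.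
  have := card_rect dAB; move: #|Ai| #|Bi| #|rect _ _| => x y z xyz.
  have -> : 64 * x * (64 * rho * y) = 4096 * rho * (x * y) by lia.
  by rewrite leq_mul2l xyz orbT.
Qed.
End Rectangles.

(** * Random subsets and real estimates *)

Import Order.TTheory GRing.Theory Num.Theory.

Local Open Scope R_scope.

Lemma pow_exp x n : pow (exp x) n = exp (INR n * x).
Proof.
elim: n => [|n IH]; first by rewrite Rmult_0_l exp_0.
by rewrite S_INR /= IH -exp_plus; congr exp; ring.
Qed.

Lemma one_minus_le_exp p : 1 - p <= exp (- p).
Proof. by have := exp_ineq1_le (- p); lra. Qed.

Lemma exp_le_one_minus p : 0 <= p <= 1 / 2 -> exp (- (2 * p)) <= 1 - p.
Proof.
move=> hp; rewrite exp_Ropp.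
have h1 : 1 + 2 * p <= exp (2 * p) by have := exp_ineq1_le (2 * p); lra.
apply: (Rle_trans _ (/ (1 + 2 * p))); first by apply: Rinv_le_contravar; lra.
apply: (Rmult_le_reg_r (1 + 2 * p)); first lra.
by rewrite Rinv_l; [nra|lra].
Qed.

Lemma pow_one_minus_le_exp p n : 0 <= p <= 1 -> pow (1 - p) n <= exp (- (INR n * p)).
Proof.
move=> hp; rewrite (_ : - (INR n * p) = INR n * - p); last by ring.
by rewrite -pow_exp; apply: pow_incr; have := one_minus_le_exp p; lra.
Qed.

Lemma exp_le_pow_one_minus p n : 0 <= p <= 1 / 2 -> exp (- (INR n * (2 * p))) <= pow (1 - p) n.
Proof.
move=> hp; rewrite (_ : - (INR n * (2 * p)) = INR n * - (2 * p)); last by ring.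
rewrite -pow_exp; apply: pow_incr; have := exp_le_one_minus hp.
by have := exp_pos (- (2 * p)); lra.
Qed.

Lemma ln_le x : 0 < x -> ln x <= x - 1.
Proof. by move=> x0; have := exp_ineq1_le (ln x); rewrite exp_ln //; lra. Qed.

Lemma exp_sub1_le y : 0 <= y <= 1 / 2 -> exp y - 1 <= 2 * y.
Proof.
move=> hy; have h := one_minus_le_exp y; rewrite exp_Ropp in h.
have e0 := exp_pos y.
have : (1 - y) * exp y <= 1.
  by apply: (Rle_trans _ (/ exp y * exp y)); [apply: Rmult_le_compat_r; lra|rewrite Rinv_l; lra].
nra.
Qed.

Lemma INR_nat_le m n : (m <= n)%N -> INR m <= INR n.
Proof. by move=> /ssrnat.leP; apply: le_INR. Qed.

Lemma INR_natM m n : INR (m * n)%N = INR m * INR n.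
Proof. exact: mult_INR. Qed.

Lemma INR_natD m n : INR (m + n)%N = INR m + INR n.
Proof. exact: plus_INR. Qed.

Lemma exp_homo x y : x <= y -> exp x <= exp y.
Proof. by case=> [h|->]; [left; apply: exp_increasing|right]. Qed.

Local Close Scope R_scope.
Local Open Scope ring_scope.

Section RandomSubset.
Variables (F : realFieldType) (X : finType) (U : {set X}) (p : F).
Hypotheses (p0 : 0 <= p) (p1 : p <= 1).
Implicit Types (S A : {set X}) (P Q : pred {set X}).

Definition bweight S : F := p ^+ #|S| * (1 - p) ^+ (#|U| - #|S|).

Definition bprob P : F := \sum_(S : {set X} | (S \subset U) && P S) bweight S.

Lemma bweight_ge0 S : 0 <= bweight S.
Proof. by rewrite mulr_ge0 // exprn_ge0 // subr_ge0. Qed.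

(** The binomial theorem, with the subsets grouped by size. *)
Lemma sum_subsets_expr (V : {set X}) (x y : F) :
  \sum_(S : {set X} | S \subset V) x ^+ #|S| * y ^+ (#|V| - #|S|) = (x + y) ^+ #|V|.
Proof.
rewrite addrC exprDn.
rewrite (partition_big (fun S : {set X} => inord #|S| : 'I_#|V|.+1) xpredT) //=.
apply: eq_bigr => i _.
rewrite (eq_bigl [pred S : {set X} | S \in [set B : {set X} | (B \subset V) && (#|B| == i)]]); last first.
  move=> S; rewrite !inE; case sSV : (S \subset V) => //=.
  by rewrite -val_eqE /= inordK // ltnS subset_leq_card.
rewrite (eq_bigr (fun=> y ^+ (#|V| - i) * x ^+ i)).
  by rewrite sumr_const cards_draws.
by move=> S; rewrite !inE => /andP[_ /eqP->]; rewrite mulrC.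
Qed.

Lemma bprobT : bprob xpredT = 1.
Proof.
rewrite /bprob (eq_bigl (fun S : {set X} => S \subset U)); last by move=> S; rewrite andbT.
by rewrite sum_subsets_expr addrC subrK expr1n.
Qed.

Lemma bprob_avoid A : A \subset U -> bprob (fun S => [disjoint S & A]) = (1 - p) ^+ #|A|.
Proof.
move=> sAU; rewrite /bprob (eq_bigl (fun S : {set X} => S \subset U :\: A)); last first.
  by move=> S; rewrite subsetD.
rewrite (eq_bigr (fun S => (1 - p) ^+ #|A| * (p ^+ #|S| * (1 - p) ^+ (#|U :\: A| - #|S|)))).
  by rewrite -big_distrr /= sum_subsets_expr [p + _]addrC subrK expr1n mulr1.
move=> S sS; rewrite mulrCA -exprD; congr (_ * _ ^+ _).
have := cardsD U A; rewrite (setIidPr sAU) => cD.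
have := subset_leq_card sAU; have := subset_leq_card sS; rewrite cD => h1 h2.
by rewrite addnBA // subnKC.
Qed.

Lemma bprob_ge0 P : 0 <= bprob P.
Proof. by apply: sumr_ge0 => S _; apply: bweight_ge0. Qed.

Lemma bprobC P : bprob (fun S => ~~ P S) = 1 - bprob P.
Proof.
apply/eqP; rewrite eq_sym subr_eq addrC -bprobT /bprob (bigID P) /=; apply/eqP.
by congr (_ + _); apply: eq_bigl => S; rewrite andbT.
Qed.

Lemma bprob_mono P Q : (forall S, S \subset U -> P S -> Q S) -> bprob P <= bprob Q.
Proof.
move=> PQ; rewrite /bprob big_mkcond [X in _ <= X]big_mkcond; apply: ler_sum => S _.
case: (boolP (S \subset U)) => //= sS; case: (boolP (P S)) => [/(PQ S sS) ->//|_].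
by case: (Q S); rewrite ?bweight_ge0.
Qed.

Lemma bprob_union (I : finType) (K : pred I) P (Q : I -> pred {set X}) :
  (forall S, S \subset U -> P S -> exists2 i, K i & Q i S) ->
  bprob P <= \sum_(i | K i) bprob (Q i).
Proof.
move=> PQ; rewrite /bprob.
under [X in _ <= X]eq_bigr => i _ do rewrite big_mkcond.
rewrite exchange_big big_mkcond /=; apply: ler_sum => S _.
case: (boolP (S \subset U)) => /= sS; last by rewrite big1.
case: (boolP (P S)) => [/(PQ S sS)[i Ki Qi]|_]; last first.
  by apply: sumr_ge0 => i _; case: ifP; rewrite ?bweight_ge0.
rewrite (bigD1 i) //= Qi lerDl; apply: sumr_ge0 => j _.
by case: ifP; rewrite ?bweight_ge0.
Qed.

Section SecondMoment.
Variables (I : finType) (A : I -> {set X}) (D : nat).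
Hypotheses (sA : forall i, A i \subset U) (p_lt1 : p < 1).
Hypothesis cA : forall i j, i != j -> (#|A i :&: A j| <= D)%N.

Definition mean_avoid : F := \sum_i (1 - p) ^+ #|A i|.

(* Chebyshev's inequality for the number of [A i] missed by the random set *)
Lemma second_moment : 0 < mean_avoid ->
  bprob (fun S => [forall i, ~~ [disjoint S & A i]]) <=
  mean_avoid^-1 + ((1 - p) ^- D - 1).
Proof.
set q := 1 - p; set mu := mean_avoid => mu0.
have q0 : 0 < q by rewrite subr_gt0.
have q1 : q <= 1 by rewrite lerBlDr lerDl.
pose N S : F := \sum_i [disjoint S & A i]%:R.
pose Ex (f : {set X} -> F) := \sum_(S : {set X} | S \subset U) bweight S * f S.
have Eind P : Ex (fun S => (P S)%:R) = bprob P.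
  rewrite /Ex /bprob big_mkcondr; apply: eq_bigr => S _.
  by case: (P S); rewrite ?mulr1 ?mulr0.
have EN : Ex N = mu.
  rewrite /Ex /N; under eq_bigr => S _ do rewrite big_distrr.
  by rewrite exchange_big /=; apply: eq_bigr => i _; rewrite -bprob_avoid // -Eind.
(* Avoiding [A i] and [A j] means avoiding their union, whose size is at least
   [#|A i| + #|A j| - D]; this costs the factor [q ^- D]. The diagonal contributes [mu]. *)
have EN2 : Ex (fun S => N S ^+ 2) <= mu + q ^- D * mu ^+ 2.
  have -> : Ex (fun S => N S ^+ 2) = \sum_i \sum_j q ^+ #|A i :|: A j|.
    rewrite /Ex; under eq_bigr => S _ do rewrite expr2 big_distrlr /= big_distrr /=.
    rewrite exchange_big /=; apply: eq_bigr => i _.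
    under eq_bigr => S _ do rewrite big_distrr.
    rewrite exchange_big /=; apply: eq_bigr => j _.
    rewrite -bprob_avoid; last by rewrite subUset !sA.
    rewrite -Eind; apply: eq_bigr => S _; congr (_ * _).
    by rewrite -natrM mulnb !disjoints_subset setCU subsetI.
  have -> : mu + q ^- D * mu ^+ 2 =
      \sum_i (q ^+ #|A i| + \sum_j q ^- D * (q ^+ #|A i| * q ^+ #|A j|)).
    rewrite big_split /=; congr (_ + _); rewrite expr2 big_distrlr /= big_distrr /=.
    by apply: eq_bigr => i _; rewrite big_distrr.
  apply: ler_sum => i _; rewrite (bigD1 i) //= setUid lerD2l.
  rewrite [X in _ <= X](bigD1 i) //=; apply: ler_wpDl.
    by rewrite !mulr_ge0 ?invr_ge0 ?exprn_ge0 // ltW.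
  apply: ler_sum => j nji; rewrite ler_pdivlMl ?exprn_gt0 // -!exprD.
  apply: ler_wiXn2l => //; first exact: ltW.
  have h : (#|A i :&: A j| <= D)%N by apply: cA; rewrite eq_sym.
  by rewrite -cardsUI addnC leq_add2r.
have key : bprob (fun S => [forall i, ~~ [disjoint S & A i]]) * mu ^+ 2 <=
    mu + (q ^- D - 1) * mu ^+ 2.
  have -> : mu + (q ^- D - 1) * mu ^+ 2 = (mu + q ^- D * mu ^+ 2) - mu ^+ 2.
    by rewrite mulrBl mul1r addrA.
  apply: le_trans (_ : Ex (fun S => N S ^+ 2) - mu ^+ 2 <= _); last by rewrite lerD2r.
  have -> : Ex (fun S => N S ^+ 2) - mu ^+ 2 = Ex (fun S => (N S - mu) ^+ 2).
    have -> : Ex (fun S => (N S - mu) ^+ 2) =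
        Ex (fun S => N S ^+ 2) - (mu * Ex N) *+ 2 + mu ^+ 2 * Ex (fun=> true%:R).
      rewrite /Ex !big_distrr -sumrMnl -sumrB -big_split /=; apply: eq_bigr => S _.
      rewrite sqrrB mulrDr mulrBr !mulrnAr mulr1 mulr1n (mulrC (N S) mu) [mu ^+ 2 * _]mulrC.
      by rewrite [bweight S * (mu * _)]mulrCA.
    by rewrite EN Eind bprobT mulr1 -expr2 mulr2n opprD addrA subrK.
  rewrite -Eind /Ex big_distrl /=; apply: ler_sum => S _; rewrite -mulrA.
  apply: ler_wpM2l; first exact: bweight_ge0.
  case: (boolP [forall i, _]) => [/forallP h|_]; last by rewrite mul0r sqr_ge0.
  rewrite mul1r /N big1 ?sub0r ?sqrrN // => i _.
  by rewrite (negPf (h i)).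
rewrite -(ler_pM2r (_ : 0 < mu ^+ 2)) ?exprn_gt0 //; apply: le_trans key _.
by rewrite [X in _ <= X]mulrDl [in X in _ <= X + _]expr2 mulKf ?gt_eqF.
Qed.
End SecondMoment.
End RandomSubset.

(** * Asymptotics *)

Local Close Scope ring_scope.
Local Open Scope R_scope.

Lemma prob_unionE n (e : rel 'I_n) (p : R) P :
  prob_union e p P = bprob (upper_pairs n) p (fun S => P (graph_union e S)).
Proof. by apply: eq_bigr => S _; rewrite /bweight !RpowE. Qed.

(** Here [y] is the inverse square root of [k]. A block has at most [4 * d * n] exits, so the factor
    [1 / 16] makes it isolated with probability at least [exp (- 8 * p * d * n) >= y]. The mean
    number of isolated blocks is thus at least [(k - 1) * y], with inverse at most [2 * y]. The
    correlation term is at most [exp y - 1 <= 2 * y]. *)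
Lemma cliques_hamiltonian_le n d k (p : R) : (4 <= k)%N -> (0 < d)%N -> (k * (d + 1) <= n)%N ->
  0 <= p -> p <= / 16 * ln (INR k) / (INR d * INR n) ->
  prob_union (@cliques n d k) p (@hamiltonian n) <= 4 * exp (- (ln (INR k) / 2)).
Proof.
move=> k4 d0 kdn p0 ple.
set L := ln (INR k) in ple *; set y := exp _.
have k2 : (1 < k)%N by apply: leq_trans k4.
have rk4 : 4 <= INR k by have := INR_nat_le k4; rewrite /=; lra.
have rd1 : 1 <= INR d by have := INR_nat_le d0; rewrite /=; lra.
have rn : INR k * (INR d + 1) <= INR n.
  by have := INR_nat_le kdn; rewrite INR_natM INR_natD /=.
have n0 : 0 < INR n by nra.
have L0 : 0 < L by rewrite /L -ln_1; apply: ln_increasing; lra.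
have y0 : 0 < y by apply: exp_pos.
have yy : y * y = / INR k.
  rewrite /y -exp_plus (_ : - (L / 2) + - (L / 2) = - L); last by field.
  by rewrite exp_Ropp exp_ln //; lra.
have y1 : y <= 1 / 2.
  have : y * y <= / 4 by rewrite yy; apply: Rinv_le_contravar; lra.
  nra.
have Ly : L <= 2 / y.
  have -> : L = 2 * ln (/ y) by rewrite ln_Rinv // /y ln_exp; field.
  have iy : 0 < / y by apply: Rinv_0_lt_compat.
  by have := ln_le iy; rewrite /Rdiv; lra.
have pdn : p * (INR d * INR n) <= / 16 * L.
  have dn0 : 0 < INR d * INR n by nra.
  apply: (Rle_trans _ (/ 16 * L / (INR d * INR n) * (INR d * INR n))).
    by apply: Rmult_le_compat_r => //; lra.
  by right; field; split; lra.
have LyI : L * (y * y) <= 2 * y.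
  apply: (Rle_trans _ (2 / y * (y * y))); first by apply: Rmult_le_compat_r => //; nra.
  by right; field; lra.
have kyy : INR k * (y * y) = 1 by rewrite yy Rinv_r //; lra.
have pdk : p * INR d * (INR k * (INR d + 1)) <= / 16 * L.
  apply: Rle_trans pdn; rewrite Rmult_assoc; apply: Rmult_le_compat_l => //.
  by apply: Rmult_le_compat_l => //; lra.
have p12 : p <= 1 / 2.
  have : p * INR d * (INR k * (INR d + 1)) * (y * y) <= / 16 * L * (y * y) by apply: Rmult_le_compat_r => //; nra.
  have -> : p * INR d * (INR k * (INR d + 1)) * (y * y) = p * (INR d * (INR d + 1)) * (INR k * (y * y)) by ring.
  rewrite kyy Rmult_1_r Rmult_assoc => h.
  have : p * 2 <= p * (INR d * (INR d + 1)) by apply: Rmult_le_compat_l => //; nra.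
  lra.
pose q := 1 - p.
have q0 : 0 < q by rewrite /q; lra.
pose D := (2 * (d.+1 * d.+1))%N.
pose M := (2 * d.+1 * n)%N.
have qM : y <= pow q M.
  apply: Rle_trans (exp_le_pow_one_minus M (conj p0 p12)).
  rewrite /y; apply: exp_homo; apply: Ropp_le_contravar.
  rewrite /M !INR_natM (S_INR d) (_ : INR 2 = 2) //.
  have : p * ((INR d + 1) * INR n) <= 2 * (p * (INR d * INR n)).
    have : p * ((INR d + 1) * INR n) <= p * (2 * INR d * INR n).
      by apply: Rmult_le_compat_l => //; apply: Rmult_le_compat_r; lra.
    lra.
  lra.
have qD : / pow q D <= exp y.
  have h := exp_le_pow_one_minus D (conj p0 p12).
  have e0 := exp_pos (- (INR D * (2 * p))).
  apply: Rle_trans (_ : / exp (- (INR D * (2 * p))) <= _); first by apply: Rinv_le_contravar.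
  rewrite -exp_Ropp Ropp_involutive; apply: exp_homo.
  rewrite /D !INR_natM (S_INR d) (_ : INR 2 = 2) //.
  (* multiply by k y^2 = 1 *)
  have h1 : p * ((INR d + 1) * (INR d + 1)) <= 2 * (p * INR d * (INR d + 1)).
    have : p * ((INR d + 1) * (INR d + 1)) <= p * (2 * INR d * (INR d + 1)).
      by apply: Rmult_le_compat_l => //; apply: Rmult_le_compat_r; lra.
    lra.
  have h2 : p * INR d * (INR d + 1) <= / 8 * y.
    have -> : p * INR d * (INR d + 1) = p * INR d * (INR k * (INR d + 1)) * (y * y).
      by rewrite -[LHS]Rmult_1_r -kyy; ring.
    apply: (Rle_trans _ (/ 16 * L * (y * y))); first by apply: Rmult_le_compat_r => //; nra.
    lra.
  lra.
have p1 : (p <= 1)%R by apply/RleP; change (p <= 1); lra.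
have p0' : (0 <= p)%R by apply/RleP.
have plt : (p < 1)%R by apply/RltP; change (p < 1); lra.
pose B (i : 'I_k.-1) := exits (block n d i).
have sB i : B i \subset upper_pairs n by apply/subsetP=> ij; rewrite inE => /andP[].
have cB i j : i != j -> (#|B i :&: B j| <= D)%N by apply: card_exitsI.
have mean : INR k.-1 * y <= mean_avoid p B.
  have -> : INR k.-1 * y = (\sum_(i < k.-1) y)%R.
    by rewrite GRing.sumr_const card_ord RmultE INRE mulr_natl.
  apply/RleP; apply: ler_sum => i _; apply/RleP.
  apply: Rle_trans qM _; rewrite -[GRing.exp _ _]RpowE.
  have cM : (#|B i| <= M)%N by apply: card_exits.
  rewrite -(subnKC cM) -[addn _ _]/(Nat.add _ _) pow_add.
  have h1 : 0 <= pow q #|B i| by apply: pow_le; lra.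
  have h2 : pow q (M - #|B i|) <= 1.
    rewrite -(pow1 (M - #|B i|)); apply: pow_incr; rewrite /q; lra.
  rewrite -[X in _ <= X]Rmult_1_r; exact: Rmult_le_compat_l.
have k1 : INR k.-1 = INR k - 1 by rewrite -{2}(prednK (ltnW k2)) S_INR; ring.
have mean0 : (0 < mean_avoid p B)%R by apply/RltP; change (0 < mean_avoid p B); nra.
have main := @second_moment _ _ _ p p0' p1 _ B D sB plt cB mean0.
rewrite prob_unionE.
apply: (Rle_trans _ (bprob (upper_pairs n) p (fun S => [forall i, ~~ [disjoint S & B i]]))).
  apply/RleP; apply: bprob_mono => // S sS hS; apply/forallP=> i; apply: contraL hS.
  exact: isolated_block.
apply: (Rle_trans _ (/ mean_avoid p B + (/ pow q D - 1))).
  by rewrite RpowE; move/RleP: main.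
have h1 : / mean_avoid p B <= 2 * y.
  apply: (Rle_trans _ (/ (INR k.-1 * y))); first by apply: Rinv_le_contravar => //; nra.
  have h : 1 <= 2 * y * (INR k.-1 * y).
    have -> : 2 * y * (INR k.-1 * y) = 2 * (INR k * (y * y)) - 2 * (y * y) by rewrite k1; ring.
    rewrite kyy; nra.
  apply: (Rmult_le_reg_r (INR k.-1 * y)); first by nra.
  by rewrite Rinv_l //; nra.
have := exp_sub1_le (conj (Rlt_le _ _ y0) y1).
lra.
Qed.

Lemma nonhamiltonian_cliques (d k : nat -> nat) :
  (exists N : nat, forall n, (N <= n)%N -> (1 <= d n)%N /\ (k n * (d n + 1) <= n)%N) ->
  (forall M : nat, exists N : nat, forall n, (N <= n)%N -> (M <= k n)%N) ->
  exists H : forall n : nat, rel 'I_n,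
    (forall n, is_graph (H n)) /\
    (exists N : nat, forall n, (N <= n)%N -> alpha (H n) = k n /\ delta (H n) = d n) /\
    (forall p : nat -> R, (forall n, (0 <= p n <= 1)%R) ->
       (exists N : nat, forall n, (N <= n)%N ->
          (p n <= Rinv (IZR 16) * ln (INR (k n)) / (INR (d n) * INR n))%R) ->
       Un_cv (fun n => prob_union (H n) (p n) (fun e => ~~ hamiltonian e)) 1%R).
Proof.
move=> [N0 hdk] hk; exists (fun n => @cliques n (d n) (k n)); split.
  by move=> n; apply: cliques_graph.
split.
  have [N1 hN1] := hk 2%N; exists (maxn N0 N1) => n; rewrite geq_max => /andP[n0 n1].
  have [d1 kdn] := hdk n n0; have k2 := hN1 n n1.
  by rewrite alpha_cliques ?delta_cliques.
move=> p hp [N2 hN2] eps eps0.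
(* Once [k] exceeds [16 / eps ^ 2], the bound [4 * y], that is four over the square root of [k], is
   below [eps]. *)
have [M hM] := INR_unbounded (16 / (eps * eps)).
have [N1 hN1] := hk (maxn 4%N M).
exists (maxn N0 (maxn N1 N2)) => n /ssrnat.leP; rewrite !geq_max => /and3P[n0 n1 n2].
have [d1 kdn] := hdk n n0; have := hN1 n n1; rewrite geq_max => /andP[k4 kM].
have /andP[p0 p1] := hp n.
have hp2 : p n <= / 16 * ln (INR (k n)) / (INR (d n) * INR n).
  by have /RleP := hN2 n n2.
have hb := cliques_hamiltonian_le k4 d1 kdn (elimT RleP p0) hp2.
set y := exp _ in hb.
have rk4 : 4 <= INR (k n) by have := INR_nat_le k4; rewrite /=; lra.
have y0 : 0 < y by apply: exp_pos.
have yy : y * y = / INR (k n).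
  rewrite /y -exp_plus (_ : - (ln (INR (k n)) / 2) + - (ln (INR (k n)) / 2) = - ln (INR (k n))); last by field.
  by rewrite exp_Ropp exp_ln //; lra.
have y4 : 4 * y < eps.
  have rkM : INR M <= INR (k n) by apply: INR_nat_le.
  have h : 16 * (y * y) < eps * eps.
    rewrite yy; apply: (Rmult_lt_reg_r (INR (k n))); first lra.
    rewrite Rmult_assoc Rinv_l; last lra.
    have : 16 / (eps * eps) * (eps * eps) < INR (k n) * (eps * eps) by apply: Rmult_lt_compat_r; nra.
    have -> : 16 / (eps * eps) * (eps * eps) = 16 by field; lra.
    lra.
  nra.
have -> : prob_union (@cliques n (d n) (k n)) (p n) (fun e => ~~ hamiltonian e) =
    1 - prob_union (@cliques n (d n) (k n)) (p n) (@hamiltonian n).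
  by rewrite !prob_unionE bprobC.
have h0 : 0 <= prob_union (@cliques n (d n) (k n)) (p n) (@hamiltonian n).
  by apply/RleP; rewrite prob_unionE; apply: bprob_ge0.
rewrite /Rdist (_ : _ - _ = - prob_union (@cliques n (d n) (k n)) (p n) (@hamiltonian n)); last first.
  by rewrite -[1%R]/1; ring.
by rewrite Rabs_Ropp Rabs_pos_eq //; lra.
Qed.

(** * Numerical estimates for part (a) *)

Lemma INR_gt0 n : (0 < n)%N -> 0 < INR n.
Proof. by move=> /ssrnat.ltP; apply: lt_0_INR. Qed.

Lemma INR_leq m n : INR m <= INR n -> (m <= n)%N.
Proof. by move=> /INR_le/ssrnat.leP. Qed.

Lemma INR_ltn m n : INR m < INR n -> (m < n)%N.
Proof. by move=> /INR_lt/ssrnat.ltP. Qed.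

(** A harmonic sum, compared with the logarithm through [ln x <= x - 1] at [x = z / (z + 1)]. *)
Lemma link_cost_le a h : (0 < h)%N ->
  INR (link_cost a h) <= 4 * INR a * (1 + ln (INR h)) + 2 * INR h.
Proof.
have aux m : INR (4 * (a %/ m.+1) + 2)%N <= 4 * INR a * / (INR m + 1) + 2.
  have m0 : 0 < INR m + 1 by have := pos_INR m; lra.
  have := INR_nat_le (leq_trunc_div a m.+1); move: (a %/ m.+1)%N => b.
  rewrite (INR_natM b) S_INR => h1; rewrite INR_natD INR_natM.
  have -> : INR 4 = 4 by rewrite /=; ring.
  have -> : INR 2 = 2 by [].
  have : INR b <= INR a * / (INR m + 1).
    apply: (Rmult_le_reg_r (INR m + 1)) => //; rewrite Rmult_assoc Rinv_l; lra.
  lra.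
case: h => // h _; elim: h => [|h IH].
  rewrite link_costS /link_cost big_ord0 add0n.
  have := aux 0%N; rewrite [INR 0]/= [INR 1]/= ln_1 Rplus_0_l Rinv_1; lra.
rewrite link_costS INR_natD; have h1 := aux h.+1.
have hp : 0 < INR h.+1 by apply: INR_gt0.
have a0 := pos_INR a.
have step : / (INR h.+1 + 1) <= ln (INR h.+2) - ln (INR h.+1).
  rewrite (S_INR h.+1); set z := INR h.+1 in hp *.
  have q0 : 0 < z / (z + 1) by apply: Rdiv_lt_0_compat; lra.
  have := ln_le q0; rewrite /Rdiv ln_mult ?ln_Rinv //; try lra; last by apply: Rinv_0_lt_compat; lra.
  have -> : z * / (z + 1) - 1 = - / (z + 1) by field; lra.
  lra.
have : 4 * INR a * / (INR h.+1 + 1) <= 4 * INR a * (ln (INR h.+2) - ln (INR h.+1)).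
  by apply: Rmult_le_compat_l => //; lra.
rewrite (S_INR h.+1) in IH step h1 *; lra.
Qed.

Lemma trunc_log_le_ln a : (0 < a)%N -> INR (trunc_log 2 a).+1 <= 1 + 2 * ln (INR a).
Proof.
move=> a0; have h := trunc_logP (isT : (1 < 2)%N) a0.
have ln2 := ln_lt_2.
have : INR (trunc_log 2 a) * ln 2 <= ln (INR a).
  rewrite -ln_pow; last lra.
  have -> : pow 2 (trunc_log 2 a) = INR (2 ^ trunc_log 2 a)%N.
    elim: (trunc_log 2 a) => [|m IHm]; first by [].
    by rewrite expnS INR_natM -IHm /=; ring.
  have : INR (2 ^ trunc_log 2 a)%N <= INR a by apply: INR_nat_le.
  case=> [lt|->]; last by right.
  by left; apply: ln_increasing => //; apply: INR_gt0; rewrite expn_gt0.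
have := pos_INR (trunc_log 2 a); rewrite S_INR; nra.
Qed.

Lemma trunc_log_le a : (trunc_log 2 a <= a)%N.
Proof.
have [->|a0] := posnP a; first by rewrite trunc_log0.
by apply: leq_trans (trunc_logP (isT : (1 < 2)%N) a0); apply: ltnW; apply: ltn_expl.
Qed.

Lemma alpha_gt0 n (e : rel 'I_n) : irreflexive e -> (0 < n)%N -> (0 < alpha e)%N.
Proof.
move=> eirr n0; rewrite -(cards1 (Ordinal n0)); apply: (@leq_bigmax_cond _ _ (fun S : {set 'I_n} => #|S|)).
by apply/indepP=> x y; rewrite !inE => /eqP-> /eqP->; rewrite eirr.
Qed.

Lemma alpha_le n (e : rel 'I_n) : (alpha e <= n)%N.
Proof. by apply/bigmax_leqP=> S _; rewrite -[X in (_ <= X)%N]card_ord max_card. Qed.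

(** The weights replace a count of the pairs [(I, Z)]: the sum factorises into the choice of
    matching and round, a binomial sum over nonempty [I], and one over [Z]. *)
Lemma sum_rect_index n rho t (g w : R) :
  (\sum_(i : rect_index n rho t) (if (0 < #|i.1.2|)%N then g ^+ #|i.1.2| else 0) * w ^+ #|i.2|)%R =
  (2 * INR rho * (((g + 1) ^+ t - 1) * (w + 1) ^+ n))%R.
Proof.
have subs m (x : R) : (\sum_(S : {set 'I_m}) x ^+ #|S| = (x + 1) ^+ m)%R.
  have := sum_subsets_expr [set: 'I_m] x 1%R; rewrite cardsT card_ord => <-.
  by apply: eq_big => [S|S _]; rewrite ?subsetT // expr1n mulr1.
have subs' : (\sum_(I : {set 'I_t}) (if (0 < #|I|)%N then g ^+ #|I| else 0) = (g + 1) ^+ t - 1)%R.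
  rewrite -subs [X in _ = (X - _)%R](bigD1 set0) //= cards0 expr0 addrAC subrr add0r.
  rewrite (bigD1 set0) //= cards0 /= add0r; apply: eq_bigr => I I0.
  by rewrite card_gt0 I0.
rewrite -(pair_bigA _ (fun (j : bool * 'I_rho * {set 'I_t}) (Z : {set 'I_n}) =>
   (if (0 < #|j.2|)%N then g ^+ #|j.2| else 0) * w ^+ #|Z|)%R) /=.
under eq_bigr => j _ do rewrite -big_distrr /= subs.
rewrite -big_distrl /= mulrA; congr (_ * _)%R.
rewrite -(pair_bigA _ (fun (j : bool * 'I_rho) (I : {set 'I_t}) =>
   (if (0 < #|I|)%N then g ^+ #|I| else 0))%R) /=.
under eq_bigr => j _ do rewrite subs'.
rewrite sumr_const card_prod card_bool card_ord INRE -[LHS]mulr_natl natrM.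
by [].
Qed.

Lemma not_pancyclic_le n (e : rel 'I_n) (p : R) : is_graph e -> 4 <= ln (INR n) ->
  100 * (INR (alpha e) * ln (INR n)) ^ 2 < INR (delta e) -> 0 <= p <= 1 ->
  100000 * ln (INR n) * ln (INR (alpha e) * ln (INR n)) / (INR n * INR (delta e)) <= p ->
  prob_union e p (fun H => ~~ pancyclic H) <= 24 / INR n.
Proof.
move=> ge L4 dbig p01 ple.
set L := ln (INR n) in L4 dbig ple *; set a := alpha e in dbig ple *; set d := delta e in dbig ple *.
have n0 : (0 < n)%N.
  (* The logarithm of zero is zero by convention, which contradicts [L4]. *)
  case: (posnP n) => // nz; move: L4; rewrite /L nz /= /ln; case: Rlt_dec => [h|_] h2; lra.
have rn0 : 0 < INR n by apply: INR_gt0.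
have expL : exp L = INR n by rewrite /L exp_ln.
have a0 : (0 < a)%N by apply: alpha_gt0 => //; case: ge.
have ra1 : 1 <= INR a by have := INR_nat_le a0; rewrite /=; lra.
have an : INR a <= INR n by apply: INR_nat_le; apply: alpha_le.
have aL : 4 * INR a <= INR a * L by rewrite Rmult_comm; apply: Rmult_le_compat_l; lra.
have d1600 : 1600 * (INR a * INR a) <= INR d.
  have : (4 * INR a) ^ 2 <= (INR a * L) ^ 2 by apply: pow_incr; lra.
  by rewrite /=; nra.
have daL : 100 * (INR a * INR a * L) <= INR d.
  have : INR a * INR a * L <= (INR a * L) ^ 2.
    have -> : (INR a * L) ^ 2 = INR a * INR a * L * L by ring.
    have : 0 <= INR a * INR a * L by nra.
    nra.
  lra.
set rho := (trunc_log 2 a).+1.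
have rho1 : INR rho <= INR a + 1.
  by rewrite /rho S_INR; have := INR_nat_le (trunc_log_le a); lra.
have rd0 : 0 < INR d by nra.
have lnaL : 0 < ln (INR a * L) by rewrite -ln_1; apply: ln_increasing; lra.
have rho2 : INR rho <= 2 * ln (INR a * L).
  have := trunc_log_le_ln a0; rewrite -/rho ln_mult; try lra.
  have ln4 : 1 / 2 <= ln L.
    have : ln 2 <= ln L by case: (Rle_lt_or_eq_dec 2 L) => [|lt|<-]; [lra|left; apply: ln_increasing; lra|right].
    by have := ln_lt_2; lra.
  lra.
have [||||||t [Af [Bf [K [ta hbad hrect]]]]] := @bad_rectangles n e rho ge a0 n0.
(* By [ln (2 * a) <= 2 * L] the budget is at most [13 * a * L]; after multiplication by [2 * a] it
   stays below [100 * a ^ 2 * L <= d]. *)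
- rewrite leq_divRL; last by rewrite muln_gt0.
  apply: INR_leq; rewrite -/a INR_natM (INR_natD ((2 * a).+1 + 4 * a)%N) (INR_natD (2 * a).+1).
  rewrite (S_INR (2 * a)%N) (INR_natM 2 a) (INR_natM 4 a).
  have h := link_cost_le a (_ : (0 < 2 * a)%N); rewrite muln_gt0 a0 in h; have {h} := h isT.
  rewrite (INR_natM 2 a) (_ : INR 2 = 2) // (_ : INR 4 = 4); last by rewrite /=; ring.
  have : ln (2 * INR a) <= 2 * L.
    rewrite ln_mult; try lra.
    have : ln 2 <= L by have := ln_le (_ : 0 < 2) ; lra.
    have : ln (INR a) <= L.
      by case: an => [lt|->]; [left; apply: ln_increasing; lra|right].
    lra.
  rewrite -/a -/d; set lc := INR (link_cost _ _); set l2 := ln _ => hl2 hlc.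
  have hl3 : INR a * l2 <= INR a * (2 * L) by apply: Rmult_le_compat_l; lra.
  have hl4 : lc <= 8 * (INR a * L) + 8 * INR a by lra.
  have hl5 : 2 * INR a + 1 + 4 * INR a + lc <= 13 * (INR a * L) by lra.
  have : (2 * INR a + 1 + 4 * INR a + lc) * (2 * INR a) <= 13 * (INR a * L) * (2 * INR a).
    by apply: Rmult_le_compat_r; lra.
  by nra.
- rewrite -/a -/d; apply: INR_ltn; rewrite !INR_natM (S_INR (2 * a)%N) INR_natM (_ : INR 2 = 2) //.
  by nra.
- by rewrite /rho ltnW // trunc_log_ltn.
- by [].
- rewrite -/d; apply: INR_leq; rewrite INR_natM.
  have -> : INR 640 = 640 by rewrite INR_IZR_INZ.
  by nra.
- rewrite -/d -/a; apply: INR_leq; rewrite (INR_natD (16 * a + 48)%N) (INR_natD (16 * a)%N) (INR_natM 16) (INR_natM 32) (INR_natM 3).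
  have -> : INR 16 = 16 by rewrite INR_IZR_INZ.
  have -> : INR 48 = 48 by rewrite INR_IZR_INZ.
  have -> : INR 32 = 32 by rewrite INR_IZR_INZ.
  have -> : INR 3 = 3 by rewrite INR_IZR_INZ.
  by nra.
have p0' : (0 <= p)%R by apply/RleP; case: p01.
have p1' : (p <= 1)%R by apply/RleP; case: p01.
pose g := exp (- (5 * L)); pose w := exp (- L).
have g0 : 0 < g by apply: exp_pos.
have w0 : 0 < w by apply: exp_pos.
rewrite prob_unionE.
have h1 := @bprob_union _ _ (upper_pairs n) p p0' p1' _ K _ _ hbad.
have subr i : rect (Af i) (Bf i) \subset upper_pairs n.
  by apply/subsetP=> ij; rewrite inE => /andP[].
apply: Rle_trans (elimT RleP h1) _.
apply: (Rle_trans _ (2 * INR rho * (((g + 1) ^ t - 1) * (w + 1) ^ n))).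
  have := sum_rect_index n rho t g w; rewrite -!RpowE => eqs.
  have {eqs} -> : 2 * INR rho * (((g + 1) ^ t - 1) * (w + 1) ^ n) = (\sum_(i : rect_index n rho t)
      (if (0 < #|i.1.2|)%N then g ^+ #|i.1.2| else 0) * w ^+ #|i.2|)%R by rewrite eqs.
  rewrite big_mkcond; apply/RleP; apply: ler_sum => i _; case: ifP => Ki; last first.
    rewrite mulr_ge0 ?exprn_ge0 //; try by apply/RleP; left.
    by case: ifP => // _; rewrite exprn_ge0 //; apply/RleP; left.
  have [I0 cZ hr] := hrect i Ki; rewrite I0 bprob_avoid // -!RpowE; apply/RleP.
  apply: Rle_trans (pow_one_minus_le_exp _ p01) _.
  change (exp (- (INR #|rect (Af i) (Bf i)| * p)) <= pow g #|i.1.2| * pow w #|i.2|).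
  rewrite /g /w !pow_exp -exp_plus; apply: exp_homo.
  have hZ := INR_nat_le cZ; have hR := INR_nat_le hr; move: hZ hR; rewrite !INR_natM -/d.
  set J := INR #|i.1.2|; set z := INR #|i.2|; set X := INR #|rect _ _|.
  have -> : INR 4096 = 4096 by rewrite INR_IZR_INZ.
  have -> : INR 5 = 5 by rewrite INR_IZR_INZ.
  move=> hZ hR.
  have J0 : 0 <= J by apply: pos_INR.
  have X0 : 0 <= X by apply: pos_INR.
  have nd0 : 0 < INR n * INR d by apply: Rmult_lt_0_compat.
  have rho0 : 0 < INR rho by apply: INR_gt0.
  have hp2 : 100000 * L * ln (INR a * L) <= p * (INR n * INR d).
    apply: (Rle_trans _ (100000 * L * ln (INR a * L) / (INR n * INR d) * (INR n * INR d))).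
      by right; field; split; lra.
    by apply: Rmult_le_compat_r => //; lra.
  have hp3 : 50000 * L * INR rho <= p * (INR n * INR d).
    apply: Rle_trans hp2; have : L * INR rho <= L * (2 * ln (INR a * L)) by apply: Rmult_le_compat_l; lra.
    lra.
  have hX : J * (50000 * L * INR rho) <= 4096 * INR rho * X * p.
    apply: (Rle_trans _ (J * (p * (INR n * INR d)))); first by apply: Rmult_le_compat_l.
    have -> : J * (p * (INR n * INR d)) = J * INR d * INR n * p by ring.
    by apply: Rmult_le_compat_r => //; case: p01.
  have hX2 : J * (50000 * L) <= 4096 * X * p.
    apply: (Rmult_le_reg_r (INR rho)) => //; lra.
  have LJ : 0 <= L * J by apply: Rmult_le_pos; lra.
  have Lz : L * z <= L * (5 * J) by apply: Rmult_le_compat_l; lra.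
  lra.
have nw : INR n * w = 1 by rewrite /w exp_Ropp expL Rinv_r //; lra.
have w1 : w <= 1 / 5 by have := exp_ineq1_le L; rewrite expL; nra.
have gw : g = w * w * w * w * w.
  by rewrite /g /w -!exp_plus; congr exp; ring.
have hwn : (w + 1) ^ n <= 3.
  apply: (Rle_trans _ (exp w ^ n)).
    by apply: pow_incr; have := exp_ineq1_le w; lra.
  by rewrite pow_exp nw; apply: exp_le_3.
have tn : INR t <= INR n by apply: Rle_trans an; apply: INR_nat_le.
have ww : 0 < w * w by nra.
have w4 : 0 < w * w * w * w by nra.
have tg : INR t * g <= w * w * w * w.
  apply: (Rle_trans _ (INR n * g)); first by apply: Rmult_le_compat_r; lra.
  rewrite gw; right.
  have -> : INR n * (w * w * w * w * w) = INR n * w * (w * w * w * w) by ring.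
  by rewrite nw; ring.
have t0 := pos_INR t.
have tg0 : 0 <= INR t * g by apply: Rmult_le_pos; lra.
have w2 : w * w <= w by nra.
have w3 : w * w * w <= w * w.
  by rewrite -[X in _ <= X]Rmult_1_r; apply: Rmult_le_compat_l; lra.
have w30 : 0 < w * w * w by apply: Rmult_lt_0_compat.
have w4le : w * w * w * w <= w.
  apply: (Rle_trans _ (w * w * w)); last by lra.
  by rewrite -[X in _ <= X]Rmult_1_r; apply: Rmult_le_compat_l; lra.
have hgt : (g + 1) ^ t - 1 <= 2 * (w * w * w * w).
  apply: (Rle_trans _ (exp (INR t * g) - 1)).
    have : (g + 1) ^ t <= exp g ^ t by apply: pow_incr; have := exp_ineq1_le g; lra.
    by rewrite pow_exp; lra.
  by have := @exp_sub1_le (INR t * g); lra.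
have hgt0 : 0 <= (g + 1) ^ t - 1.
  have : 1 ^ t <= (g + 1) ^ t by apply: pow_incr; lra.
  by rewrite pow1; lra.
have rho3 : 0 <= INR rho <= 2 * INR n by split; [apply: pos_INR|lra].
have hwn0 : 0 <= (w + 1) ^ n by apply: pow_le; lra.
have s1 : ((g + 1) ^ t - 1) * (w + 1) ^ n <= 2 * (w * w * w * w) * 3 by apply: Rmult_le_compat.
have s2 : 0 <= ((g + 1) ^ t - 1) * (w + 1) ^ n by apply: Rmult_le_pos.
apply: (Rle_trans _ (2 * (2 * INR n) * (2 * (w * w * w * w) * 3))).
  by apply: Rmult_le_compat => //; lra.
have -> : 2 * (2 * INR n) * (2 * (w * w * w * w) * 3) = 24 * (INR n * w) * (w * w * w) by ring.
rewrite nw (_ : 24 / INR n = 24 * w); last by rewrite /w exp_Ropp expL.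
nra.
Qed.

Lemma perturbed_pancyclic (G : forall n : nat, rel 'I_n) (p : nat -> R) :
  (forall n, is_graph (G n)) -> (forall n, (0 <= p n <= 1)%R) ->
  (exists N : nat, forall n, (N <= n)%N ->
     (INR (delta (G n)) > IZR 100 * (INR (alpha (G n)) * ln (INR n)) ^ 2)%R) ->
  (exists N : nat, forall n, (N <= n)%N ->
     (p n >= IZR 100000 * ln (INR n) * ln (INR (alpha (G n)) * ln (INR n))
             / (INR n * INR (delta (G n))))%R) ->
  Un_cv (fun n => prob_union (G n) (p n) (@pancyclic n)) 1%R.
Proof.
move=> gG hp [N1 hN1] [N2 hN2] eps eps0.
have [M1 hM1] := INR_unbounded (exp 4); have [M2 hM2] := INR_unbounded (24 / eps).
exists (maxn (maxn N1 N2) (maxn M1 M2)) => n /ssrnat.leP; rewrite !geq_max => /andP[/andP[n1 n2] /andP[m1 m2]].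
have hn1 := INR_nat_le m1; have hn2 := INR_nat_le m2.
have e4 := exp_pos 4.
have L4 : 4 <= ln (INR n) by rewrite -(ln_exp 4); left; apply: ln_increasing; lra.
have /andP[/RleP q0 /RleP q1] := hp n.
have hd : 100 * (INR (alpha (G n)) * ln (INR n)) ^ 2 < INR (delta (G n)).
  by have /RltP := hN1 n n1; rewrite -exprnP -RpowE.
have hb := @not_pancyclic_le n (G n) (p n) (gG n) L4 hd (conj q0 q1).
have {}hb : prob_union (G n) (p n) (fun H => ~~ pancyclic H) <= 24 / INR n.
  by apply: hb; have /RleP := hN2 n n2.
have e2 : prob_union (G n) (p n) (fun H => ~~ pancyclic H) = 1 - prob_union (G n) (p n) (@pancyclic n).
  by rewrite !prob_unionE bprobC.
have h0 : 0 <= prob_union (G n) (p n) (fun H => ~~ pancyclic H).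
  by apply/RleP; rewrite prob_unionE; apply: bprob_ge0; apply/RleP.
have small : 24 / INR n < eps.
  have i0 : 0 < INR n by lra.
  apply: (Rmult_lt_reg_r (INR n)) => //; rewrite /Rdiv Rmult_assoc Rinv_l; last lra.
  have : 24 / eps * eps < INR n * eps by apply: Rmult_lt_compat_r; lra.
  have -> : 24 / eps * eps = 24 by field; lra.
  lra.
rewrite /Rdist (_ : _ - _ = - prob_union (G n) (p n) (fun H => ~~ pancyclic H)); last first.
  by rewrite e2 -[1%R]/1; ring.
by rewrite Rabs_Ropp Rabs_pos_eq //; lra.
Qed.

Local Close Scope R_scope.

Theorem theorem1p3 :
  exists c1 c2 c3 : R, (0 < c1)%R /\ (0 < c2)%R /\ (0 < c3)%R /\
  (* (a) *)
  (forall (G : forall n : nat, rel 'I_n) (p : nat -> R),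
     (forall n, is_graph (G n)) ->
     (forall n, (0 <= p n <= 1)%R) ->
     (exists (C : R) (N : nat), forall n, (N <= n)%N ->
        (INR (alpha (G n) * delta (G n)) <= C * INR n)%R) ->
     (exists N : nat, forall n, (N <= n)%N ->
        (INR (delta (G n)) > c1 * (INR (alpha (G n)) * ln (INR n)) ^ 2)%R) ->
     (exists N : nat, forall n, (N <= n)%N ->
        (p n >= c2 * ln (INR n) * ln (INR (alpha (G n)) * ln (INR n))
                / (INR n * INR (delta (G n))))%R) ->
     Un_cv (fun n => prob_union (G n) (p n) (@pancyclic n)) 1%R)
  /\
  (* (b) *)
  (forall d k : nat -> nat,
     (exists N : nat, forall n, (N <= n)%N ->
        (1 <= d n)%N /\ (k n * (d n + 1) <= n)%N) ->
     (forall M : nat, exists N : nat, forall n, (N <= n)%N -> (M <= k n)%N) ->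
     exists H : forall n : nat, rel 'I_n,
       (forall n, is_graph (H n)) /\
       (exists N : nat, forall n, (N <= n)%N ->
          alpha (H n) = k n /\ delta (H n) = d n) /\
       (forall p : nat -> R,
          (forall n, (0 <= p n <= 1)%R) ->
          (exists N : nat, forall n, (N <= n)%N ->
             (p n <= c3 * ln (INR (k n)) / (INR (d n) * INR n))%R) ->
          Un_cv (fun n => prob_union (H n) (p n) (fun e => ~~ hamiltonian e)) 1%R)).
Proof.
exists (IZR 100), (IZR 100000), (Rinv (IZR 16)).
split; first by apply/RltP; apply: IZR_lt.
split; first by apply/RltP; apply: IZR_lt.
split; first by apply/RltP; apply: Rinv_0_lt_compat; apply: IZR_lt.
split; last exact: nonhamiltonian_cliques.
by move=> G p gG hp _; apply: perturbed_pancyclic.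
Qed.
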